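(* Let $a>1/2$ be a real number and put $\alpha=1/a\in(0,2)$. Let $G_1<G_2<\cdots$ be the successive arrival times of a Poisson process on $(0,\infty)$ with intensity $1$, and set $G_0:=1$. Let $\varepsilon_1,\varepsilon_2,\ldots$ be independent identically distributed real random variables, the sequence $(\varepsilon_n)_{n\ge 1}$ being independent of the Poisson process. Define the process $(X_n)_{n\ge 0}$ by $$X_0=1,\qquad X_n=\Bigl(\frac{G_n}{G_{n-1}}\Bigr)^a X_{n-1}+\varepsilon_n,\quad n=1,2,\ldots$$ Suppose that the distribution of $\varepsilon_n$ is symmetric (i.e. $\varepsilon_n$ and $-\varepsilon_n$ have the same distribution) and that $\mathbb{E}|\varepsilon_n|^{\alpha}<\infty$. Then $X_n/n^a$ converges in distribution as $n\to\infty$, and the limit distribution is the stable distribution with index of stability $\alpha=1/a$, skewness parameter $\beta=0$, location parameter $1$, and scale parameter $$\sigma=\Bigl(\frac{\mathbb{E}|\varepsilon_1|^{\alpha}}{c_\alpha}\Bigr)^{a},\qquad\text{where } c_\alpha=\frac{1-\alpha}{\Gamma(2-\alpha)\cos(\pi\alpha/2)}\ \text{ for } \alpha\neq 1,\qquad c_1=\frac{2}{\pi}.$$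
   Context: The arrival times of a Poisson process of intensity $1$ are $G_n=E_1+\cdots+E_n$, where $E_1,E_2,\ldots$ are i.i.d. exponential random variables with mean $1$. Stable distributions are parametrized in the standard way of Samorodnitsky and Taqqu: the stable distribution with index $\alpha\in(0,2)$, scale $\sigma\ge 0$, skewness $\beta=0$ and location $\mu\in\mathbb{R}$ is the probability law on $\mathbb{R}$ with characteristic function $t\mapsto \exp\bigl(i\mu t-\sigma^{\alpha}|t|^{\alpha}\bigr)$ (for $\sigma=0$ this is the point mass at $\mu$). Here $\Gamma$ denotes the Gamma function. *)

(* Defs.v *)
From HB Require Import structures.
From mathcomp Require Import all_boot all_order all_algebra.
From mathcomp Require Import all_classical all_reals all_analysis.
From mathcomp Require Import measurable_realfun complex.
Import numFieldNormedType.Exports.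

Set Implicit Arguments.
Unset Strict Implicit.
Unset Printing Implicit Defensive.

Import Order.TTheory GRing.Theory Num.Theory.

Local Open Scope classical_set_scope.
Local Open Scope ring_scope.

Section real_functions.
Context {R : realType}.

(* Only meaningful for s > 0, where the integral converges. *)
Definition Gamma (s : R) : R :=
  \int[lebesgue_measure]_(x in `]0, +oo[) (x `^ (s - 1) * expR (- x)).

(* The constant 1 / \int_0^oo x^(-alpha) sin x dx of Samorodnitsky and Taqqu, in
   closed form. *)
Definition stable_c (alpha : R) : R :=
  if alpha == 1 then 2 / pi
  else (1 - alpha) / (Gamma (2 - alpha) * cos (pi * alpha / 2)).

Definition cexp (z : R[i]) : R[i] :=
  ((expR (complex.Re z))%:C * (cos (complex.Im z) +i* sin (complex.Im z)))%C.

End real_functions.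

Section laws_on_R.
Context {R : realType}.
Implicit Types mu nu : set R -> \bar R.

(* Measures are total functions on sets, hence the restriction to measurable
   sets. *)
Definition same_law mu nu := forall A : set R, measurable A -> mu A = nu A.

(* The expectation of exp(itx), the complex integral being taken
   componentwise. *)
Definition char_fun (mu : probability R R) (t : R) : R[i] :=
  ((\int[mu]_x complex.Re (cexp ('i%C * (t * x)%:C%C))) +i*
   (\int[mu]_x complex.Im (cexp ('i%C * (t * x)%:C%C))))%C.

(* The law with index alpha, scale sigma, skewness 0 and location m; note that
   0 `^ alpha = 0 for alpha != 0, so that sigma = 0 gives a point mass. *)
Definition symmetric_stable (alpha sigma m : R) (mu : probability R R) :=
  forall t : R, char_fun mu t =
    cexp ('i%C * (m * t)%:C%C - (sigma `^ alpha * `|t| `^ alpha)%:C%C).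

End laws_on_R.

Section random_sequences.
Context {d} {T : measurableType d} {R : realType} (P : probability T R).

Definition mutually_independent (X : nat -> T -> R) :=
  forall (s : seq nat) (A : nat -> set R), uniq s ->
    (forall i, measurable (A i)) ->
    P (\bigcap_(i in [set` s]) X i @^-1` A i) =
    (\prod_(i <- s) P (X i @^-1` A i))%E.

Definition sigma_of_sequence (X : nat -> T -> R) : set (set T) :=
  <<s \bigcup_n preimage_set_system setT (X n) measurable >>.

Definition independent_sequences (X Y : nat -> T -> R) :=
  forall A B, sigma_of_sequence X A -> sigma_of_sequence Y B ->
    P (A `&` B) = (P A * P B)%E.

Definition iid (X : nat -> {RV P >-> R}) :=
  mutually_independent X /\
  forall m n, same_law (distribution P (X m)) (distribution P (X n)).

(* Weak convergence of the laws: test against bounded continuous functions. *)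
Definition cvg_in_distribution (X : nat -> {RV P >-> R})
    (mu : probability R R) :=
  forall f : R -> R, continuous f -> (exists M : R, forall x, `|f x| <= M) ->
    'E_P[f \o X n]%E @[n --> \oo] --> (\int[mu]_x (f x)%:E)%E.

End random_sequences.
Arguments iid {d T R} P X.
Arguments cvg_in_distribution {d T R} P X mu.

Section process.
Context {d} {T : measurableType d} {R : realType}.
Implicit Types E eps : nat -> {mfun T >-> R}.

(* The n-th arrival time is the sum of the first n interarrival times
   E 0, ..., E (n - 1); the 0-th one is set to 1, not to the empty sum. *)
Definition arrival_time E (n : nat) (w : T) : R :=
  if n is 0 then 1 else \sum_(k < n) E k w.

(* The innovation entering at time n >= 1 is eps (n - 1). *)
Fixpoint process (a : R) E eps (n : nat) (w : T) : R :=
  if n is m.+1 then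
    (arrival_time E m.+1 w / arrival_time E m w) `^ a * process a E eps m w
      + eps m w
  else 1.

Lemma measurable_arrival_time E n : measurable_fun setT (arrival_time E n).
Proof.
case: n => [|n]; first exact: measurable_cst.
by apply: measurable_sum => k; exact: measurable_funPT.
Qed.

HB.instance Definition _ E n :=
  isMeasurableFun.Build _ _ _ _ (arrival_time E n) (measurable_arrival_time E n).

Lemma measurable_invr : measurable_fun [set: R] (@GRing.inv R).
Proof.
rewrite (_ : [set: R] = [set 0] `|` [set x | x != 0]); last first.
  by apply/seteqP; split => x //= _; have [|] := eqVneq x 0; [left|right].
have o0 : open [set x : R | x != 0] by exact: open_neq.
apply/measurable_funU => //; first exact: open_measurable.
split; first exact: measurable_fun_set1.
apply: open_continuous_measurable_fun => // x.
by rewrite inE => /= x0; exact: inv_continuous.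
Qed.

Lemma measurable_process (a : R) E eps n :
  measurable_fun setT (process a E eps n).
Proof.
elim: n => [|n IH]; first exact: measurable_cst.
apply: measurable_funD; last exact: measurable_funPT.
apply: measurable_funM => //.
apply: (measurableT_comp (measurable_powR a)).
apply: measurable_funM; first exact: measurable_arrival_time.
exact: measurableT_comp measurable_invr (measurable_arrival_time E n).
Qed.

HB.instance Definition _ (a : R) E eps n :=
  isMeasurableFun.Build _ _ _ _ (process a E eps n)
    (measurable_process a E eps n).

End process.

(* Main.v *)
(* Write G_n for the arrival times and S_n for the sum of eps_k G_k^(-a) over
   k <= n. Almost surely X_n = G_n^a (1 + S_n) and G_n / n -> 1, so X_n / n^a has the
   same limit law as 1 + S_n. Let e_t(g) be the exponential of minus the integral
   over s > g of 1 - E cos(t eps s^(-a)). Conditioning on the next interarrival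
   time gives an integral equation for e_t, and, as eps is symmetric, it makes
   cos(om + t S_n) e_t(G_n) a martingale. Since e_t(G_n) -> 1, it follows that
   E cos(om + t S_n) -> cos(om) e_t(0). The scaling s -> |y|^alpha s gives
   e_t(0) = exp(- |t|^alpha E|eps|^alpha / c_alpha), once the integral of
   alpha (1 - cos x) x^(-alpha-1) over (0, oo) is known to be 1 / c_alpha; that
   value comes from rotating the half-line in the Gamma integral.

   The same identity started at G_n bounds 1 - E cos(t (S_m - S_n)), and
   integrating this against e^(-t) bounds E D^2 / (1 + D^2) for D = S_m - S_n, so S_n is
   Cauchy in probability. A subsequence N_j then converges almost surely to some S
   (the limit law is that of 1 + S), and so does S_(m_j) whenever m_j >= N_j; this
   suffices for the convergence in law of the whole sequence. *)

From HB Require Import structures.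
Require Import Defs.
From mathcomp Require Import all_boot all_order all_algebra.
From mathcomp Require Import all_classical all_reals all_analysis.
From mathcomp Require Import measurable_realfun complex.
From mathcomp Require Import ring lra zify.
Import numFieldNormedType.Exports.
Import Order.TTheory GRing.Theory Num.Theory.
Local Open Scope classical_set_scope.
Local Open Scope ring_scope.

(** Conditioning on Poisson points and Campbell's formula are avoided: each step integrates out a
    single variable, and only the constancy of the martingale's mean is used. For alpha >= 1 the
    series of shocks need not converge absolutely, so S cannot come from termwise bounds; the
    cancellation comes from the symmetry of eps, which removes the sine terms. The bound 1 - cos(tx)
    <= 2 (1 + t^2) x^2 / (1 + x^2) separates t from x, which is what makes the integration against
    e^(-t) possible.

    No continuity theorem for characteristic functions is needed: the characteristic function only
    identifies the law of S, and the convergence in law is dominated convergence along almost surely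
    convergent sequences. Likewise G_n / n -> 1 is shown only along sparse sequences, from Laplace
    transforms. The phase om lets real cosines carry both parts of the characteristic function.
    Rotation determines the stable constant only up to a factor 1 - alpha, so alpha = 1 needs its
    own computation. *)

Set Implicit Arguments.
Unset Strict Implicit.
Unset Printing Implicit Defensive.

(** * Integration on half-lines *)

Section half_line.
Context {R : realType}.
Notation mu := (@lebesgue_measure R).
Implicit Types (f F : R -> R) (a A B : R).

Lemma measurable_oy a : measurable (`]a, +oo[%classic : set (measurableTypeR R)).
Proof. exact: measurable_itv. Qed.

Lemma measurable_fun_oy f a :
  (forall x, a < x -> {for x, continuous f}) -> measurable_fun `]a, +oo[ f.
Proof.
move=> cf; apply: open_continuous_measurable_fun => //.
by move=> x; rewrite inE/= in_itv/= andbT => /cf.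
Qed.

(** With n + 2 in place of n + 1 the first interval is already nondegenerate, as [FTC_segment]
    requires. *)
Lemma bigcup_itv_oy a :
  \bigcup_n `[a + n.+2%:R^-1, a + n.+2%:R]%classic = `]a, +oo[%classic.
Proof.
apply/seteqP; split=> x /=.
  case=> n _; rewrite /= !in_itv/= andbT => /andP[h _].
  by rewrite (lt_le_trans _ h)// ltrDl.
rewrite in_itv/= andbT -subr_gt0 => ax.
have [n1 _ /(_ _ (leqnn _)) h1] := near_infty_natSinv_lt (PosNum ax).
have [n2 _ /(_ _ (leqnn _)) h2] := nbhs_infty_ger (x - a).
exists (n1 + n2)%N => //=; rewrite in_itv/=; apply/andP; split.
  rewrite -lerBrDl; apply: le_trans (ltW h1); rewrite lef_pV2 ?posrE//.
  by rewrite ler_nat; lia.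
by rewrite -lerBlDl (le_trans h2)// ler_nat; lia.
Qed.

Lemma FTC_segment f F a u v : a < u -> u < v ->
  (forall x, a < x -> {for x, continuous f}) ->
  (forall x, a < x -> is_derive x 1 F (f x)) ->
  (\int[mu]_(x in `[u, v]) (f x)%:E = (F v - F u)%:E)%E.
Proof.
move=> au uv cf dF.
have cF x : a < x -> {for x, continuous F}.
  by move=> /dF [+ _] => /derivable1_diffP; exact: differentiable_continuous.
rewrite EFinB; apply: continuous_FTC2 => //.
- apply: continuous_in_subspaceT => x; rewrite inE/= in_itv/= => /andP[ux _].
  exact/cf/(lt_le_trans au).
- split.
  + by move=> x; rewrite in_itv/= => /andP[ux _]; case: (dF x (lt_trans au ux)).
  + exact/cvg_at_right_filter/cF.
  + exact/cvg_at_left_filter/cF/(lt_trans au).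
- move=> x; rewrite in_itv/= => /andP[ux _].
  by rewrite derive1E; case: (dF x (lt_trans au ux)).
Qed.

Lemma lt_itv_oy a n : a + n.+2%:R^-1 < a + n.+2%:R.
Proof. by rewrite ltrD2l (@lt_trans _ _ 1)// ?invf_lt1 ?ltr1n. Qed.

Lemma cvg_exhaustion_oy F a A B :
  F x @[x --> a^'+] --> A -> F x @[x --> +oo] --> B ->
  (F (a + n.+2%:R) - F (a + n.+2%:R^-1))%:E @[n --> \oo] --> (B - A)%:E.
Proof.
move=> FA FB; apply: cvg_EFin; first exact: nearW.
apply: cvgB.
  move/cvg_pinftyP : FB; apply.
  apply/cvgryPge => r; near=> n.
  rewrite -lerBlDl (@le_trans _ _ n%:R) ?ler_nat ?leqW//.
  by near: n; exact: nbhs_infty_ger.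
move/cvg_at_rightP : FA; apply; split => [n|]; first by rewrite ltrDl.
rewrite -[X in _ --> X]addr0; apply: cvgD; first exact: cvg_cst.
by have := @cvg_harmonic R; rewrite -cvg_shiftS.
Unshelve. all: by end_near. Qed.

Lemma nd_exhaustion_oy a :
  nondecreasing_seq (fun n => `[a + n.+2%:R^-1, a + n.+2%:R]%classic : set R).
Proof.
move=> m n mn; apply/subsetPset; apply: subset_itv; rewrite bnd_simp lerD2l.
  by rewrite lef_pV2 ?posrE// ler_nat.
by rewrite ler_nat.
Qed.

(** Monotone convergence along the exhaustion by compact intervals. Integrability is not assumed; it
    is read off from the finite value in the next lemma. *)
Lemma ge0_FTC_oy f F a A B :
  (forall x, a < x -> 0 <= f x) ->
  (forall x, a < x -> {for x, continuous f}) ->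
  (forall x, a < x -> is_derive x 1 F (f x)) ->
  F x @[x --> a^'+] --> A -> F x @[x --> +oo] --> B ->
  (\int[mu]_(x in `]a, +oo[) (f x)%:E = (B - A)%:E)%E.
Proof.
move=> f0 cf dF FA FB; have mf := measurable_fun_oy cf.
rewrite -bigcup_itv_oy.
have := @ge0_nondecreasing_set_cvg_integral _ (measurableTypeR R) R
  (fun n => `[a + n.+2%:R^-1, a + n.+2%:R]%classic) (EFin \o f) mu.
move=> /(_ (nd_exhaustion_oy a)) H.
have FBA : (\int[mu]_(x in `[(a + n.+2%:R^-1)%R, (a + n.+2%:R)%R]) (f x)%:E)%E
    @[n --> \oo] --> (B - A)%:E.
  rewrite (_ : (fun n => _) = fun n => (F (a + n.+2%:R) - F (a + n.+2%:R^-1))%:E).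
    exact: cvg_exhaustion_oy.
  apply/funext => n; apply: (@FTC_segment _ _ a) => //; first by rewrite ltrDl.
  exact: lt_itv_oy.
apply: (@cvg_unique _ (@ereal_hausdorff R) _ _ _ _ _ FBA).
have sub n : `[a + n.+2%:R^-1, a + n.+2%:R]%classic `<=` `]a, +oo[%classic.
  by rewrite -bigcup_itv_oy => x xn; exists n.
apply: H => [n|n|n x]; [exact: measurable_itv| |]; first by apply/measurable_EFinP;
  apply: measurable_funS (sub n) mf.
by move/sub; rewrite /= in_itv/= andbT lee_fin => /f0.
Qed.

Lemma ge0_FTC_oy_integrable f F a A B :
  (forall x, a < x -> 0 <= f x) ->
  (forall x, a < x -> {for x, continuous f}) ->
  (forall x, a < x -> is_derive x 1 F (f x)) ->
  F x @[x --> a^'+] --> A -> F x @[x --> +oo] --> B ->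
  mu.-integrable `]a, +oo[ (EFin \o f).
Proof.
move=> f0 cf dF FA FB; apply/integrableP; split.
  by apply/measurable_EFinP; exact: measurable_fun_oy.
rewrite (_ : integral _ _ _ = (B - A)%:E) ?ltry//.
rewrite -(ge0_FTC_oy f0 cf dF FA FB); apply: eq_integral => x.
by rewrite inE/= in_itv/= andbT => /f0 ?; rewrite ger0_norm.
Qed.

(** For a signed integrand the exhaustion is passed to the limit by dominated convergence with bound
    |f|, hence the integrability hypothesis. *)
Lemma FTC_oy f F a A B :
  (forall x, a < x -> {for x, continuous f}) ->
  (forall x, a < x -> is_derive x 1 F (f x)) ->
  F x @[x --> a^'+] --> A -> F x @[x --> +oo] --> B ->
  mu.-integrable `]a, +oo[ (EFin \o f) ->
  \int[mu]_(x in `]a, +oo[) f x = B - A.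
Proof.
move=> cf dF FA FB intf; have mf := measurable_fun_oy cf.
pose D n := `[a + n.+2%:R^-1, a + n.+2%:R]%classic : set R.
have mD n : measurable (D n) by exact: measurable_itv.
have DS n : D n `<=` `]a, +oo[%classic.
  by rewrite -bigcup_itv_oy => x xn; exists n.
have [|||||_ _] := @dominated_convergence _ _ _ mu `]a, +oo[%classic
    (measurable_itv _) (fun n => (EFin \o f) \_ (D n)) (EFin \o f) (abse \o EFin \o f).
- move=> n; apply: (measurable_restrict _ _ _).1 => //; first exact: measurable_itv.
  by apply/measurable_EFinP; apply: measurable_funS mf => //; exact: subIsetl.
- by apply/measurable_EFinP.
- apply/aeW => x; rewrite -bigcup_itv_oy => -[k _ xk].
  apply: cvg_near_cst; exists k => // n/= kn.
  have /subsetPset/(_ _ xk) xn := nd_exhaustion_oy a kn.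
  by apply/esym; rewrite patchE mem_set.
- exact: integrable_abse.
- apply/aeW => x n _; rewrite patchE; case: ifPn => //= _.
  by rewrite lee_fin normr0.
move=> H; rewrite /Rintegral.
suff -> : (\int[mu]_(x in `]a, +oo[) (f x)%:E = (B - A)%:E)%E by [].
apply: (@cvg_unique _ (@ereal_hausdorff R) _ _ _ _ H).
rewrite (_ : [sequence _]_n = fun n => (F (a + n.+2%:R) - F (a + n.+2%:R^-1))%:E).
  exact: cvg_exhaustion_oy.
apply/funext => n; rewrite [LHS]/= -integral_mkcondr setIidr//.
apply: (@FTC_segment _ _ a) => //; first by rewrite ltrDl.
exact: lt_itv_oy.
Qed.

End half_line.

Section Rintegral_dominated.
Context d (T : measurableType d) (R : realType) (mu : {measure set T -> \bar R}).
Variables (D : set T) (f_ : nat -> T -> R) (f g : T -> R).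
Hypothesis mD : measurable D.

Lemma Rintegral_dominated_cvg :
  (forall n, measurable_fun D (f_ n)) -> measurable_fun D f ->
  {ae mu, forall x, D x -> f_ ^~ x @ \oo --> f x} ->
  mu.-integrable D (EFin \o g) ->
  (forall n x, D x -> `|f_ n x| <= g x) ->
  \int[mu]_(x in D) f_ n x @[n --> \oo] --> \int[mu]_(x in D) f x.
Proof.
move=> mf_ mf f_f ig f_g.
have [|||||/integrable_fin_num fi _ H] := @dominated_convergence _ _ _ mu D mD
    (fun n => EFin \o f_ n) (EFin \o f) (EFin \o g).
- by move=> n; apply/measurable_EFinP.
- by apply/measurable_EFinP.
- apply: filterS f_f => x /[apply] fx.
  by apply: cvg_EFin => //; exact: nearW.
- exact: ig.
- by apply/aeW => x n Dx; rewrite /= lee_fin f_g.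
by apply: fine_cvg; rewrite fineK// fi.
Qed.

End Rintegral_dominated.

Section integrable_real.
Context d (T : measurableType d) (R : realType) (mu : {measure set T -> \bar R}).
Variables (D : set T) (f g : T -> R).
Hypothesis mD : measurable D.

Lemma integrable_fD : mu.-integrable D (fun x => (f x)%:E) ->
  mu.-integrable D (fun x => (g x)%:E) ->
  mu.-integrable D (fun x => (f x + g x)%:E).
Proof. exact: integrableD. Qed.

Lemma integrable_fB : mu.-integrable D (fun x => (f x)%:E) ->
  mu.-integrable D (fun x => (g x)%:E) ->
  mu.-integrable D (fun x => (f x - g x)%:E).
Proof. exact: integrableB. Qed.

Lemma integrable_fZl (k : R) : mu.-integrable D (fun x => (f x)%:E) ->
  mu.-integrable D (fun x => (k * f x)%:E).
Proof. exact: integrableZl. Qed.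

End integrable_real.

Section tonelli_on.
Context d1 d2 (T1 : measurableType d1) (T2 : measurableType d2) (R : realType).
Variables (m1 : {sigma_finite_measure set T1 -> \bar R})
  (m2 : {sigma_finite_measure set T2 -> \bar R}).

(** Extending f by 0 outside the rectangle reduces this to the whole product space, and the sign of
    f matters on the rectangle only. *)
Lemma tonelli_on (A : set T1) (B : set T2) (f : T1 * T2 -> R) :
  measurable A -> measurable B -> measurable_fun setT f ->
  (forall x y, A x -> B y -> 0 <= f (x, y)) ->
  (\int[m1]_(x in A) \int[m2]_(y in B) (f (x, y))%:E =
   \int[m2]_(y in B) \int[m1]_(x in A) (f (x, y))%:E)%E.
Proof.
move=> mA mB mf f0; pose g := (EFin \o f) \_ (A `*` B).
have gE x y : g (x, y) = if (x \in A) && (y \in B) then (f (x, y))%:E else 0%E.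
  by rewrite /g patchE in_setX.
have mg : measurable_fun setT g.
  apply/(measurable_restrict _ _ _).1 => //; first exact: measurableX.
  by apply/measurable_EFinP; apply: measurable_funTS.
have g0 z : (0 <= g z)%E.
  case: z => x y; rewrite gE; case: ifPn => // /andP[/set_mem Ax /set_mem By].
  by rewrite lee_fin f0.
transitivity (\int[m1]_x \int[m2]_y g (x, y))%E.
  rewrite integral_mkcond; apply: eq_integral => x _; rewrite patchE.
  case: ifPn => xA; last by rewrite integral0_eq// => y _; rewrite gE (negbTE xA).
  by rewrite integral_mkcond; apply: eq_integral => y _; rewrite gE xA patchE.
rewrite fubini_tonelli// [RHS]integral_mkcond; apply: eq_integral => y _; rewrite patchE.
case: ifPn => yB; last by rewrite integral0_eq// => x _; rewrite gE (negbTE yB) andbF.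
by rewrite [RHS]integral_mkcond; apply: eq_integral => x _; rewrite gE yB andbT patchE.
Qed.

End tonelli_on.

Section tail_integral.
Context {R : realType}.
Notation mu := (@lebesgue_measure R).
Variables (f : R -> R) (a : R).
Hypothesis intf : mu.-integrable `]a, +oo[ (EFin \o f).

Let tail x := \int[mu]_(t in `]x, +oo[) f t.

(** Treats both limits at once: c = true when u decreases to a from the right, so that the indicator
    of ]u n, +oo[ tends to 1, and c = false when u tends to infinity and the indicator tends to
    0. *)
Lemma cvg_tail_integral_seq (u : nat -> R) (c : bool) :
  (forall n, a <= u n) -> (forall x, a < x -> \forall n \near \oo, (u n < x) = c) ->
  tail (u n) @[n --> \oo] --> (if c then tail a else 0).
Proof.
move=> au uc; have mf : measurable_fun `]a, +oo[ f.
  by apply/measurable_EFinP; exact: measurable_int intf.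
have uS n : `]u n, +oo[ `<=` `]a, +oo[%classic.
  by apply: subset_itvr; rewrite bnd_simp.
rewrite (_ : (fun n => tail (u n)) = fun n =>
    \int[mu]_(t in `]a, +oo[) (f \_ `]u n, +oo[) t); last first.
  by apply/funext => n; rewrite -Rintegral_mkcondr setIidr.
rewrite (_ : (if c then _ else _) =
    \int[mu]_(t in `]a, +oo[) (if c then f t else 0)); last first.
  by case: c {uc} => //; rewrite /Rintegral integral0.
apply: (@Rintegral_dominated_cvg _ _ _ mu _ (fun n => f \_ `]u n, +oo[)
  (fun t => if c then f t else 0) (Num.norm \o f)) => //.
- move=> n; apply: (measurable_restrict _ _ _).1 => //.
  by apply: measurable_funS mf => //; exact: subIsetl.
- by case: c {uc}.
- apply/aeW => x/=; rewrite in_itv/= andbT => /uc[k _ uk].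
  apply: cvg_near_cst; exists k => // n/= /uk.
  by rewrite patchE mem_setE in_itv/= andbT => ->.
- exact: integrable_norm.
- move=> n x _; rewrite patchE; case: ifPn => //= _; by rewrite normr0.
Qed.

Lemma cvg_tail_integral_right : tail x @[x --> a^'+] --> tail a.
Proof.
apply/cvg_at_rightP => u [ua cu].
apply: (cvg_tail_integral_seq (c := true)) => [n|x ax]; first exact/ltW/ua.
by near=> n; apply/idP; near: n; exact: (cvgr_lt _ cu).
Unshelve. all: by end_near. Qed.

Lemma cvg_tail_integral_pinfty : tail x @[x --> +oo] --> 0.
Proof.
apply/cvg_pinftyP => u cu.
have [k _ ku] : \forall n \near \oo, a <= u n by move/cvgryPge : cu; apply.
rewrite -(cvg_shiftn k).
apply: (cvg_tail_integral_seq (c := false)) => [n|x ax].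
  by apply: ku; rewrite /= leq_addl.
have : \forall n \near \oo, x <= u (n + k)%N.
  by move: x {ax}; apply/cvgryPge; rewrite cvg_shiftn.
by apply: filterS => n; rewrite leNgt => /negbTE.
Qed.

Lemma is_derive_tail_integral x : a < x -> {for x, continuous f} ->
  is_derive x 1 tail (- f x).
Proof.
move=> ax cf.
have intfx : mu.-integrable `]a, x + 1] (EFin \o f).
  by apply: integrableS intf => //; exact: subset_itvl.
have xx1 : x < x + 1 by rewrite ltrDl.
have [dF F'] := @continuous_FTC1 R f (BRight a) x (x + 1) xx1 intfx ax cf.
have dFx : is_derive x 1 (fun y => \int[mu]_(t in `]a, y]) f t) (f x).
  by apply: DeriveDef dF _; rewrite -derive1E.
apply: (@near_eq_is_derive _ _ _ (cst (tail a) - (fun y => \int[mu]_(t in `]a, y]) f t))).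
  near=> y; rewrite !fctE /tail.
  have ay : a <= y by apply/ltW; near: y; exact: lt_nbhsr.
  by rewrite (@Rintegral_itvB _ f (BRight a) +oo%O y).
by rewrite -[- f x]add0r; exact: is_deriveB.
Unshelve. all: by end_near. Qed.

End tail_integral.

(** * Derivatives and elementary integrals *)

Section derivative_rules.
Context {R : realType}.
Implicit Types (f g : R -> R) (p x c df dg : R).

Lemma is_derive1_continuous f x df : is_derive x 1 f df -> {for x, continuous f}.
Proof. by case=> /derivable1_diffP fx _; exact: differentiable_continuous. Qed.

Lemma is_derive1_fcst c x : is_derive x 1 (fun=> c) 0.
Proof. exact: is_derive_cst. Qed.

Lemma is_derive1_fid x : is_derive x 1 (fun y => y) 1.
Proof. exact: is_derive_id. Qed.

Lemma is_derive1_fD f g x df dg : is_derive x 1 f df -> is_derive x 1 g dg ->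
  is_derive x 1 (fun y => f y + g y) (df + dg).
Proof. exact: is_deriveD. Qed.

Lemma is_derive1_fN f x df : is_derive x 1 f df -> is_derive x 1 (fun y => - f y) (- df).
Proof. exact: is_deriveN. Qed.

Lemma is_derive1_fM f g x df dg : is_derive x 1 f df -> is_derive x 1 g dg ->
  is_derive x 1 (fun y => f y * g y) (f x * dg + g x * df).
Proof. exact: is_deriveM. Qed.

Lemma is_derive1_fX f n x df : is_derive x 1 f df ->
  is_derive x 1 (fun y => f y ^+ n) (n%:R * f x ^+ n.-1 * df).
Proof.
move=> fx; rewrite (_ : (fun y => _) = f ^+ n); first exact: is_deriveX.
by apply/funext => y; elim: n => [|n ih]; rewrite ?expr0// !exprS ih.
Qed.

Lemma is_derive1_fV f x df : f x != 0 -> is_derive x 1 f df ->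
  is_derive x 1 (fun y => (f y)^-1) (- f x ^- 2 * df).
Proof. by move=> fx0 fx; exact: is_deriveV. Qed.

Lemma is_derive1_fexpR f x df : is_derive x 1 f df ->
  is_derive x 1 (fun y => expR (f y)) (expR (f x) * df).
Proof. by move=> fx; apply: is_derive1_comp. Qed.

Lemma is_derive1_fcos f x df : is_derive x 1 f df ->
  is_derive x 1 (fun y => cos (f y)) (- sin (f x) * df).
Proof. by move=> fx; apply: is_derive1_comp. Qed.

Lemma is_derive1_fsin f x df : is_derive x 1 f df ->
  is_derive x 1 (fun y => sin (f y)) (cos (f x) * df).
Proof. by move=> fx; apply: is_derive1_comp. Qed.

Lemma is_derive1_powR p x : 0 < x -> is_derive x 1 (fun y => y `^ p) (p * x `^ (p - 1)).
Proof.
move=> x0; have xI : x \in `]0, +oo[ by rewrite in_itv/= andbT.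
apply: DeriveDef; first exact: derivable_powR.
by rewrite -derive1E powR_derive1.
Qed.

Lemma is_derive1_fpowR f p x df : 0 < f x -> is_derive x 1 f df ->
  is_derive x 1 (fun y => f y `^ p) (p * f x `^ (p - 1) * df).
Proof.
by move=> fx0 fx; apply: (@is_derive1_comp _ (fun y => y `^ p) f) => //; exact: is_derive1_powR.
Qed.

End derivative_rules.

(** Differentiates by the shape of the function, leaving the side conditions of inverses and real
    powers as goals. The derivative may be an existential variable, so that, with
    [is_derive1_continuous], it also serves as a continuity prover. *)
Ltac derive1 := cbv beta; lazymatch goal with
  | |- is_derive _ _ (fun y => y) _ => notypeclasses refine (is_derive1_fid _)
  | |- is_derive _ _ (fun _ => ?c) _ => notypeclasses refine (is_derive1_fcst _ _)
  | |- is_derive _ _ (fun y => @?f y + @?g y) _ =>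
      notypeclasses refine (is_derive1_fD _ _); derive1
  | |- is_derive _ _ (fun y => - @?f y) _ => notypeclasses refine (is_derive1_fN _); derive1
  | |- is_derive _ _ (fun y => @?f y * @?g y) _ =>
      notypeclasses refine (is_derive1_fM _ _); derive1
  | |- is_derive _ _ (fun y => @?f y ^+ ?n) _ => notypeclasses refine (is_derive1_fX _ _); derive1
  | |- is_derive _ _ (fun y => (@?f y)^-1) _ => notypeclasses refine (is_derive1_fV _ _); [|derive1]
  | |- is_derive _ _ (fun y => expR (@?f y)) _ => notypeclasses refine (is_derive1_fexpR _); derive1
  | |- is_derive _ _ (fun y => cos (@?f y)) _ => notypeclasses refine (is_derive1_fcos _); derive1
  | |- is_derive _ _ (fun y => sin (@?f y)) _ => notypeclasses refine (is_derive1_fsin _); derive1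
  | |- is_derive _ _ (fun y => @?f y `^ ?p) _ =>
      notypeclasses refine (is_derive1_fpowR _ _ _); [|derive1]
  | |- is_derive _ _ (fun _ => _) _ => eassumption
  | |- is_derive ?x ?v ?f ?d =>
      first [eassumption | change (is_derive x v (fun y => f y) d); derive1]
  end.

Ltac derive1_eq := notypeclasses refine (is_derive_eq _ _); [by derive1|cbv beta].

Section integrability.
Context {R : realType}.
Notation mu := (@lebesgue_measure R).
Implicit Types (x : R).

Lemma gt0_powRD x r s : 0 < x -> x `^ (r + s) = x `^ r * x `^ s.
Proof. by move=> x0; rewrite powRD// (gt_eqF x0) implybT. Qed.

Lemma cvgy_powR (r : R) : 0 < r -> x `^ r @[x --> +oo] --> +oo.
Proof.
move=> r0; apply/cvgryPge => A; near=> x.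
have A0 : 0 <= Num.max A 0 by rewrite le_max lexx orbT.
apply: (@le_trans _ _ (Num.max A 0)); first by rewrite le_max lexx.
rewrite -[leLHS](@powRr1 R)// -(mulVf (lt0r_neq0 r0)) powRrM.
have Ax : Num.max A 0 `^ r^-1 <= x by near: x; exact: nbhs_pinfty_ge.
have x0 : 0 <= x by apply: le_trans Ax; exact: powR_ge0.
by apply: ge0_ler_powR => //; rewrite ?nnegrE ?powR_ge0// ltW.
Unshelve. all: by end_near. Qed.

Lemma cvgy_powRN (r : R) : 0 < r -> x `^ (- r) @[x --> +oo] --> 0.
Proof.
move=> r0; under eq_fun do rewrite powRN.
have xr0 : \forall x \near +oo, 0 < x `^ r by near=> x; exact: powR_gt0.
exact: ((gtr0_cvgV0 xr0).2 (cvgy_powR r0)).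
Unshelve. all: by end_near. Qed.

(** The integrand has the explicit antiderivative (x^e / (1 + x^e))^s / (e s). It behaves like x^(e
    s - 1) at 0 and like x^(-e-1) at infinity, and is the dominating function from which the
    integrability of the power integrands below is deduced. *)
Lemma integrable_ratio (e s : R) : 0 < e -> 0 < s ->
  mu.-integrable `]0, +oo[ (fun x => (x `^ (e * s - 1) * (1 + x `^ e) `^ (- (s + 1)))%:E).
Proof.
move=> e0 s0.
have d1 x : 0 < x -> 0 < 1 + x `^ e by move=> x0; rewrite addr_gt0// powR_gt0.
pose F x := (e * s)^-1 * (x `^ (e * s) * (1 + x `^ e) `^ (- s)).
have dF x : 0 < x ->
    is_derive x 1 F (x `^ (e * s - 1) * (1 + x `^ e) `^ (- (s + 1))).
  move=> x0; rewrite /F; apply: is_derive_eq; first by derive1 => //; exact: d1.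
  rewrite (_ : 1 + x `^ e = (1 + x `^ e) `^ 1) ?powRr1 ?ltW ?d1//.
  have -> : - (s + 1) = - s - 1 by ring.
  set D := 1 + x `^ e; have D0 : 0 < D by exact: d1.
  have -> : e * s - 1 = (e * s) + (- 1) by [].
  rewrite !(gt0_powRD _ _ x0) !(gt0_powRD _ _ D0).
  rewrite !powR_inv1 ?ltW//.
  have -> : x `^ e = D - 1 by rewrite /D addrC addKr.
  by field; rewrite !gt_eqF.
apply: (@ge0_FTC_oy_integrable _ _ F 0 0 (e * s)^-1) => //.
- by move=> x x0; rewrite mulr_ge0 ?powR_ge0.
- move=> x x0; apply: is_derive1_continuous.
  by derive1 => //; exact: d1.
- rewrite -[X in _ --> X](mulr0 (e * s)^-1); apply: cvgM; first exact: cvg_cst.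
  rewrite -[X in _ --> X](mul0r (1 `^ (- s))); apply: cvgM.
    by apply: powR_cvg0; rewrite mulr_gt0.
  have c1 : 1 + x `^ e @[x --> (0:R)^'+] --> (1 : R).
    by rewrite -[X in _ --> X]addr0; apply: cvgD; [exact: cvg_cst|exact: powR_cvg0].
  apply: (@cvg_comp _ _ _ (fun x => 1 + x `^ e) (fun x => x `^ (- s)) _ _ _ c1).
  by apply: (is_derive1_continuous (is_derive1_powR _ _)).
- rewrite -[X in _ --> X]mulr1; apply: cvgM; first exact: cvg_cst.
  rewrite [X in _ --> X](_ : _ = (1 : R) `^ (- s)); last by rewrite powR1.
  (* For x > 0, x^(e s) (1 + x^e)^(-s) = (x^(-e) + 1)^(-s), which has a visible limit at
     infinity. *)
  have c1 : x `^ (- e) + 1 @[x --> +oo] --> (1 : R).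
    by rewrite -[X in _ --> X]add0r; apply: cvgD; [exact: cvgy_powRN|exact: cvg_cst].
  apply: cvg_trans; last first.
    apply: (@cvg_comp _ _ _ (fun x => x `^ (- e) + 1) (fun x => x `^ (- s)) _ _ _ c1).
    by apply: (is_derive1_continuous (is_derive1_powR _ _)).
  apply: near_eq_cvg; near=> x => /=.
  have x0 : 0 < x by [].
  rewrite (_ : x `^ (- e) + 1 = x `^ (- e) * (1 + x `^ e)); last first.
    by rewrite mulrDr mulr1 -gt0_powRD// addNr powRr0.
  by rewrite powRM ?powR_ge0// ?ltW ?d1// -powRrM mulrNN.
Unshelve. all: by end_near. Qed.

Lemma integrable_le0y (f g : R -> R) (c : R) :
  mu.-integrable `]0, +oo[ (fun x => (g x)%:E) ->
  measurable_fun (`]0, +oo[%classic : set R) f ->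
  (forall x, 0 < x -> `|f x| <= c * g x) ->
  mu.-integrable `]0, +oo[ (fun x => (f x)%:E).
Proof.
move=> ig mf fg.
have icg : mu.-integrable `]0, +oo[ (fun x => (c%:E * (g x)%:E)%E).
  exact: integrableZl ig.
apply: le_integrable icg => //.
- by apply/measurable_EFinP.
- move=> x /=; rewrite in_itv/= andbT => x0; rewrite lee_fin.
  exact: le_trans (fg _ x0) (ler_norm _).
Qed.

(** Raise 1 + y <= e^y at y = d x / p to the power p, and use 1 + x <= (1 + p/d) (1 + d x / p). *)
Lemma powR1D_le_expR (p d x : R) : 0 < p -> 0 < d -> 0 < x ->
  (1 + x) `^ p <= (1 + p / d) `^ p * expR (d * x).
Proof.
move=> p0 d0 x0.
have -> : d * x = (d * x / p) * p by field; rewrite gt_eqF.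
rewrite expRM.
have e1 : 1 + d * x / p <= expR (d * x / p) by exact: expR_ge1Dx.
have C0 : 0 <= 1 + p / d by rewrite addr_ge0// divr_ge0// ltW.
rewrite -powRM ?expR_ge0//.
apply: ge0_ler_powR; rewrite ?nnegrE ?(ltW p0)// ?mulr_ge0 ?expR_ge0//.
  by rewrite addr_ge0// ltW.
apply: le_trans (_ : (1 + p / d) * (1 + d * x / p) <= _); last first.
  by rewrite ler_wpM2l// addr_ge0 ?divr_ge0 ?ltW.
have -> : (1 + p / d) * (1 + d * x / p) = 1 + x + (p / d + d * x / p).
  by field; rewrite !gt_eqF.
by rewrite lerDl addr_ge0// ?divr_ge0 ?mulr_ge0 ?ltW.
Qed.

(** Comparison with [integrable_ratio] at e = 1, s = b + 1, that is with x^b (1 + x)^(-(b+2)). *)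
Lemma integrable_powR_expR (b d : R) : -1 < b -> 0 < d ->
  mu.-integrable `]0, +oo[ (fun x => (x `^ b * expR (- (d * x)))%:E).
Proof.
move=> b1 d0.
have b2 : 0 < b + 1 + 1 by lra.
have b10 : 0 < b + 1 by lra.
apply: (integrable_le0y (c := (1 + (b + 1 + 1) / d) `^ (b + 1 + 1))
    (@integrable_ratio 1 (b + 1) ltr01 b10)).
  apply: measurable_fun_oy => x x0; apply: is_derive1_continuous.
  by derive1.
move=> x x0.
rewrite ger0_norm ?mulr_ge0 ?powR_ge0 ?expR_ge0// mul1r addrK powRr1 ?(ltW x0)//.
rewrite mulrCA ler_wpM2l ?powR_ge0// powRN expRN.
rewrite ler_pdivlMr ?powR_gt0 ?addr_gt0// mulrC ler_pdivrMr ?expR_gt0//.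
exact: powR1D_le_expR.
Qed.

(** Comparison with [integrable_ratio] at e = al, s = (2 - al) / al, whose second factor (1 +
    x^al)^(-2/al) is comparable to 1 / (1 + x^2). This function dominates x^(-al-1) (1 - cos x). *)
Lemma integrable_powR_quadratic (al : R) : 0 < al -> al < 2 ->
  mu.-integrable `]0, +oo[ (fun x => (x `^ (1 - al) / (1 + x ^+ 2))%:E).
Proof.
move=> al0 al2.
have s0 : 0 < (2 - al) / al by rewrite divr_gt0 ?subr_gt0.
apply: (integrable_le0y (c := 2 `^ (2 / al)) (integrable_ratio al0 s0)).
  apply: measurable_fun_oy => x x0; apply: is_derive1_continuous.
  by derive1 => //; rewrite gt_eqF// ltr_pwDl// sqr_ge0.
move=> x x0; have x20 : 0 < 1 + x ^+ 2 by rewrite ltr_pwDl// sqr_ge0.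
rewrite ger0_norm ?mulr_ge0 ?powR_ge0 ?invr_ge0 ?(ltW x20)//.
have -> : al * ((2 - al) / al) - 1 = 1 - al by field; rewrite gt_eqF.
have -> : (2 - al) / al + 1 = 2 / al by field; rewrite gt_eqF.
rewrite mulrCA ler_wpM2l ?powR_ge0// powRN.
have D0 : 0 < 1 + x `^ al by rewrite addr_gt0 ?powR_gt0.
suff : (1 + x `^ al) `^ (2 / al) <= 2 `^ (2 / al) * (1 + x ^+ 2).
  by move=> H; rewrite ler_pdivlMr ?powR_gt0// mulrC ler_pdivrMr.
have p0 : 0 <= 2 / al by rewrite divr_ge0// ltW.
have [x1|x1] := leP x 1.
  apply: (@le_trans _ _ (2 `^ (2 / al))).
    apply: ge0_ler_powR; rewrite ?nnegrE ?(ltW D0)//.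
    rewrite -[leRHS]/(1 + 1) lerD2l.
    have -> : (1 : R) = 1 `^ al by rewrite powR1.
    by apply: ge0_ler_powR; rewrite ?nnegrE ?(ltW al0) ?(ltW x0).
  by rewrite ler_peMr ?powR_ge0// lerDl sqr_ge0.
apply: (@le_trans _ _ ((2 * x `^ al) `^ (2 / al))).
  apply: ge0_ler_powR => //; rewrite ?nnegrE ?mulr_ge0 ?powR_ge0 ?(ltW D0)//.
  rewrite mulr_natl mulr2n lerD2r -(powRr0 x).
  by apply: ler_powR; rewrite ltW.
rewrite powRM ?powR_ge0// -powRrM (_ : al * (2 / al) = 2%:R).
  by rewrite powR_mulrn ?(ltW x0)// ler_wpM2l ?powR_ge0// lerDr.
by field; rewrite gt_eqF.
Qed.

End integrability.

(** * Evaluation of the stable constant *)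

Section rotation.
Context {R : realType}.
Notation mu := (@lebesgue_measure R).
Implicit Types (x th om b d : R).

Lemma cvg_powR_expR0 (p d : R) : 0 < p -> x `^ p * expR (- (d * x)) @[x --> 0^'+] --> 0.
Proof.
move=> p0; rewrite -[X in _ --> X](mul0r (expR (- (d * 0)))); apply: cvgM.
  exact: powR_cvg0.
apply: cvg_at_right_filter.
have : {for (0 : R), continuous (fun x => expR (- (d * x)))}.
  by apply: is_derive1_continuous; derive1.
by [].
Qed.

Lemma cvg_expR_Ny (d : R) : 0 < d -> expR (- (d * x)) @[x --> +oo] --> 0.
Proof.
move=> d0.
have dy : d * x @[x --> +oo] --> +oo by apply: gt0_cvgMry.
exact: (@cvg_comp _ _ _ (fun x => d * x) (fun x => expR (- x)) _ _ _ dy (@cvgr_expR R)).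
Qed.

Lemma cvgy_powR_expR (p d : R) : 0 < p -> 0 < d ->
  x `^ p * expR (- (d * x)) @[x --> +oo] --> 0.
Proof.
move=> p0 d0; have d20 : 0 < d / 2 by rewrite divr_gt0.
have H := cvg_expR_Ny d20.
have : (1 + p / (d / 2)) `^ p * expR (- (d / 2 * x)) @[x --> +oo] --> 0.
  by rewrite -[X in _ --> X](mulr0 ((1 + p / (d / 2)) `^ p)); apply: cvgM => //; exact: cvg_cst.
apply: squeeze_cvgr (cvg_cst 0); near=> x.
have x0 : 0 < x by [].
rewrite mulr_ge0 ?powR_ge0 ?expR_ge0//=.
have -> : - (d * x) = - (d / 2 * x) - (d / 2 * x) by field.
rewrite expRD mulrA ler_pM2r ?expR_gt0//.
rewrite expRN ler_pdivrMr ?expR_gt0//.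
apply: le_trans (powR1D_le_expR p0 d20 x0).
by apply: ge0_ler_powR; rewrite ?nnegrE ?(ltW p0) ?(ltW x0)// ?addr_ge0 ?(ltW x0)// lerDr.
Unshelve. all: by end_near. Qed.

Variable b : R.
Hypothesis b1 : -1 < b.

(* The real part of e^(i om) x^b exp (- x e^(i th)); its integral is computed by
   rotating the half-line, the derivatives in th and in x being proportional. *)
Definition rot_integrand om th x :=
  x `^ b * expR (- (cos th * x)) * cos (om + (b + 1) * th - x * sin th).

Let phi := rot_integrand.

Let dphi om th x := x `^ b * expR (- (cos th * x)) *
  (x * (sin th * cos (om + (b + 1) * th - x * sin th) +
        cos th * sin (om + (b + 1) * th - x * sin th))
   - (b + 1) * sin (om + (b + 1) * th - x * sin th)).

Let is_derive_phi om th x : is_derive th 1 (phi om ^~ x) (dphi om th x).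
Proof.
rewrite /phi /rot_integrand /dphi; derive1_eq.
ring.
Qed.

(** Cauchy's theorem in real form. With z = x e^(i th), the differentiated function is the real part
    of i e^(i om) z^(b+1) e^(-z); it vanishes at both ends of the half-line, so [dphi] has integral
    0 over x. *)
Let is_derive_psi om th x : 0 < x -> is_derive x 1
  (fun x => - (x `^ (b + 1) * expR (- (cos th * x))) * sin (om + (b + 1) * th - x * sin th))
  (dphi om th x).
Proof.
move=> x0; rewrite /dphi; derive1_eq.
by rewrite addrK (gt0_powRD _ _ x0) powRr1 ?(ltW x0)//; ring.
Qed.

(** Dominates [dphi] for all angles with cos th >= d at once, as differentiation under the integral
    sign demands. *)
Let bound d x := `|b + 1| * (x `^ b * expR (- (d * x))) + 2 * (x `^ (b + 1) * expR (- (d * x))).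

Let integrable_bound d : 0 < d -> mu.-integrable `]0, +oo[ (fun x => (bound d x)%:E).
Proof.
move=> d0; have b11 : -1 < b + 1 by rewrite -subr_gt0 opprK addr_gt0// -ltrBlDr sub0r.
apply: integrable_fD; first exact: measurable_oy.
  by apply: integrable_fZl; [exact: measurable_oy|exact: integrable_powR_expR].
by apply: integrable_fZl; [exact: measurable_oy|exact: integrable_powR_expR].
Qed.

Lemma integrable_rot om th : 0 < cos th ->
  mu.-integrable `]0, +oo[ (fun x => (rot_integrand om th x)%:E).
Proof.
move=> c0; apply: (integrable_le0y (c := 1) (integrable_powR_expR b1 c0)).
  apply: measurable_fun_oy => x x0; apply: is_derive1_continuous.
  by rewrite /rot_integrand; derive1.
move=> x x0; rewrite mul1r normrM ger0_norm ?mulr_ge0 ?powR_ge0 ?expR_ge0//.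
by rewrite ler_piMr ?mulr_ge0 ?powR_ge0 ?expR_ge0// cos_max.
Qed.

Let dphi_bound d om th x : 0 < x -> d <= cos th -> `|dphi om th x| <= bound d x.
Proof.
move=> x0 dc; rewrite /dphi /bound.
have -> : x `^ (b + 1) = x `^ b * x by rewrite (gt0_powRD _ _ x0) powRr1 ?(ltW x0).
set e := expR (- (d * x)).
have -> : `|b + 1| * (x `^ b * e) + 2 * (x `^ b * x * e) = x `^ b * e * (x * 2 + `|b + 1|) by ring.
rewrite normrM ger0_norm ?mulr_ge0 ?powR_ge0 ?expR_ge0//.
apply: ler_pM; rewrite ?mulr_ge0 ?powR_ge0 ?expR_ge0//.
  by rewrite ler_wpM2l ?powR_ge0// ler_expR lerN2 ler_wpM2r// ltW.
apply: le_trans (ler_normB _ _) _; apply: lerD; rewrite normrM.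
  rewrite (gtr0_norm x0) ler_wpM2l ?(ltW x0)//.
  apply: le_trans (ler_normD _ _) _; rewrite -[leRHS]/(1 + 1).
  by apply: lerD; rewrite normrM mulr_ile1 ?cos_max ?sin_max.
by rewrite ler_piMr// sin_max.
Qed.

Let int_dphi om th : 0 < cos th -> \int[mu]_(x in `]0, +oo[) dphi om th x = 0.
Proof.
move=> c0; have b10 : 0 < b + 1 by rewrite -ltrBlDr sub0r.
have lim0 (F : set_system R) (FF : Filter F) :
    x `^ (b + 1) * expR (- (cos th * x)) @[x --> F] --> 0 ->
    - (x `^ (b + 1) * expR (- (cos th * x))) * sin (om + (b + 1) * th - x * sin th)
    @[x --> F] --> 0.
  move=> H; apply/norm_cvg0P.
  apply: squeeze_cvgr (cvg_cst 0) H; near=> x; rewrite normr_ge0/= normrM normrN.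
  have p0 : 0 <= x `^ (b + 1) * expR (- (cos th * x)).
    by rewrite mulr_ge0 ?powR_ge0 ?expR_ge0.
  by rewrite (ger0_norm p0) ler_piMr// sin_max.
rewrite -[RHS](subrr 0).
apply: (FTC_oy (F := fun x => - (x `^ (b + 1) * expR (- (cos th * x))) *
  sin (om + (b + 1) * th - x * sin th))).
- move=> x x0; apply: is_derive1_continuous.
  by rewrite /dphi; derive1.
- by move=> x x0; exact: is_derive_psi.
- by apply: lim0; exact: cvg_powR_expR0.
- by apply: lim0; exact: cvgy_powR_expR.
- apply: (integrable_le0y (c := 1) (integrable_bound c0)).
    apply: measurable_fun_oy => x x0; apply: is_derive1_continuous.
    by rewrite /dphi; derive1.
  by move=> x x0; rewrite mul1r dphi_bound.
Unshelve. all: by end_near. Qed.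

(** An open interval containing [0, t] on which cos stays above the positive number cos v. It is
    symmetric so that 0 is an interior point. *)
Lemma cos_gt0_near (t : R) : 0 <= t < pi / 2 ->
  exists2 v, t < v < pi / 2 & forall th, - v < th < v -> cos v <= cos th.
Proof.
move=> /andP[t0 tpi]; exists ((t + pi / 2) / 2); first by lra.
set v := (t + pi / 2) / 2 => th /andP[thv vth].
have [p0] := (@pi_gt0 R).
have vpi : v < pi by rewrite /v; lra.
rewrite -(cos_norm th) leNgt.
have nth : `|th| < v by rewrite ltr_norml thv.
have vI : v \in `[0, pi] by rewrite in_itv/= (ltW vpi) andbT /v; lra.
have tI : `|th| \in `[0, pi] by rewrite in_itv/= normr_ge0 (ltW (lt_trans nth vpi)).
by rewrite ltr_cos// -leNgt ltW.
Qed.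

(** The derivative in th, taken under the integral, is the integral of [dphi], which is 0; the mean
    value theorem concludes. The angle pi / 2 is excluded because the damping cos th > 0 is lost
    there. *)
Lemma rot_integral om th : 0 <= th < pi / 2 ->
  \int[mu]_(x in `]0, +oo[) rot_integrand om th x =
  \int[mu]_(x in `]0, +oo[) rot_integrand om 0 x.
Proof.
move=> th0; have [v /andP[thv vpi] vcos] := cos_gt0_near th0.
have cv : 0 < cos v.
  apply: cos_gt0_pihalf; rewrite vpi andbT.
  by move: th0 => /andP[]; have := @pi_gt0 R; lra.
have d0 t : - v < t < v -> is_derive t 1
    (fun t => \int[mu]_(x in `]0, +oo[) phi om t x) 0.
  move=> tv.
  have tI : `]- v, v[%classic t by rewrite /= in_itv.
  have int1 (x : R) : `]- v, v[%classic x ->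
      mu.-integrable `]0, +oo[ (EFin \o phi om x).
    rewrite /= in_itv/= => xv; apply: integrable_rot.
    exact: lt_le_trans cv (vcos _ xv).
  have d1 (x y : R) : `]- v, v[%classic x -> `]0, +oo[%classic y ->
      derivable (phi om ^~ y) x 1.
    by move=> _ _; case: (is_derive_phi om x y).
  have g0 (y : R) : 0 <= bound (cos v) y.
    by rewrite addr_ge0 ?mulr_ge0 ?powR_ge0 ?expR_ge0.
  have gb (x y : R) : `]- v, v[%classic x -> `]0, +oo[%classic y ->
      `|partial1of2 (phi om) x y| <= bound (cos v) y.
    rewrite /= !in_itv/= andbT => xv y0; rewrite partial1of2E.
    by case: (is_derive_phi om x y) => _ ->; exact: dphi_bound (vcos _ xv).
  have mI : measurable (`]0, +oo[%classic : set (measurableTypeR R)) by exact: measurable_itv.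
  have ib := integrable_bound cv.
  apply: DeriveDef; first exact: (@derivable_under_integral R _ _ mu (phi om) _ mI t _ _ tI int1
    d1 _ g0 ib gb).
  rewrite -derive1E (@differentiation_under_integral R _ _ mu (phi om) _ mI t _ _ tI int1 d1 _ g0
    ib gb).
  rewrite -[RHS](int_dphi om (lt_le_trans cv (vcos _ tv))).
  apply: eq_Rintegral => x _; rewrite partial1of2E.
  by case: (is_derive_phi om t x).
move: th0 => /andP[+ thpi]; rewrite le_eqVlt => /predU1P[<-//|th0].
have [||c _] := @MVT R (fun t => \int[mu]_(x in `]0, +oo[) phi om t x) (cst 0) 0 th th0.
- by move=> x; rewrite in_itv/= => /andP[x0 xth]; apply: d0; lra.
- apply: derivable_within_continuous => x; rewrite in_itv/= => /andP[x0 xth].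
  by have [] : is_derive x 1 (fun t => \int[mu]_(x in `]0, +oo[) phi om t x) 0 by apply: d0; lra.
by rewrite mul0r => /eqP; rewrite subr_eq0 => /eqP.
Qed.

End rotation.

Section trig_bounds.
Context {R : realType}.
Implicit Types (x y t : R).

Lemma norm_sub_le_of_derive (f df : R -> R) x y :
  (forall t, is_derive t 1 f (df t)) -> (forall t, `|df t| <= 1) -> x <= y ->
  `|f y - f x| <= y - x.
Proof.
move=> dF df1 xy.
have cf : {within `[x, y], continuous f}.
  by apply: derivable_within_continuous => z _; case: (dF z).
have [c _ ->] := MVT_segment xy (fun z _ => dF z) cf.
have yx : 0 <= y - x by rewrite subr_ge0.
by rewrite normrM (ger0_norm yx) ler_piMl.
Qed.

Lemma norm_sin_le x : `|sin x| <= `|x|.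
Proof.
have H y : 0 <= y -> `|sin y| <= y.
  move=> y0; have := @norm_sub_le_of_derive sin cos 0 y.
  by rewrite sin0 !subr0; apply => // t; rewrite cos_max.
have [x0|x0] := leP 0 x; first by rewrite (ger0_norm x0) H.
by rewrite -normrN -sinN (ltr0_norm x0) H// oppr_ge0 ltW.
Qed.

Lemma oneBcos_ge0 x : 0 <= 1 - cos x.
Proof. by rewrite subr_ge0 cos_le1. Qed.

Lemma oneBcos_le2 x : 1 - cos x <= 2.
Proof. by have := cos_geN1 x; lra. Qed.

Lemma oneBcos_le_id x : 0 <= x -> 1 - cos x <= x.
Proof.
move=> x0; have := @norm_sub_le_of_derive cos (fun t => - sin t) 0 x.
rewrite cos0 distrC subr0 (ger0_norm (oneBcos_ge0 _)); apply => // t.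
  by rewrite normrN sin_max.
Qed.

Lemma oneBcos_le_sqr x : 1 - cos x <= x ^+ 2 / 2.
Proof.
have -> : 1 - cos x = 2 * sin (x / 2) ^+ 2.
  rewrite sin2cos2 {1}(_ : x = (x / 2) *+ 2) ?cos_mulr2n; first by ring.
  by rewrite -mulr_natr; field.
have : sin (x / 2) ^+ 2 <= (x / 2) ^+ 2.
  rewrite -[leLHS]real_normK ?num_real// -[leRHS]real_normK ?num_real//.
  by rewrite lerXn2r ?nnegrE// norm_sin_le.
by rewrite -[x ^+ 2 / 2]/(x ^+ 2 / 2); lra.
Qed.

(** Joins the bounds 2 and (t x)^2 / 2. All values of t are thereby controlled by one function of
    x. *)
Lemma oneBcos_le_ratio t x : 1 - cos (t * x) <= 2 * (1 + t ^+ 2) * (x ^+ 2 / (1 + x ^+ 2)).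
Proof.
have D0 : 0 < 1 + x ^+ 2 by rewrite ltr_pwDl// sqr_ge0.
rewrite mulrA ler_pdivlMr// mulrDr mulr1.
have h1 := oneBcos_le2 (t * x); have h2 := oneBcos_le_sqr (t * x).
have h3 : (1 - cos (t * x)) * x ^+ 2 <= 2 * x ^+ 2 by rewrite ler_wpM2r// sqr_ge0.
have h4 : 0 <= (t * x) ^+ 2 by exact: sqr_ge0.
apply: (le_trans (lerD h2 h3)).
by rewrite exprMn in h4 *; lra.
Qed.

End trig_bounds.

Section stable_constant.
Context {R : realType}.
Notation mu := (@lebesgue_measure R).
Implicit Types (x y t th D : R).

(** Needed at two places: y = 1 gives D^2 / (1 + D^2), and D = 1 gives 1 / (y (1 + y^2)), which
    settles alpha = 1. *)
Lemma laplace_oneBcos y D : 0 < y ->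
  (\int[mu]_(x in `]0%R, +oo[) (expR (- (y * x)) * (1 - cos (x * D)))%:E =
   (D ^+ 2 / (y * (y ^+ 2 + D ^+ 2)))%:E)%E.
Proof.
move=> y0; have D0 : 0 < y ^+ 2 + D ^+ 2 by rewrite ltr_pwDl ?sqr_ge0 ?exprn_gt0.
pose F x := expR (- (y * x)) *
  (- y^-1 + (y ^+ 2 + D ^+ 2)^-1 * (y * cos (x * D) - D * sin (x * D))).
have cF0 : {for 0, continuous F}.
  by apply: is_derive1_continuous; rewrite /F; derive1.
have -> : D ^+ 2 / (y * (y ^+ 2 + D ^+ 2)) = 0 - F 0.
  rewrite /F !(mul0r, mulr0) oppr0 expR0 cos0 sin0.
  by field; rewrite !gt_eqF.
apply: (@ge0_FTC_oy _ _ F).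
- by move=> x _; rewrite mulr_ge0 ?expR_ge0 ?oneBcos_ge0.
- by move=> x _; apply: is_derive1_continuous; derive1.
- move=> x _; rewrite /F; derive1_eq.
  by field; rewrite !gt_eqF.
- exact: cvg_at_right_filter.
- apply/norm_cvg0P.
  have := cvg_expR_Ny y0 => H.
  have : (y^-1 + (y ^+ 2 + D ^+ 2)^-1 * (y + `|D|)) * expR (- (y * x)) @[x --> +oo] --> 0.
    by rewrite -[X in _ --> X](mulr0 (y^-1 + (y ^+ 2 + D ^+ 2)^-1 * (y + `|D|)));
      apply: cvgM => //; exact: cvg_cst.
  apply: squeeze_cvgr (cvg_cst 0); near=> x.
  rewrite normr_ge0/= /F normrM (ger0_norm (expR_ge0 _)) mulrC ler_wpM2r ?expR_ge0//.
  apply: le_trans (ler_normD _ _) _; rewrite normrN gtr0_norm ?invr_gt0// lerD2l.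
  rewrite normrM gtr0_norm ?invr_gt0// ler_wpM2l ?invr_ge0 ?(ltW D0)//.
  apply: le_trans (ler_normB _ _) _; rewrite !normrM (gtr0_norm y0).
  by apply: lerD; rewrite ler_piMr// ?(ltW y0)// ?cos_max ?sin_max.
Unshelve. all: by end_near. Qed.

(** Serves to write x^(-2) as a superposition of exponentials when alpha = 1. *)
Lemma integral_xexpR x : 0 < x ->
  (\int[mu]_(y in `]0%R, +oo[) (y * expR (- (x * y)))%:E = (x ^- 2)%:E)%E.
Proof.
move=> x0; pose F y := - (y / x + x ^- 2) * expR (- (x * y)).
have cF0 : {for 0, continuous F}.
  by apply: is_derive1_continuous; rewrite /F; derive1.
have -> : x ^- 2 = 0 - F 0.
  by rewrite /F !(mul0r, mulr0) oppr0 expR0; ring.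
apply: (@ge0_FTC_oy _ _ F).
- by move=> y y0; rewrite mulr_ge0 ?expR_ge0 ?ltW.
- by move=> y _; apply: is_derive1_continuous; derive1.
- move=> y _; rewrite /F; derive1_eq.
  by field; rewrite !gt_eqF.
- exact: cvg_at_right_filter.
- have h1 := @cvgy_powR_expR R 1 x ltr01 x0.
  have h2 := cvg_expR_Ny x0.
  have : - (x^-1) * (y `^ 1 * expR (- (x * y))) + - (x ^- 2) * expR (- (x * y))
     @[y --> +oo] --> 0.
    rewrite [X in _ --> X](_ : 0 = - (x^-1) * 0 + - (x ^- 2) * 0).
      by apply: cvgD; apply: cvgM; [exact: cvg_cst| |exact: cvg_cst|].
    by rewrite !mulr0 addr0.
  apply: cvg_trans; apply: near_eq_cvg; near=> y.
  have y0 : 0 < y by [].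
  by rewrite /F powRr1 ?(ltW y0)//; ring.
Unshelve. all: by end_near. Qed.

End stable_constant.

Section stable_constant_value.
Context {R : realType}.
Notation mu := (@lebesgue_measure R).
Implicit Types (x y t th al : R).

Lemma rot_integral_Gamma al th : 0 < al < 2 -> 0 <= th < pi / 2 ->
  \int[mu]_(x in `]0, +oo[) (x `^ (1 - al) * expR (- (cos th * x)) * cos (2 * th - x * sin th))
  = Gamma (2 - al) * cos (al * th).
Proof.
move=> /andP[al0 al2] thI; have b1 : -1 < 1 - al by lra.
(* With b = 1 - al, the phase om = al th turns om + (b + 1) th into 2 th, and at angle 0 it leaves
   the constant cos(al th). *)
have := rot_integral b1 (al * th) thI.
have -> : \int[mu]_(x in `]0, +oo[) rot_integrand (1 - al) (al * th) th x =
    \int[mu]_(x in `]0, +oo[)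
      (x `^ (1 - al) * expR (- (cos th * x)) * cos (2 * th - x * sin th)).
  apply: eq_Rintegral => x _; rewrite /rot_integrand.
  by congr (_ * cos (_ - _)); ring.
move=> ->; rewrite /Gamma -RintegralZr; last 2 first.
- exact: measurable_oy.
- have := @integrable_powR_expR R (1 - al) 1 b1 ltr01.
  apply: eq_integrable; first exact: measurable_oy.
  by move=> x _ /=; rewrite mul1r; congr (_ `^ _ * _)%:E; ring.
apply: eq_Rintegral => x _; rewrite /rot_integrand cos0 sin0 mul1r !mulr0 subr0 addr0.
by congr (_ `^ _ * _ * _); ring.
Qed.

Lemma gt0_powR_sqr al x : 0 < x -> x `^ (- al - 1) * x ^+ 2 = x `^ (1 - al).
Proof.
move=> x0; rewrite -(powR_mulrn 2 (ltW x0)) -(gt0_powRD _ _ x0); congr (_ `^ _).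
by ring.
Qed.

Lemma integrable_oneBcos al c s : 0 < al < 2 -> 0 <= c -> `|s| <= 1 ->
  mu.-integrable `]0, +oo[
    (fun x => (x `^ (- al - 1) * expR (- (c * x)) * (1 - cos (x * s)))%:E).
Proof.
move=> /andP[al0 al2] c0 s1.
(* 4 bounds the factor 2 (1 + s^2) of [oneBcos_le_ratio] for |s| <= 1. *)
apply: (integrable_le0y (c := 4) (integrable_powR_quadratic al0 al2)).
  apply: measurable_fun_oy => x x0; apply: is_derive1_continuous.
  by derive1.
move=> x x0.
rewrite ger0_norm ?mulr_ge0 ?powR_ge0 ?expR_ge0 ?oneBcos_ge0//.
rewrite -(gt0_powR_sqr _ x0) -mulrA.
have -> p q : 4 * (p * x ^+ 2 / q) = p * (4 * (x ^+ 2 / q)) by ring.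
rewrite ler_wpM2l ?powR_ge0//.
apply: (@le_trans _ _ (1 - cos (x * s))).
  rewrite ler_piMl ?oneBcos_ge0// -[leRHS]expR0 ler_expR oppr_le0 mulr_ge0//.
  exact: ltW.
rewrite (mulrC x); apply: le_trans (oneBcos_le_ratio s x) _.
rewrite ler_wpM2r ?divr_ge0 ?addr_ge0 ?sqr_ge0//.
have : s ^+ 2 <= 1 by rewrite -[leLHS]real_normK ?num_real// expr_le1.
by lra.
Qed.

Let F c s x := expR (- (c * x)) * (1 - cos (x * s)).
Let F' c s x := expR (- (c * x)) * (s * sin (x * s) - c * (1 - cos (x * s))).

(** Up to the exponential factor, F = O(x^2) and F' = O(x), so the boundary terms of both
    integrations by parts are O(x^(2-al) e^(-c x)) and vanish at 0 and at infinity. *)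
Let boundary_bound al c s x : 0 < x -> 0 <= c <= 1 -> 0 <= s <= 1 ->
  `|x `^ (1 - al) * F' c s x - (1 - al) * (x `^ (- al) * F c s x)|
  <= (2 + `|1 - al|) * (x `^ (2 - al) * expR (- (c * x))).
Proof.
move=> x0 /andP[c0 c1] /andP[s0 s1].
have -> : x `^ (1 - al) = x `^ (- al) * x.
  by rewrite addrC (gt0_powRD _ _ x0) powRr1 ?(ltW x0).
have -> : x `^ (2 - al) = x `^ (- al) * x ^+ 2.
  by rewrite addrC (gt0_powRD _ _ x0) powR_mulrn ?(ltW x0).
have xs0 : 0 <= x * s by rewrite mulr_ge0 ?(ltW x0).
have xsx : x * s <= x by rewrite ler_piMr ?(ltW x0).
have h1 : `|s * sin (x * s) - c * (1 - cos (x * s))| <= 2 * x.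
  apply: le_trans (ler_normB _ _) _.
  rewrite !normrM (ger0_norm s0) (ger0_norm c0) (ger0_norm (oneBcos_ge0 _)).
  rewrite mulr_natl mulr2n; apply: lerD.
    apply: (@le_trans _ _ (1 * `|x * s|)).
      by apply: ler_pM => //; exact: norm_sin_le.
    by rewrite mul1r ger0_norm.
  apply: (@le_trans _ _ (1 * (x * s))); last by rewrite mul1r.
  by apply: ler_pM; rewrite ?oneBcos_ge0 ?oneBcos_le_id.
have h2 : `|1 - cos (x * s)| <= x ^+ 2.
  rewrite (ger0_norm (oneBcos_ge0 _)); apply: le_trans (oneBcos_le_sqr _) _.
  have : (x * s) ^+ 2 <= x ^+ 2 by rewrite lerXn2r ?nnegrE ?(ltW x0).
  have := sqr_ge0 x; lra.
rewrite /F /F'; set e := expR _; have e0 : 0 <= e := expR_ge0 _.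
set p := x `^ (- al); have p0 : 0 <= p := powR_ge0 _ _.
have -> : p * x * (e * (s * sin (x * s) - c * (1 - cos (x * s)))) -
    (1 - al) * (p * (e * (1 - cos (x * s)))) =
  (p * e) * (x * (s * sin (x * s) - c * (1 - cos (x * s))) - (1 - al) * (1 - cos (x * s))).
  by ring.
have -> : (2 + `|1 - al|) * (p * x ^+ 2 * e) = (p * e) * (x * (2 * x) + `|1 - al| * x ^+ 2).
  by ring.
rewrite normrM ger0_norm ?mulr_ge0// ler_wpM2l ?mulr_ge0//.
apply: le_trans (ler_normB _ _) _; apply: lerD.
  by rewrite normrM (gtr0_norm x0) ler_wpM2l ?(ltW x0).
by rewrite normrM ler_wpM2l.
Qed.

(* Twofold integration by parts of x^(-al-1) F(x) with
   F(x) = e^(-x cos th) (1 - cos (x sin th)). *)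
Lemma oneBcos_integral_by_parts al th : 0 < al < 2 -> 0 <= th < pi / 2 ->
  al * (1 - al) * \int[mu]_(x in `]0, +oo[)
    (x `^ (- al - 1) * expR (- (cos th * x)) * (1 - cos (x * sin th))) =
  Gamma (2 - al) * cos (al * th) -
  \int[mu]_(x in `]0, +oo[) (cos th ^+ 2 * (x `^ (1 - al) * expR (- (cos th * x)))).
Proof.
move=> alI thI; rewrite -rot_integral_Gamma//.
have /andP[al0 al2] := alI; have /andP[th0 thpi] := thI.
have p0 := @pi_gt0 R.
set c := cos th; set s := sin th.
have c0 : 0 < c by apply: cos_gt0_pihalf; lra.
have c01 : 0 <= c <= 1 by rewrite (ltW c0) cos_le1.
have s01 : 0 <= s <= 1 by rewrite sin_le1 sin_ge0_pi//; lra.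
have b1 : -1 < 1 - al by lra.
have p2 : 0 < 2 - al by lra.
pose t1 x := x `^ (- al - 1) * expR (- (c * x)) * (1 - cos (x * s)).
pose t2 x := x `^ (1 - al) * expR (- (c * x)) * cos (2 * th - x * s).
pose t3 x := c ^+ 2 * (x `^ (1 - al) * expR (- (c * x))).
have i1 : mu.-integrable `]0, +oo[ (fun x => (t1 x)%:E).
  apply: integrable_oneBcos; rewrite ?(ltW c0)//.
  by rewrite ger0_norm; case/andP: s01.
have i2 : mu.-integrable `]0, +oo[ (fun x => (t2 x)%:E).
  apply: eq_integrable (@integrable_rot R _ b1 (al * th) th c0); first exact: measurable_oy.
  move=> x _; rewrite /rot_integrand /t2; congr (_ * cos (_ - _))%:E; ring.
have i3 : mu.-integrable `]0, +oo[ (fun x => (t3 x)%:E).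
  apply: integrable_fZl; first exact: measurable_oy.
  exact: integrable_powR_expR.
have mI := measurable_oy (0 : R).
have lim0 (G : set_system R) (FG : ProperFilter G) : (\forall x \near G, 0 < x) ->
    x `^ (2 - al) * expR (- (c * x)) @[x --> G] --> 0 ->
    x `^ (1 - al) * F' c s x - (1 - al) * (x `^ (- al) * F c s x) @[x --> G] --> 0.
  move=> G0 H; apply/norm_cvg0P.
  have : (2 + `|1 - al|) * (x `^ (2 - al) * expR (- (c * x))) @[x --> G] --> 0.
    rewrite -[X in _ --> X](mulr0 (2 + `|1 - al|)).
    by apply: cvgM => //; exact: cvg_cst.
  apply: squeeze_cvgr (cvg_cst 0); near=> x; rewrite normr_ge0/=.
  by apply: boundary_bound => //; near: x.
(* [t3 - t2] is x^(1-al) F''(x): since e^(-c x) cos(x s) is the real part of exp(-x e^(i th)), its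
   second derivative is e^(-c x) cos(2 th - x s). *)
have : \int[mu]_(x in `]0, +oo[) (t3 x - t2 x + al * (1 - al) * t1 x) = 0 - 0.
  apply: (FTC_oy (F := fun x => x `^ (1 - al) * F' c s x -
     (1 - al) * (x `^ (- al) * F c s x))).
  - move=> x x0; apply: is_derive1_continuous.
    by rewrite /t1 /t2 /t3; derive1.
  - move=> x x0; rewrite /F /F' /t1 /t2 /t3; derive1_eq.
    have -> : cos (2 * th - x * s) =
        (c * c - s * s) * cos (x * s) + (s * c + c * s) * sin (x * s).
      by rewrite (_ : 2 * th = th + th) ?cosB ?cosD ?sinD//; ring.
    have -> : 1 - al - 1 = - al by ring.
    rewrite -(gt0_powR_sqr _ x0).
    have -> : x `^ (- al) = x `^ (- al - 1) * x.
      by rewrite -[X in _ * X](powRr1 (ltW x0)) -(gt0_powRD _ _ x0); congr (_ `^ _); ring.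
    ring.
  - by apply: lim0; [near=> x|exact: cvg_powR_expR0].
  - by apply: lim0; [near=> x|exact: cvgy_powR_expR].
  - apply: integrable_fD => //; first exact: integrable_fB.
    exact: integrable_fZl.
rewrite subrr RintegralD//; last 2 first.
- exact: integrable_fB.
- exact: integrable_fZl.
rewrite RintegralB// RintegralZl// => /eqP; rewrite addrC addr_eq0 => /eqP ->.
by rewrite opprB.
Unshelve. all: by end_near. Qed.

Definition oneBcos_moment al : R :=
  \int[mu]_(x in `]0, +oo[) (x `^ (- al - 1) * (1 - cos x)).

(** The rotation by pi / 2 is reached only as a limit; these angles are nonnegative because pi / 2
    >= 1. *)
Let theta (n : nat) : R := pi / 2 - n.+1%:R^-1.

Let thetaI n : 0 <= theta n < pi / 2.
Proof.
rewrite /theta subr_ge0 ltrBlDr ltrDl invr_gt0 ltr0n andbT.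
by rewrite (le_trans _ (pihalf_ge1 R))// invf_le1// ler1n.
Qed.

Let cvg_theta : theta n @[n --> \oo] --> pi / 2.
Proof.
rewrite -[X in _ --> X]subr0; apply: cvgB; first exact: cvg_cst.
exact: cvg_harmonic.
Qed.

Let cos_theta n : 0 <= cos (theta n) <= 1.
Proof.
rewrite cos_le1 andbT; apply: cos_ge0_pihalf.
by have := thetaI n; have := @pi_gt0 R; lra.
Qed.

Let cvg_cos_theta : cos (theta n) @[n --> \oo] --> (0 : R).
Proof. by rewrite -cos_pihalf; apply: continuous_cvg cvg_theta; exact: continuous_cos. Qed.

Let cvg_sin_theta : sin (theta n) @[n --> \oo] --> (1 : R).
Proof. by rewrite -sin_pihalf; apply: continuous_cvg cvg_theta; exact: continuous_sin. Qed.

Let cvg_expR_theta x : expR (- (cos (theta n) * x)) @[n --> \oo] --> (1 : R).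
Proof.
rewrite -[X in _ --> X]expR0; apply: continuous_cvg; first exact: continuous_expR.
rewrite -oppr0; apply: cvgN; rewrite -[X in _ --> X](mul0r x).
by apply: cvgM cvg_cos_theta _; exact: cvg_cst.
Qed.

Lemma oneBcos_le_quadratic al s x : 0 < x -> `|s| <= 1 ->
  x `^ (- al - 1) * (1 - cos (x * s)) <= 4 * (x `^ (1 - al) / (1 + x ^+ 2)).
Proof.
move=> x0 s1; rewrite -(gt0_powR_sqr _ x0).
have -> p q : 4 * (p * x ^+ 2 / q) = p * (4 * (x ^+ 2 / q)) by ring.
rewrite ler_wpM2l ?powR_ge0//.
rewrite (mulrC x); apply: le_trans (oneBcos_le_ratio s x) _.
rewrite ler_wpM2r ?divr_ge0 ?addr_ge0 ?sqr_ge0//.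
have : s ^+ 2 <= 1 by rewrite -[leLHS]real_normK ?num_real// expr_le1.
by lra.
Qed.

(** The limit th -> pi / 2 in [oneBcos_integral_by_parts], where cos th kills the last integral. At
    al = 1 both sides are 0, so that value needs [oneBcos_moment1]. *)
Lemma oneBcos_momentE al : 0 < al < 2 ->
  al * (1 - al) * oneBcos_moment al = Gamma (2 - al) * cos (al * (pi / 2)).
Proof.
move=> alI; have /andP[al0 al2] := alI.
have iq : mu.-integrable `]0, +oo[ (fun x => (4 * (x `^ (1 - al) / (1 + x ^+ 2)))%:E).
  apply: integrable_fZl; first exact: measurable_oy.
  exact: integrable_powR_quadratic.
have mI := measurable_oy (0 : R).
have lhs : al * (1 - al) * \int[mu]_(x in `]0, +oo[)
    (x `^ (- al - 1) * expR (- (cos (theta n) * x)) * (1 - cos (x * sin (theta n))))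
    @[n --> \oo] --> al * (1 - al) * oneBcos_moment al.
  apply: cvgM; first exact: cvg_cst.
  apply: (@Rintegral_dominated_cvg _ _ _ mu _
    (fun n x => x `^ (- al - 1) * expR (- (cos (theta n) * x)) * (1 - cos (x * sin (theta n))))
    (fun x => x `^ (- al - 1) * (1 - cos x)) _ mI _ _ _ iq).
  - move=> n; move: (cos (theta n)) (sin (theta n)) => c s'.
    apply: measurable_fun_oy => x x0; apply: is_derive1_continuous.
    by derive1.
  - apply: measurable_fun_oy => x x0; apply: is_derive1_continuous.
    by derive1.
  - apply/aeW => x _ /=; apply: cvgM.
      rewrite -[X in _ --> X]mulr1; apply: cvgM; first exact: cvg_cst.
      exact: cvg_expR_theta.
    apply: cvgB; first exact: cvg_cst.
    apply: continuous_cvg; first exact: continuous_cos.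
    by rewrite -[X in _ --> X]mulr1; apply: cvgM => //; exact: cvg_cst.
  - move=> n x /=; rewrite in_itv/= andbT => x0.
    rewrite ger0_norm ?mulr_ge0 ?powR_ge0 ?expR_ge0 ?oneBcos_ge0//.
    apply: le_trans (oneBcos_le_quadratic al x0 (sin_max (theta n))).
    rewrite -mulrA ler_wpM2l ?powR_ge0// ler_piMl ?oneBcos_ge0//.
    have /andP[c0 _] := cos_theta n.
    by rewrite -[leRHS]expR0 ler_expR oppr_le0 mulr_ge0// ltW.
have rhs : Gamma (2 - al) * cos (al * theta n) - \int[mu]_(x in `]0, +oo[)
    (cos (theta n) ^+ 2 * (x `^ (1 - al) * expR (- (cos (theta n) * x))))
    @[n --> \oo] --> Gamma (2 - al) * cos (al * (pi / 2)) - 0.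
  apply: cvgB.
    apply: cvgM; first exact: cvg_cst.
    apply: continuous_cvg; first exact: continuous_cos.
    by apply: cvgM => //; exact: cvg_cst.
  rewrite [X in _ --> X](_ : 0 = \int[mu]_(x in `]0, +oo[) (cst 0 x)); last first.
    by rewrite /Rintegral integral0.
  apply: (@Rintegral_dominated_cvg _ _ _ mu _
    (fun n x => cos (theta n) ^+ 2 * (x `^ (1 - al) * expR (- (cos (theta n) * x))))
    (cst 0) _ mI _ _ _ iq).
  - move=> n; move: (cos (theta n)) (sin (theta n)) => c s'.
    apply: measurable_fun_oy => x x0; apply: is_derive1_continuous.
    by derive1.
  - exact: measurable_cst.
  - apply/aeW => x _ /=.
    rewrite -[X in _ --> X](mul0r (x `^ (1 - al) * 1)).
    apply: cvgM; first by rewrite -(mulr0 0); apply: cvgM.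
    by apply: cvgM (cvg_expR_theta _); exact: cvg_cst.
  - move=> n x /=; rewrite in_itv/= andbT => x0.
    have x20 : 0 < 1 + x ^+ 2 by rewrite ltr_pwDl// sqr_ge0.
    have /andP[c0 c1] := cos_theta n; set c := cos _ in c0 c1 *.
    rewrite ger0_norm ?mulr_ge0 ?sqr_ge0 ?powR_ge0 ?expR_ge0//.
    rewrite mulrCA [leRHS]mulrCA ler_wpM2l ?powR_ge0// ler_pdivlMr//.
    rewrite expRN mulrAC ler_pdivrMr ?expR_gt0//.
    have cx0 : 0 <= c * x by rewrite mulr_ge0// ltW.
    (* e^(c x) >= 1 + (c x)^2 / 2 absorbs c^2 (1 + x^2) uniformly in the angle, so the same
       dominating function serves again. *)
    have := expR_ge1Dxn 1 cx0; rewrite -[1%N.+1`!]/2%N => h.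
    have c21 : c ^+ 2 <= 1 by rewrite expr_le1.
    have h2 : c ^+ 2 * (1 + x ^+ 2) = c ^+ 2 + (c * x) ^+ 2 by ring.
    by rewrite h2; have := sqr_ge0 (c * x); lra.
have e n := oneBcos_integral_by_parts alI (thetaI n).
move: lhs; under eq_fun do rewrite e.
by move=> /(cvg_unique (@norm_hausdorff _ _) rhs) <-; rewrite subr0.
Qed.

(** Write x^(-2) as the integral of y e^(-x y) over y and exchange: the inner integral over x
    becomes 1 / (1 + y^2), whose integral is pi / 2. *)
Lemma oneBcos_moment1 : oneBcos_moment 1 = pi / 2.
Proof.
rewrite /oneBcos_moment /Rintegral; have mI := measurable_oy (0 : R).
suff -> : (\int[mu]_(x in `]0%R, +oo[) (x `^ (- 1 - 1) * (1 - cos x))%:E = (pi / 2)%:E)%E by [].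
transitivity (\int[mu]_(x in `]0%R, +oo[) \int[mu]_(y in `]0%R, +oo[)
    (y * expR (- (x * y)) * (1 - cos x))%:E)%E.
  apply: eq_integral => x; rewrite inE/= in_itv/= andbT => x0.
  rewrite (_ : x `^ (- 1 - 1) = x ^- 2); last first.
    by rewrite -opprD -powR_invn// ltW.
  have mf : measurable_fun (`]0, +oo[%classic : set R) (fun y => y * expR (- (x * y))).
    by apply: measurable_fun_oy => y y0; apply: is_derive1_continuous; derive1.
  rewrite EFinM -integral_xexpR// -ge0_integralZr//=.
  - exact/measurable_EFinP.
  - by move=> y; rewrite in_itv/= andbT lee_fin => y0; rewrite mulr_ge0 ?expR_ge0 ?ltW.
rewrite (@tonelli_on _ _ _ _ R mu mu _ _ (fun z => z.2 * expR (- (z.1 * z.2)) * (1 - cos z.1)));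
  last 4 first.
- exact: mI.
- exact: mI.
- apply: measurable_funM; first apply: measurable_funM.
  + exact: measurable_snd.
  + apply: measurableT_comp; first exact: measurable_expR.
    apply: measurableT_comp => //; apply: measurable_funM.
      exact: measurable_fst.
    exact: measurable_snd.
  + apply: measurable_funB => //; apply: measurableT_comp; last exact: measurable_fst.
    exact: (continuous_measurable_fun (@continuous_cos R)).
- move=> x y; rewrite /= !in_itv/= !andbT => x0 y0.
  by rewrite !mulr_ge0 ?expR_ge0 ?oneBcos_ge0 ?(ltW y0).
rewrite -integral0y_oneDsqr -integral_itv_obnd_cbnd; last first.
  apply/measurable_EFinP; apply: measurable_fun_oy => y y0.
  exact: continuous_oneDsqrV.
apply: eq_integral => y; rewrite inE/= in_itv/= andbT => y0.
transitivity (\int[mu]_(x in `]0%R, +oo[) (y%:E * (expR (- (y * x)) * (1 - cos (x * 1)))%:E))%E.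
  by apply: eq_integral => x _; rewrite -EFinM mulr1 mulrA (mulrC y x).
have mf : measurable_fun (`]0, +oo[%classic : set R)
    (fun x => expR (- (y * x)) * (1 - cos (x * 1))).
  by apply: measurable_fun_oy => x x0; apply: is_derive1_continuous; derive1.
rewrite ge0_integralZl//=.
- rewrite laplace_oneBcos// -EFinM; congr EFin; rewrite /oneDsqr.
  by field; rewrite !gt_eqF// ?ltr_pwDl ?sqr_ge0// ltr_wpDr// exprn_gt0.
- exact/measurable_EFinP.
- by rewrite lee_fin; exact: ltW.
Qed.

Lemma stable_c_moment al : 0 < al < 2 -> al * oneBcos_moment al = (stable_c al)^-1.
Proof.
move=> alI; rewrite /stable_c; have [->|al1] := eqVneq al 1.
  by rewrite mul1r oneBcos_moment1 invf_div.
rewrite invf_div; have a1 : 1 - al != 0 by rewrite subr_eq0 eq_sym.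
apply: (mulfI a1); rewrite mulrA (mulrC (1 - al)) oneBcos_momentE//.
by rewrite [RHS]mulrC divfK//; congr (_ * cos _); ring.
Qed.

End stable_constant_value.

(** * The renewal identity *)

Section power_substitution.
Context {R : realType}.
Notation mu := (@lebesgue_measure R).
Implicit Types (x y s t c : R).
Variables (a : R) (h : R -> R).
Hypothesis a0 : 0 < a.
Hypothesis h0 : forall x, 0 < x -> 0 <= h x.
Hypothesis ch : forall x, 0 < x -> {for x, continuous h}.
Hypothesis ih : mu.-integrable `]0, +oo[ (fun x => (x `^ (- a^-1 - 1) * h x)%:E).

Definition power_moment := \int[mu]_(x in `]0, +oo[) (x `^ (- a^-1 - 1) * h x).

Let tail x := \int[mu]_(z in `]x, +oo[) (z `^ (- a^-1 - 1) * h z).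

(** The substitution x = c s^(-a), carried out by exhibiting the antiderivative: the tail integral
    evaluated at c s^(-a), which falls from infinity to 0 as s grows. *)
Lemma integral_power_substitution c : 0 < c ->
  (\int[mu]_(s in `]0%R, +oo[) (h (c * s `^ (- a)))%:E =
   (c `^ a^-1 * (a^-1 * power_moment))%:E)%E.
Proof.
move=> c0; have an0 : a != 0 by rewrite gt_eqF.
pose u s := c * s `^ (- a).
have u0 s : 0 < s -> 0 < u s by move=> s0; rewrite mulr_gt0 ?powR_gt0.
have du s : 0 < s -> is_derive s 1 u (c * (- a * s `^ (- a - 1))).
  by move=> s0; rewrite /u; derive1_eq; ring.
rewrite -[X in X%:E]subr0.
apply: (@ge0_FTC_oy _ _ (fun s => c `^ a^-1 * (a^-1 * tail (u s)))).
- by move=> s /u0 /h0.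
- move=> s s0; apply: (@continuous_comp _ _ _ u h).
    exact: is_derive1_continuous (du _ s0).
  exact/ch/u0.
- move=> s s0.
  have dk : is_derive (u s) 1 tail (- ((u s) `^ (- a^-1 - 1) * h (u s))).
    apply: (is_derive_tail_integral ih); first exact: u0.
    apply: (@continuousM _ _ (fun z => z `^ (- a^-1 - 1)) h); last exact/ch/u0.
    exact: is_derive1_continuous (is_derive1_powR _ (u0 _ s0)).
  have dtu := @is_derive1_comp _ tail u s _ _ dk (du _ s0).
  have dtu' : is_derive s 1 (fun s => tail (u s))
    (- (u s `^ (- a^-1 - 1) * h (u s)) * (c * (- a * s `^ (- a - 1)))) by [].
  derive1_eq.
  rewrite !mulr0 !addr0 -/(u s).
  have -> : u s `^ (- a^-1 - 1) = c `^ (- a^-1) * c^-1 * (s * s `^ a).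
    rewrite /u powRM ?powR_ge0 ?(ltW c0)// -powRrM (gt0_powRD _ _ c0).
    rewrite powR_inv1 ?(ltW c0)//.
    have -> : - a * (- a^-1 - 1) = 1 + a by field.
    by rewrite (gt0_powRD _ _ s0) powRr1// ltW.
  rewrite powRN (gt0_powRD _ _ s0) powR_inv1 ?(ltW s0)// powRN.
  have ca0 : c `^ a^-1 != 0 by rewrite gt_eqF ?powR_gt0.
  have sa0 : s `^ a != 0 by rewrite gt_eqF ?powR_gt0.
  by field; rewrite ca0 sa0 an0 !gt_eqF.
- rewrite -[X in _ --> X](mulr0 (c `^ a^-1)); apply: cvgM; first exact: cvg_cst.
  rewrite -[X in _ --> X](mulr0 a^-1); apply: cvgM; first exact: cvg_cst.
  have uy : u s @[s --> 0^'+] --> +oo.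
    apply: gt0_cvgMry => //; under eq_fun do rewrite powRN.
    have h1 : \forall s \near 0^'+, 0 < (s `^ a)^-1.
      by near=> s; rewrite invr_gt0 powR_gt0.
    apply/(gtr0_cvgV0 h1).
    have : ((s `^ a)^-1)^-1 @[s --> 0^'+] --> 0.
      by under eq_fun do rewrite invrK; exact: powR_cvg0.
    by [].
  exact: (@cvg_comp _ _ _ u tail _ _ _ uy (cvg_tail_integral_pinfty ih)).
- apply: cvgM; first exact: cvg_cst.
  apply: cvgM; first exact: cvg_cst.
  (* The tail integral has a limit at 0 from the right only, so u must be known to approach 0
     through positive values. *)
  have u0' : u s @[s --> +oo] --> 0^'+.
    have cu : u s @[s --> +oo] --> 0.
      rewrite -[X in _ --> X](mulr0 c); apply: cvgM; first exact: cvg_cst.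
      exact: cvgy_powRN.
    move=> A A0.
    have cA : \forall s \near +oo, 0 < u s -> A (u s).
      exact: (cu _ A0).
    apply: filterS2 cA (nbhs_pinfty_gt (num_real 0)) => s H s0.
    exact: H (u0 _ s0).
  exact: (@cvg_comp _ _ _ u tail _ _ _ u0' (cvg_tail_integral_right ih)).
Unshelve. all: by end_near. Qed.

End power_substitution.

Section bounded_integrals.
Context d (T : measurableType d) (R : realType) (P : probability T R).
Implicit Types f : T -> R.

Lemma integrable_bounded f (C : R) : measurable_fun setT f ->
  (forall x, `|f x| <= C) -> P.-integrable setT (fun x => (f x)%:E).
Proof.
move=> mf fC; apply: measurable_bounded_integrable => //.
  by rewrite (@le_lt_trans _ _ 1%E) ?probability_le1// ltry.
exists C; split; first exact: num_real.
by move=> x Cx y _; exact: le_trans (fC y) (ltW Cx).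
Qed.

Lemma EFin_Rintegral_bounded f (C : R) : measurable_fun setT f ->
  (forall x, `|f x| <= C) -> (\int[P]_x f x)%:E = (\int[P]_x (f x)%:E)%E.
Proof.
move=> mf fC; rewrite fineK//; apply: integrable_fin_num => //.
exact: integrable_bounded fC.
Qed.

Lemma Rintegral_prob_cst (c : R) : \int[P]_x c = c.
Proof. by rewrite Rintegral_cst//= probability_setT mulr1. Qed.

Lemma norm_Rintegral_le f (C : R) : measurable_fun setT f ->
  (forall x, `|f x| <= C) -> `|\int[P]_x f x| <= C.
Proof.
move=> mf fC; apply: le_trans (le_normr_Rintegral _ _) _ => //.
  exact: integrable_bounded fC.
rewrite -[leRHS]Rintegral_prob_cst; apply: le_Rintegral => //.
- by apply: (integrable_bounded (C := C)) => [|x]; [exact: measurableT_comp|rewrite normr_id].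
- by apply: (integrable_bounded (C := `|C|)).
Qed.

End bounded_integrals.

Section scale_mixture.
Context {R : realType}.
Notation mu := (@lebesgue_measure R).
Implicit Types (x y s t c : R).
Variables (a : R) (h : R -> R) (C : R).
Hypothesis a0 : 0 < a.
Hypothesis h0 : forall x, 0 <= h x.
Hypothesis hC : forall x, h x <= C.
Hypothesis ch : continuous h.
Hypothesis he : forall x, h (- x) = h x.
Hypothesis h00 : h 0 = 0.
Hypothesis ih : mu.-integrable `]0, +oo[ (fun x => (x `^ (- a^-1 - 1) * h x)%:E).

Let mh : measurable_fun setT h.
Proof. exact: continuous_measurable_fun. Qed.

Lemma integral_even_power_substitution y :
  (\int[mu]_(s in `]0%R, +oo[) (h (y * s `^ (- a)))%:E =
   (`|y| `^ a^-1 * (a^-1 * power_moment a h))%:E)%E.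
Proof.
have [->|y0] := eqVneq y 0.
  rewrite normr0 powR0 ?invr_eq0 ?gt_eqF// mul0r integral0_eq// => x _.
  by rewrite mul0r h00.
rewrite -(integral_power_substitution a0 _ _ ih) ?normr_gt0//.
- apply: eq_integral => s _; congr EFin.
  by have [y1|y1] := ger0P y => //; rewrite mulNr he.
- by move=> x _; exact: ch.
Qed.

Variable lam : probability R R.

(** General in h because two cases are needed: 1 - cos gives the exponent of the characteristic
    function, and x^2 / (1 + x^2) gives a bound free of t. *)
Definition scale_mixture t s := \int[lam]_y h (t * y * s `^ (- a)).

Let measurable_scaled t s : measurable_fun setT (fun y => h (t * y * s `^ (- a))).
Proof.
by apply: (measurableT_comp mh); apply: measurable_funM.
Qed.

Let norm_h x : `|h x| <= C.
Proof. by rewrite ger0_norm. Qed.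

Lemma scale_mixture_ge0 t s : 0 <= scale_mixture t s.
Proof. by apply: Rintegral_ge0. Qed.

Lemma scale_mixture_le t s : scale_mixture t s <= C.
Proof.
by apply: le_trans (ler_norm _) _; apply: norm_Rintegral_le.
Qed.

Lemma continuous_scale_mixture t s : 0 < s -> {for s, continuous (scale_mixture t)}.
Proof.
move=> s0; have sI : s \in `]0, s + 1[%classic.
  by apply/mem_set; rewrite /= in_itv/= s0 ltrDl ltr01.
have mT := @measurableT _ (measurableTypeR R).
apply: (@continuity_under_integral R _ _ lam (fun s y => h (t * y * s `^ (- a)))
  setT measurableT 0 (s + 1) _ _ (cst C)) => //.
- move=> x _; apply: integrable_bounded; first exact: measurable_scaled.
  by move=> y; exact: norm_h.
- apply/aeW => y _ x; rewrite inE/= in_itv/= => /andP[x0 _].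
  apply: (@continuous_comp _ _ _ (fun s => t * y * s `^ (- a)) h); last exact: ch.
  by apply: is_derive1_continuous; derive1.
- exact: finite_measure_integrable_cst.
- by move=> x _; apply/aeW => y _; exact: norm_h.
Qed.

Lemma measurable_scale_mixture t : measurable_fun setT (scale_mixture t).
Proof.
have m1 : measurable_fun setT (fun z : R * R => z.1 `^ (- a)).
  exact: (measurableT_comp (measurable_powR (- a)) measurable_fst).
have m2 : measurable_fun setT (fun z : R * R => t * z.2).
  by apply: measurable_funM; [exact: measurable_cst|exact: measurable_snd].
have mf : measurable_fun setT (fun z : R * R => (h (t * z.2 * z.1 `^ (- a)))%:E).
  by apply/measurable_EFinP; apply: (measurableT_comp mh); exact: measurable_funM m2 m1.
have H : measurable_fun setT (fubini_F lam (fun z : R * R => (h (t * z.2 * z.1 `^ (- a)))%:E)).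
  by apply: measurable_fun_fubini_tonelli_F => // z; rewrite lee_fin.
apply/measurable_EFinP; rewrite (_ : EFin \o _ = fubini_F lam
  (fun z : R * R => (h (t * z.2 * z.1 `^ (- a)))%:E))//.
by apply/funext => s; exact: (@EFin_Rintegral_bounded _ _ _ _ _ C).
Qed.

Hypothesis lam_moment : (\int[lam]_y (`|y| `^ a^-1)%:E < +oo)%E.

Let m := fine (\int[lam]_y (`|y| `^ a^-1)%:E)%E.

(** Tonelli's theorem requires no prior integrability; the finite right-hand side then yields
    [integrable_scale_mixture]. *)
Lemma ereal_integral_scale_mixture t :
  (\int[mu]_(s in `]0%R, +oo[) (scale_mixture t s)%:E =
   (`|t| `^ a^-1 * m * (a^-1 * power_moment a h))%:E)%E.
Proof.
have mI := measurable_oy (0 : R).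
transitivity (\int[mu]_(s in `]0%R, +oo[) \int[lam]_y (h (t * y * s `^ (- a)))%:E)%E.
  apply: eq_integral => s _; apply: (@EFin_Rintegral_bounded _ _ _ _ _ C) => //.
have m1 : measurable_fun setT (fun z : measurableTypeR R * R => z.1 `^ (- a)).
  exact: (measurableT_comp (measurable_powR (- a)) measurable_fst).
have m2 : measurable_fun setT (fun z : measurableTypeR R * R => t * z.2).
  apply: measurable_funM; [exact: measurable_cst|exact: measurable_snd].
have mf : measurable_fun setT (fun z : measurableTypeR R * R => h (t * z.2 * z.1 `^ (- a))).
  apply: (measurableT_comp mh); exact: measurable_funM m2 m1.
rewrite (@tonelli_on _ _ _ _ R mu lam _ _ (fun z => h (t * z.2 * z.1 `^ (- a))))//.
have M0 : 0 <= a^-1 * power_moment a h.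
  by rewrite mulr_ge0 ?invr_ge0 ?(ltW a0)//; apply: Rintegral_ge0 => x _;
    rewrite mulr_ge0 ?powR_ge0.
have mp : measurable_fun setT (fun y : R => (`|y| `^ a^-1)%:E).
  apply/measurable_EFinP; apply: (measurableT_comp (measurable_powR a^-1)).
  exact: normr_measurable.
transitivity (\int[lam]_y ((`|y| `^ a^-1)%:E * (`|t| `^ a^-1 * (a^-1 * power_moment a h))%:E))%E.
  apply: eq_integral => y _; rewrite /= integral_even_power_substitution.
  by rewrite normrM powRM// -EFinM; congr EFin; ring.
rewrite ge0_integralZr//.
- rewrite -[X in (X * _)%E]fineK; last first.
    by rewrite ge0_fin_numE// integral_ge0// => y _; rewrite lee_fin powR_ge0.
  by rewrite -EFinM -/m; congr EFin; ring.
by rewrite lee_fin mulr_ge0 ?powR_ge0.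
Qed.

Lemma integrable_scale_mixture t :
  mu.-integrable `]0, +oo[ (fun s => (scale_mixture t s)%:E).
Proof.
apply/integrableP; split.
  apply/measurable_EFinP; apply: measurable_fun_oy => s s0.
  exact: continuous_scale_mixture.
under eq_integral do rewrite /= ger0_norm ?scale_mixture_ge0//.
by rewrite ereal_integral_scale_mixture ltry.
Qed.

Lemma integral_scale_mixture t :
  \int[mu]_(s in `]0, +oo[) scale_mixture t s =
   `|t| `^ a^-1 * m * (a^-1 * power_moment a h).
Proof. by rewrite /Rintegral ereal_integral_scale_mixture. Qed.

End scale_mixture.

Section positive_tail.
Context {R : realType}.
Notation mu := (@lebesgue_measure R).
Implicit Types (f : R -> R) (g x : R).

(** Clipping at 0 makes this monotone and bounded on all of R when f is nonnegative and integrable: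
    arrival times are positive only almost surely, and the functions composed with them must be
    measurable and bounded everywhere. *)
Definition tail_integral f g := \int[mu]_(s in `]Num.max g 0, +oo[) f s.

Lemma max0_ge0 g : 0 <= Num.max g 0.
Proof. by rewrite le_max lexx orbT. Qed.

Lemma integrable_tail f g : mu.-integrable `]0, +oo[ (fun s => (f s)%:E) ->
  mu.-integrable `]Num.max g 0, +oo[ (fun s => (f s)%:E).
Proof.
move=> fi; apply: integrableS fi; [exact: measurable_oy|exact: measurable_oy|].
by apply: subset_itvr; rewrite bnd_simp max0_ge0.
Qed.

Lemma tail_integral_eq f g : 0 <= g -> tail_integral f g = \int[mu]_(s in `]g, +oo[) f s.
Proof. by move=> g0; rewrite /tail_integral max_l. Qed.

Lemma tail_integral_ge0 f g : (forall s, 0 < s -> 0 <= f s) -> 0 <= tail_integral f g.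
Proof.
move=> f0; apply: Rintegral_ge0 => s /=; rewrite in_itv/= andbT => gs.
by apply: f0; exact: le_lt_trans (max0_ge0 g) gs.
Qed.

Lemma tail_integral_nonincreasing f : (forall s, 0 < s -> 0 <= f s) ->
  mu.-integrable `]0, +oo[ (fun s => (f s)%:E) ->
  {homo tail_integral f : x y /~ x <= y}.
Proof.
move=> f0 fi x y xy; rewrite /tail_integral.
have mxy : Num.max y 0 <= Num.max x 0.
  by rewrite ge_max max0_ge0 andbT le_max xy.
have fiy := integrable_tail y fi; have fix' := integrable_tail x fi.
rewrite /Rintegral fine_le ?integrable_fin_num//; [exact: measurable_oy..|].
apply: ge0_subset_integral; [exact: measurable_oy|exact: measurable_oy| | |].
- exact: measurable_int fiy.
- move=> s /=; rewrite in_itv/= andbT => ys; rewrite lee_fin f0//.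
  exact: le_lt_trans (max0_ge0 y) ys.
- by apply: subset_itvr; rewrite bnd_simp.
Qed.

Lemma measurable_tail_integral f : (forall s, 0 < s -> 0 <= f s) ->
  mu.-integrable `]0, +oo[ (fun s => (f s)%:E) ->
  measurable_fun setT (tail_integral f).
Proof.
move=> f0 fi; apply: nonincreasing_measurable => // x y.
exact: tail_integral_nonincreasing.
Qed.

Lemma cvg_tail_integral_y f : mu.-integrable `]0, +oo[ (fun s => (f s)%:E) ->
  tail_integral f x @[x --> +oo] --> 0.
Proof.
move=> fi; apply: cvg_trans (cvg_tail_integral_pinfty fi).
apply: near_eq_cvg; near=> x; rewrite tail_integral_eq//.
Unshelve. all: by end_near. Qed.

Lemma le_tail_integral f1 f2 (c : R) g :
  mu.-integrable `]0, +oo[ (fun s => (f1 s)%:E) ->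
  mu.-integrable `]0, +oo[ (fun s => (f2 s)%:E) ->
  (forall s, 0 < s -> f1 s <= c * f2 s) -> tail_integral f1 g <= c * tail_integral f2 g.
Proof.
move=> i1 i2 f12; rewrite /tail_integral.
have mI := measurable_oy (Num.max g 0).
have j1 := integrable_tail g i1; have j2 := integrable_tail g i2.
rewrite -RintegralZl//; apply: le_Rintegral => //.
  exact: integrable_fZl.
move=> s /=; rewrite in_itv/= andbT => gs.
by apply: f12; exact: le_lt_trans (max0_ge0 g) gs.
Qed.

End positive_tail.

Section renewal_function.
Context {R : realType}.
Notation mu := (@lebesgue_measure R).
Implicit Types (t g s x y : R).
Variables (a : R) (lam : probability R R).
Hypothesis a12 : 2^-1 < a.
Hypothesis lam_moment : (\int[lam]_y (`|y| `^ a^-1)%:E < +oo)%E.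

Let a0 : 0 < a. Proof. by apply: lt_trans a12; rewrite invr_gt0. Qed.

Let alI : 0 < a^-1 < 2.
Proof. by rewrite invr_gt0 a0/= -[ltRHS]invrK ltf_pV2 ?posrE ?invr_gt0. Qed.

Let m := fine (\int[lam]_y (`|y| `^ a^-1)%:E)%E.

Let oneBcos x : R := 1 - cos x.

(** A bounded stand-in for x^2 whose mean detects convergence to 0 in probability. *)
Definition ratio x : R := x ^+ 2 / (1 + x ^+ 2).

Let continuous_oneBcos : continuous oneBcos.
Proof. by move=> x; apply: is_derive1_continuous; rewrite /oneBcos; derive1. Qed.

Let d0 x : 1 + x ^+ 2 != 0.
Proof. by rewrite gt_eqF// ltr_pwDl// sqr_ge0. Qed.

Lemma continuous_ratio : continuous ratio.
Proof. by move=> x; apply: is_derive1_continuous; rewrite /ratio; derive1; exact: d0. Qed.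

Lemma ratio_ge0 x : 0 <= ratio x.
Proof. by rewrite divr_ge0 ?addr_ge0 ?sqr_ge0. Qed.

Lemma ratio_le1 x : ratio x <= 1.
Proof. by rewrite ler_pdivrMr ?mul1r ?lerDr// ltr_pwDl// sqr_ge0. Qed.

Let integrable_oneBcos_power :
  mu.-integrable `]0, +oo[ (fun x => (x `^ (- a^-1 - 1) * oneBcos x)%:E).
Proof.
have n1 : `|1 : R| <= 1 by rewrite normr1.
apply: eq_integrable (integrable_oneBcos alI (lexx 0) n1); first exact: measurable_oy.
by move=> x _ /=; rewrite mul0r oppr0 expR0 !mulr1.
Qed.

Let integrable_ratio_power :
  mu.-integrable `]0, +oo[ (fun x => (x `^ (- a^-1 - 1) * ratio x)%:E).
Proof.
have /andP[al0 al2] := alI.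
apply: eq_integrable (integrable_powR_quadratic al0 al2); first exact: measurable_oy.
move=> x; rewrite inE/= in_itv/= andbT => x0.
by rewrite -(gt0_powR_sqr _ x0) /ratio; congr EFin; rewrite mulrA.
Qed.

Definition cos_deficit t s := scale_mixture a oneBcos lam t s.
Definition ratio_mixture s := scale_mixture a ratio lam 1 s.

Let even_oneBcos x : oneBcos (- x) = oneBcos x.
Proof. by rewrite /oneBcos cosN. Qed.

Let even_ratio x : ratio (- x) = ratio x.
Proof. by rewrite /ratio sqrrN. Qed.

Let oneBcos0 : oneBcos 0 = 0. Proof. by rewrite /oneBcos cos0 subrr. Qed.
Let ratio0 : ratio 0 = 0. Proof. by rewrite /ratio expr0n/= mul0r. Qed.

Lemma integrable_cos_deficit t : mu.-integrable `]0, +oo[ (fun s => (cos_deficit t s)%:E).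
Proof.
exact: (integrable_scale_mixture a0 (@oneBcos_ge0 R) (@oneBcos_le2 R) continuous_oneBcos
  even_oneBcos oneBcos0 integrable_oneBcos_power lam_moment).
Qed.

Lemma integrable_ratio_mixture : mu.-integrable `]0, +oo[ (fun s => (ratio_mixture s)%:E).
Proof.
exact: (integrable_scale_mixture a0 ratio_ge0 ratio_le1 continuous_ratio
  even_ratio ratio0 integrable_ratio_power lam_moment).
Qed.

Lemma cos_deficit_ge0 t s : 0 <= cos_deficit t s.
Proof. by rewrite /cos_deficit; apply: scale_mixture_ge0; exact: oneBcos_ge0. Qed.

Lemma ratio_mixture_ge0 s : 0 <= ratio_mixture s.
Proof. by rewrite /ratio_mixture; apply: scale_mixture_ge0; exact: ratio_ge0. Qed.

Lemma continuous_cos_deficit t s : 0 < s -> {for s, continuous (cos_deficit t)}.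
Proof.
exact: (continuous_scale_mixture (@oneBcos_ge0 R) (@oneBcos_le2 R) continuous_oneBcos).
Qed.

Lemma measurable_cos_deficit t : measurable_fun setT (cos_deficit t).
Proof.
exact: (measurable_scale_mixture a (@oneBcos_ge0 R) (@oneBcos_le2 R) continuous_oneBcos).
Qed.

Lemma norm_oneB_cos_deficit t s : `|1 - cos_deficit t s| <= 1.
Proof.
rewrite ler_norml; apply/andP; split; last by rewrite gerBl cos_deficit_ge0.
by rewrite lerBrDl lerBlDl -[leRHS]/2 (scale_mixture_le a (@oneBcos_ge0 R) (@oneBcos_le2 R)
  continuous_oneBcos).
Qed.

Let measurable_cos_scaled t s : measurable_fun setT (fun y : R => cos (t * y * s)).
Proof.
apply: (measurableT_comp (continuous_measurable_fun (@continuous_cos R))).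
by apply: measurable_funM => //; exact: measurable_funM.
Qed.

Lemma cos_deficitE t s : \int[lam]_y cos (t * y * s `^ (- a)) = 1 - cos_deficit t s.
Proof.
rewrite /cos_deficit /scale_mixture /oneBcos.
have ic : lam.-integrable setT (fun y => (cos (t * y * s `^ (- a)))%:E).
  apply: (integrable_bounded _ (C := 1)) => [|y]; last exact: cos_max.
  exact: measurable_cos_scaled.
rewrite RintegralB//; last exact: finite_measure_integrable_cst.
by rewrite Rintegral_prob_cst opprB addrC subrK.
Qed.

Lemma cos_deficit_le_ratio t s : cos_deficit t s <= 2 * (1 + t ^+ 2) * ratio_mixture s.
Proof.
have mr : measurable_fun setT (fun y : R => ratio (1 * y * s `^ (- a))).
  apply: (measurableT_comp (continuous_measurable_fun continuous_ratio)).
  by apply: measurable_funM => //; exact: measurable_funM.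
have ir : lam.-integrable setT (fun y => (ratio (1 * y * s `^ (- a)))%:E).
  apply: (integrable_bounded _ (C := 1)) => // y; rewrite ger0_norm ?ratio_ge0//.
  exact: ratio_le1.
rewrite /ratio_mixture /scale_mixture -RintegralZl//.
apply: le_Rintegral => //.
- apply: (integrable_bounded _ (C := 2)) => [|y].
    by apply: measurable_funB; [exact: measurable_cst|exact: measurable_cos_scaled].
  by rewrite ger0_norm ?oneBcos_ge0 ?oneBcos_le2.
- exact: integrable_fZl.
- by move=> y _; rewrite mul1r -mulrA; exact: oneBcos_le_ratio.
Qed.

(* By Campbell's formula, the characteristic function at t of the sum of the
   shocks y s^(-a) at the Poisson points s > max(g, 0), y being drawn from lam. *)
Definition renewal_exp t g := expR (- tail_integral (cos_deficit t) g).

Lemma renewal_exp_gt0 t g : 0 < renewal_exp t g. Proof. exact: expR_gt0. Qed.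

Lemma renewal_exp_le1 t g : renewal_exp t g <= 1.
Proof.
rewrite -[leRHS]expR0 ler_expR oppr_le0; apply: tail_integral_ge0 => s _.
exact: cos_deficit_ge0.
Qed.

Lemma norm_renewal_exp t g : `|renewal_exp t g| <= 1.
Proof. by rewrite gtr0_norm ?renewal_exp_gt0 ?renewal_exp_le1. Qed.

Lemma measurable_renewal_exp t : measurable_fun setT (renewal_exp t).
Proof.
apply: (measurableT_comp (@measurable_expR R)); apply: measurableT_comp => //.
apply: measurable_tail_integral; last exact: integrable_cos_deficit.
by move=> s _; exact: cos_deficit_ge0.
Qed.

(** From 1 - e^(-x) <= x and [cos_deficit_le_ratio]; the dependence on t is split off as a
    polynomial factor. *)
Lemma oneB_renewal_exp_le t g :
  1 - renewal_exp t g <= 2 * (1 + t ^+ 2) * tail_integral ratio_mixture g.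
Proof.
apply: (@le_trans _ _ (tail_integral (cos_deficit t) g)).
  have := expR_ge1Dx (- tail_integral (cos_deficit t) g).
  by rewrite -/(renewal_exp t g); lra.
apply: le_tail_integral; [exact: integrable_cos_deficit|exact: integrable_ratio_mixture|].
by move=> s _; exact: cos_deficit_le_ratio.
Qed.

Lemma renewal_exp0 t : renewal_exp t 0 = expR (- (`|t| `^ a^-1 * m / stable_c a^-1)).
Proof.
rewrite /renewal_exp tail_integral_eq//; congr (expR (- _)).
rewrite (integral_scale_mixture a0 (@oneBcos_ge0 R) (@oneBcos_le2 R) continuous_oneBcos
  even_oneBcos oneBcos0 integrable_oneBcos_power lam_moment) -/m.
by rewrite -stable_c_moment.
Qed.

(* The decomposition at the first Poisson point g + x after g. *)
Lemma renewal_identity t g : 0 <= g ->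
  \int[mu]_(x in `]0, +oo[)
    (((1 - cos_deficit t (g + x)) * renewal_exp t (g + x)) * expR (- x)) = renewal_exp t g.
Proof.
move=> g0.
have gx x : 0 < x -> 0 < g + x by move=> x0; rewrite ltr_wpDl.
have iq := integrable_cos_deficit t.
pose I x := \int[mu]_(s in `]x, +oo[) cos_deficit t s.
have eE x : 0 <= x -> renewal_exp t x = expR (- I x).
  by move=> x0; rewrite /renewal_exp tail_integral_eq.
have dg x : is_derive x 1 (fun x => g + x) 1 by derive1_eq; rewrite add0r.
have dI x : 0 < x -> is_derive x 1 (fun x => I (g + x)) (- cos_deficit t (g + x) * 1).
  move=> x0; have dI' := is_derive_tail_integral iq (gx _ x0) (continuous_cos_deficit (gx _ x0)).
  exact: (@is_derive1_comp _ I (fun x => g + x) x _ _ dI' (dg x)).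
have cq x : 0 < x -> {for x, continuous (fun x => cos_deficit t (g + x))}.
  move=> x0; apply: (@continuous_comp _ _ _ (fun x => g + x) (cos_deficit t)).
    exact: is_derive1_continuous (dg x).
  exact: continuous_cos_deficit (gx _ x0).
have ce x : 0 < x -> {for x, continuous (fun x => expR (- I (g + x)))}.
  by move=> x0; have := dI x x0 => dIx; apply: is_derive1_continuous; derive1.
have cx x : {for x, continuous (fun x : R => expR (- x))}.
  by apply: is_derive1_continuous; derive1.
have cf x : 0 < x -> {for x, continuous
    (fun x => (1 - cos_deficit t (g + x)) * expR (- I (g + x)) * expR (- x))}.
  move=> x0; apply: cvgM; last exact: cx.
  apply: cvgM; last exact: ce.
  by apply: cvgB; [exact: cvg_cst|exact: cq].
transitivity (\int[mu]_(x in `]0, +oo[)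
    (((1 - cos_deficit t (g + x)) * expR (- I (g + x))) * expR (- x))).
  apply: eq_Rintegral => x; rewrite inE/= in_itv/= andbT => x0.
  by rewrite eE// ltW// gx.
rewrite eE// -[RHS]opprK -[RHS]sub0r.
have cI : I (g + x) @[x --> 0^'+] --> I g.
  have ig : mu.-integrable `]g, +oo[ (fun s => (cos_deficit t s)%:E).
    by have := integrable_tail g iq; rewrite max_l.
  have /cvg_at_rightP H := cvg_tail_integral_right ig.
  apply/cvg_at_rightP => u [u0 cu]; apply: (H (fun n => g + u n)); split.
    by move=> n; rewrite ltrDl.
  by rewrite -[X in _ --> X]addr0; apply: cvgD => //; exact: cvg_cst.
(* Since I' = - [cos_deficit t], the integrand is the derivative of - e^(-I(g+x)-x). Only the right
   limit at x = 0 is taken, because g = 0 is allowed and I is differentiated only at positive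
   points. *)
apply: (FTC_oy (F := fun x => - (expR (- I (g + x)) * expR (- x)))) => //.
- by move=> x x0; have := dI x x0 => dIx; derive1_eq; ring.
- apply: cvgN; rewrite -[X in _ --> X]mulr1; apply: cvgM.
    apply: continuous_cvg; first exact: continuous_expR.
    exact: cvgN.
  have c0 : expR (- x) @[x --> (0 : R)] --> expR (- 0) := cx 0.
  rewrite oppr0 expR0 in c0.
  exact: cvg_at_right_filter.
- apply/norm_cvg0P; apply: squeeze_cvgr (cvg_cst 0) (@cvgr_expR R); near=> x.
  have x0 : 0 < x by [].
  rewrite normr_ge0/= normrN ger0_norm ?mulr_ge0 ?expR_ge0//.
  by rewrite ler_piMl ?expR_ge0// -eE ?renewal_exp_le1// ltW// gx.
- have ie : mu.-integrable `]0, +oo[ (fun x => (x `^ 0 * expR (- (1 * x)))%:E).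
    by apply: integrable_powR_expR => //; rewrite oppr_lt0.
  apply: (integrable_le0y (c := 1) ie); first exact: measurable_fun_oy.
  move=> x x0; rewrite powRr0 !mul1r normrM (ger0_norm (expR_ge0 _)).
  rewrite ler_piMl ?expR_ge0// normrM mulr_ile1 ?normr_ge0//.
    exact: norm_oneB_cos_deficit.
  by rewrite -eE ?norm_renewal_exp// ltW// gx.
Unshelve. all: by end_near. Qed.

End renewal_function.

(** * Independence *)

Section parametric_integral.
Context d (T : measurableType d) (R : realType) (P : probability T R).

Lemma ae_eq_Rintegral (f g : T -> R) : measurable_fun setT f -> measurable_fun setT g ->
  {ae P, forall w, f w = g w} -> \int[P]_w f w = \int[P]_w g w.
Proof.
move=> mf mg fg; rewrite /Rintegral; congr fine; apply: ae_eq_integral => //.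
- by apply/measurable_EFinP.
- by apply/measurable_EFinP.
- by apply: filterS fg => w fgw _; rewrite /= fgw.
Qed.

Lemma measurable_parametric_Rintegral d' (U : measurableType d') (f : U * T -> R) (C : R) :
  measurable_fun setT f -> (forall z, `|f z| <= C) ->
  measurable_fun setT (fun u => \int[P]_y f (u, y)).
Proof.
move=> mf fC.
(* Adding C makes the integrand nonnegative, as the Tonelli measurability statement requires. *)
have mf1 : measurable_fun setT (fun z => (f z + C)%:E).
  by apply/measurable_EFinP; apply: measurable_funD.
have f1 z : (0 <= (f z + C)%:E)%E.
  by rewrite lee_fin -lerBlDr sub0r; have := fC z; rewrite ler_norml => /andP[].
have mfu u : measurable_fun setT (fun y => f (u, y)).
  exact: (measurableT_comp mf (measurable_pair1 u)).
have H : measurable_fun setT (fubini_F P (fun z => (f z + C)%:E)).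
  exact: measurable_fun_fubini_tonelli_F.
have FE : fubini_F P (fun z => (f z + C)%:E) = EFin \o (fun u => \int[P]_y (f (u, y) + C)).
  apply/funext => u; rewrite /= (@EFin_Rintegral_bounded _ _ _ P _ (C + C))//.
    by apply: measurable_funD.
  move=> y; apply: le_trans (ler_normD _ _) _; rewrite lerD//.
  by rewrite ger0_norm// (le_trans _ (fC (u, y))).
rewrite FE in H; move/measurable_EFinP in H.
have -> : (fun u => \int[P]_y f (u, y)) = (fun u => \int[P]_y (f (u, y) + C) - C).
  apply/funext => u; rewrite RintegralD//.
  - by rewrite Rintegral_prob_cst addrK.
  - exact: (integrable_bounded _ (mfu u) (fun y => fC (u, y))).
  - by apply: (@integrable_bounded _ _ _ P (fun=> C) `|C|).
by apply: measurable_funB.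
Qed.

End parametric_integral.

Section independence.
Context d (T : measurableType d) (R : realType) (P : probability T R).

(** The joint law agrees with the product of the laws on rectangles, hence everywhere, and Fubini
    applies. V takes values in a general space because it will be a pair. *)
Lemma independent_Rintegral d' (U : measurableType d') (V : {mfun T >-> U})
    (W : {mfun T >-> R}) (lam : probability R R) (f : U * R -> R) (C : R) :
  same_law (distribution P W) lam ->
  (forall A B, measurable A -> measurable B ->
    P (V @^-1` A `&` W @^-1` B) = (P (V @^-1` A) * P (W @^-1` B))%E) ->
  measurable_fun setT f -> (forall z, `|f z| <= C) ->
  \int[P]_w f (V w, W w) = \int[P]_w \int[lam]_y f (V w, y).
Proof.
move=> lamW indep mf fC.
have mVW : measurable_fun setT (fun w => (V w, W w)).
  by apply/measurable_fun_pair => //; exact: measurable_funPT.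
pose VW : {mfun T >-> (U * R)%type} :=
  HB.pack (fun w => (V w, W w)) (isMeasurableFun.Build _ _ _ _ _ mVW).
pose PV := distribution P V.
have prodE A : measurable A -> (PV \x lam)%E A = distribution P VW A.
  apply: product_measure_unique => A' B mA mB.
  by apply: etrans (indep _ _ mA mB) _; congr (_ * _)%E; exact: lamW.
have ifVW : (distribution P VW).-integrable setT (EFin \o f).
  by apply: integrable_bounded fC.
have ifp : (PV \x lam)%E.-integrable setT (EFin \o f).
  apply: measurable_bounded_integrable => //.
    apply: (@le_lt_trans _ _ (distribution P VW setT)).
      by rewrite -(prodE _ measurableT).
    by rewrite (le_lt_trans (probability_le1 _ _))// ltry.
  exists C; split; first exact: num_real.
  by move=> x Cx y _; exact: le_trans (fC y) (ltW Cx).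
rewrite /Rintegral; congr fine.
transitivity (\int[distribution P VW]_z (f z)%:E)%E.
  rewrite integral_distribution//; first by apply/measurable_EFinP.
  apply: (@integrable_bounded _ _ _ _ (f \o VW) C); last by move=> x; exact: fC.
  exact: (measurableT_comp mf mVW).
transitivity (\int[(PV \x lam)%E]_z (f z)%:E)%E.
  by apply: eq_measure_integral => A mA _; apply/esym; exact: prodE.
have mfx x : measurable_fun setT (fun y => f (x, y)).
  exact: (measurableT_comp mf (measurable_pair1 x)).
pose F x := \int[lam]_y f (x, y).
have FE : fubini_F lam (EFin \o f) = EFin \o F.
  apply/funext => x; rewrite /= /F (@EFin_Rintegral_bounded _ _ _ lam _ C)//.
have mF : measurable_fun setT F.
  apply/measurable_EFinP; rewrite -FE.
  exact: measurable_int (integrable_fubini_F ifp).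
rewrite -integral12_prod_meas1// FE integral_distribution//; first by apply/measurable_EFinP.
apply: (@integrable_bounded _ _ _ _ (F \o V) C).
  by apply: (measurableT_comp mF); exact: measurable_funPT.
by move=> w; exact: norm_Rintegral_le.
Qed.

End independence.

Section past.
Context d (T : measurableType d) (R : realType) (P : probability T R).
Variables (X : nat -> {mfun T >-> R}) (Y : nat -> T -> R).
Hypothesis mY : forall n, measurable_fun setT (Y n).
Hypothesis iX : mutually_independent P X.
Hypothesis iYX : independent_sequences P Y X.

Let cyl n (D : nat -> set R) : set T := \bigcap_(i in [set` iota 0 n]) X i @^-1` D i.

Let iotaP n i : [set` iota 0 n] i <-> (i < n)%N.
Proof. by rewrite /mkset mem_iota. Qed.

(** Only a generating pi-system of the past, which holds the whole sequence Y and the first n terms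
    of X. It is used with (X, Y) = (eps, arrival times) and (E, eps). *)
Definition past n : set (set T) := [set F | exists A D,
  [/\ sigma_of_sequence Y A, (forall i, measurable (D i)) & F = A `&` cyl n D]].

Let sigma_measurable (Z : nat -> T -> R) : (forall n, measurable_fun setT (Z n)) ->
  sigma_of_sequence Z `<=` measurable.
Proof.
move=> mZ; apply: smallest_sub; first exact: sigma_algebra_measurable.
move=> A [k _ [B mB <-]]; exact: mZ.
Qed.

Let sigma_preim (Z : nat -> T -> R) n B : measurable B ->
  sigma_of_sequence Z (Z n @^-1` B).
Proof.
move=> mB; apply: sub_gen_smallest; exists n => //; exists B => //.
by rewrite setTI.
Qed.

Let sigma_cyl n D : (forall i, measurable (D i)) -> sigma_of_sequence X (cyl n D).
Proof.
move=> mD; apply: (@bigcap_measurableType _ (g_sigma_algebraType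
  (\bigcup_n preimage_set_system setT (X n) measurable))) => i _.
exact: sigma_preim.
Qed.

Let sigmaI (Z : nat -> T -> R) A B : sigma_of_sequence Z A -> sigma_of_sequence Z B ->
  sigma_of_sequence Z (A `&` B).
Proof.
exact: (@measurableI _ (g_sigma_algebraType
  (\bigcup_n preimage_set_system setT (Z n) measurable))).
Qed.

Let sigmaT (Z : nat -> T -> R) : sigma_of_sequence Z setT.
Proof.
exact: (@measurableT _ (g_sigma_algebraType
  (\bigcup_n preimage_set_system setT (Z n) measurable))).
Qed.

Let past_setI n : setI_closed (past n).
Proof.
move=> _ _ [A [D [sA mD ->]]] [B [D' [sB mD' ->]]].
exists (A `&` B), (fun i => D i `&` D' i); split.
- exact: sigmaI.
- by move=> i; exact: measurableI.
- rewrite setIACA; congr (_ `&` _); apply/seteqP; split.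
    by move=> w [h1 h2] i ki; split; [exact: h1|exact: h2].
  by move=> w h; split=> i ki; case: (h i ki).
Qed.

Let past_measurable n : past n `<=` measurable.
Proof.
move=> _ [A [D [sA mD ->]]]; apply: measurableI; first exact: sigma_measurable sA.
by apply: (sigma_measurable _ (sigma_cyl n mD)) => k; exact: measurable_funPT.
Qed.

(** As functions of F both sides are finite measures. They agree on the pi-system [past n], hence on
    the sigma-algebra it generates. *)
Lemma past_independent n F B : <<s past n >> F -> measurable B ->
  P (F `&` X n @^-1` B) = (P F * P (X n @^-1` B))%E.
Proof.
move=> sF mB.
have mK : measurable (X n @^-1` B) by rewrite -[X in measurable X]setTI; exact: measurable_funPT.
have PK : P (X n @^-1` B) \is a fin_num by exact: fin_num_measure.
have PK0 : 0 <= fine (P (X n @^-1` B)) by rewrite fine_ge0.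
pose m1 := mrestr P mK.
pose m2 := mscale (NngNum PK0) P.
have m2E F' : (P F' * P (X n @^-1` B))%E = m2 F' by rewrite /m2 /mscale/= fineK// muleC.
rewrite m2E; change (m1 F = m2 F).
apply: (@g_sigma_algebra_measure_unique _ R T (past n) (@past_measurable n) (fun=> setT))
  => //.
- move=> _; exists setT, (fun=> setT); split => //.
  by apply/seteqP; split => // w _; split => // i.
- by rewrite bigcup_const.
- move=> _ [A [D [sA mD ->]]].
  apply: etrans (m2E _).
  change (P ((A `&` cyl n D) `&` X n @^-1` B) = (P (A `&` cyl n D) * P (X n @^-1` B))%E).
  rewrite -setIA.
  have -> : cyl n D `&` X n @^-1` B = cyl n.+1 (fun i => if i == n then B else D i).
    apply/seteqP; split => w.
      move=> [h1 h2] i /iotaP; rewrite ltnS leq_eqVlt.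
      by case: eqP => [->//|_ /= lin]; apply: h1; exact/iotaP.
    move=> h; split.
      move=> i /iotaP lin; have /h : [set` iota 0 n.+1] i by exact/iotaP/ltnW.
      by rewrite /preimage (ltn_eqF lin).
    have /h : [set` iota 0 n.+1] n by exact/iotaP.
    by rewrite /preimage eqxx.
  have mD' i : measurable (if i == n then B else D i) by case: eqP.
  rewrite (iYX sA (sigma_cyl _ mD')) (iYX sA (sigma_cyl _ mD)) -muleA; congr (_ * _)%E.
  rewrite muleC.
  (* Listing n first lets [big_cons] split off the factor of X n. *)
  have e : cyl n.+1 (fun i => if i == n then B else D i) =
      \bigcap_(i in [set` n :: iota 0 n]) X i @^-1` (if i == n then B else D i).
    rewrite /cyl; congr (\bigcap_(i in _) _); apply/seteqP; split=> i.
      move=> /iotaP; rewrite ltnS leq_eqVlt /mkset in_cons mem_iota => /orP[->//|->].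
      by rewrite orbT.
    move=> iI; apply/iotaP; move: iI.
    by rewrite /mkset in_cons mem_iota leq0n add0n ltnS (leq_eqVlt i).
  have uq : uniq (n :: iota 0 n) by rewrite /= iota_uniq mem_iota add0n ltnn.
  rewrite e (iX uq mD') /cyl (iX (iota_uniq 0 n) mD) big_cons eqxx.
  congr (_ * _)%E.
  by apply: eq_big_seq => i; rewrite mem_iota add0n/= => /ltn_eqF ->.
- move=> k; rewrite /m1 /mrestr (le_lt_trans (probability_le1 _ _)) ?ltry//.
  by rewrite setTI.
Qed.

Lemma past_preim_X n i B : (i < n)%N -> measurable B -> <<s past n >> (X i @^-1` B).
Proof.
move=> lin mB; apply: sub_gen_smallest.
exists setT, (fun j => if j == i then B else setT); split => //.
- by move=> j; case: eqP.
- apply/seteqP; split => w /=.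
    by move=> h; split => // j _ /=; case: eqP => [->|].
  move=> [_ h]; have /h : [set` iota 0 n] i by exact/iotaP.
  by rewrite /preimage eqxx.
Qed.

Lemma past_preim_Y n i B : measurable B -> <<s past n >> (Y i @^-1` B).
Proof.
move=> mB; apply: sub_gen_smallest; exists (Y i @^-1` B), (fun=> setT); split => //.
  exact: sigma_preim.
by apply/seteqP; split => [w h|w []]; [split|].

Qed.

(* With this type, measurability with respect to the past is measurable_fun. *)
Definition pastT n : measurableType _ := g_sigma_algebraType (past n).

Lemma past_measurable_X n i : (i < n)%N -> measurable_fun setT (X i : pastT n -> R).
Proof. by move=> lin _ B mB; rewrite setTI; exact: past_preim_X. Qed.

Lemma past_measurable_Y n i : measurable_fun setT (Y i : pastT n -> R).
Proof. by move=> _ B mB; rewrite setTI; exact: past_preim_Y. Qed.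

End past.

(** * Densities and the exponential law *)

Section density.
Local Open Scope ereal_scope.
Context d (T : measurableType d) (R : realType).
Variables (nu : {finite_measure set T -> \bar R}) (mu : {sigma_finite_measure set T -> \bar R}).
Variables (p f : T -> R).
Hypothesis mp : measurable_fun setT p.
Hypothesis p0 : forall x, (0 <= p x)%R.
Hypothesis nuE : forall A, measurable A -> nu A = \int[mu]_(x in A) (p x)%:E.

(** p agrees almost everywhere with the Radon-Nikodym derivative, for which the change of variables
    is known. *)
Lemma integral_density : nu.-integrable setT (EFin \o f) ->
  \int[nu]_x (f x)%:E = \int[mu]_x ((f x)%:E * (p x)%:E).
Proof.
move=> fi; have mf : measurable_fun setT f.
  by apply/measurable_EFinP; exact: measurable_int fi.
have mpE : measurable_fun setT (EFin \o p) by apply/measurable_EFinP.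
have dom : nu `<< mu.
  apply/null_content_dominatesP => A mA muA0; rewrite nuE//.
  apply: null_set_integral => //.
  by apply: measurable_funTS; apply/measurable_EFinP.
have pint : mu.-integrable setT (EFin \o p).
  apply/integrableP; split => //.
  under eq_integral do rewrite /= ger0_norm//.
  by rewrite -nuE// -ge0_fin_numE ?fin_num_measure.
have h := Radon_Nikodym_change_of_variables dom measurableT fi.
rewrite -[LHS]h; apply: ae_eq_integral => //.
- apply: emeasurable_funM; first by apply/measurable_EFinP.
  by apply: (measurable_int mu); exact: Radon_Nikodym_integrable.
- by apply: emeasurable_funM => //; apply/measurable_EFinP.
- apply: ae_eqe_mul2l.
  rewrite Radon_NikodymE/=.
  case: cid => /= g [g1 g2 g3].
  apply: integral_ae_eq => //=.
  by move=> E _ mE; apply: etrans (nuE mE); apply: esym; exact: g3.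
Qed.

End density.

Section exponential_law.
Context {R : realType}.
Notation mu := (@lebesgue_measure R).

Lemma Rintegral_exponential (lam : probability R R) (f : R -> R) (C : R) :
  same_law lam (exponential_prob 1) -> measurable_fun setT f ->
  (forall x, `|f x| <= C) ->
  \int[lam]_x f x = \int[mu]_(x in `]0, +oo[) (f x * expR (- x)).
Proof.
move=> lamE mf fC.
have mid : measurable_fun setT (id : R -> measurableTypeR R) by exact: measurable_id.
(* Transports lam to the measurable type that carries Lebesgue measure. *)
pose idR : {mfun R >-> measurableTypeR R} :=
  HB.pack (id : R -> measurableTypeR R) (isMeasurableFun.Build _ _ _ _ _ mid).
have fi : (distribution lam idR).-integrable setT (EFin \o (f : measurableTypeR R -> R)).
  have mf' : measurable_fun setT (f : measurableTypeR R -> R) by exact: mf.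
  exact: (@integrable_bounded _ (measurableTypeR R) R (distribution lam idR) f C mf' fC).
rewrite /Rintegral; congr fine.
transitivity (\int[distribution lam idR]_x (f x)%:E)%E.
  rewrite integral_distribution//; first by apply/measurable_EFinP.
  exact: (@integrable_bounded _ _ _ lam f C mf fC).
have mp : measurable_fun setT (exponential_pdf 1 : measurableTypeR R -> R).
  exact: measurable_exponential_pdf.
have p0 (x : measurableTypeR R) : 0 <= exponential_pdf 1 x by exact: exponential_pdf_ge0.
have nuE (A : set (measurableTypeR R)) : measurable A ->
    distribution lam idR A = (\int[mu]_(x in A) (exponential_pdf 1 x)%:E)%E.
  exact: lamE.
rewrite (@integral_density _ _ _ _ mu _ _ mp p0 nuE fi).
rewrite [RHS]integral_mkcond.
(* The density lives on the closed half-line and the integral on the open one; they differ at the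
   null point 0. *)
have e : ae_eq mu setT (fun x => ((f x)%:E * (exponential_pdf 1 x)%:E)%E)
    ((fun x => (f x * expR (- x))%:E) \_ `]0, +oo[).
  exists [set (0 : R)]; split; [exact: measurable_set1|exact: lebesgue_measure_set1|].
  move=> x /= /not_implyP[_]; apply: contra_notP => x0.
  rewrite patchE mem_setE in_itv/= andbT.
  have [xp|] := ltP 0 x.
    by rewrite exponential_pdfE ?ltW// mul1r mulN1r -EFinM.
  rewrite le_eqVlt => /predU1P[//|xn].
  by rewrite lt0_exponential_pdf// mule0.
apply: ae_eq_integral => //.
- by apply: emeasurable_funM; apply/measurable_EFinP; [exact: mf|exact: mp].
- apply/(measurable_restrict _ _ _).1 => //.
  have me : measurable_fun setT (fun x : R => expR (- x)).
    by apply: continuous_measurable_fun => x; apply: is_derive1_continuous; derive1.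
  by apply: measurable_funTS; apply/measurable_EFinP; exact: measurable_funM mf me.
Qed.

End exponential_law.

(** * Shocks at the arrival times *)

Lemma Rintegral_expR_oy (R : realType) (c : R) : 0 < c ->
  \int[@lebesgue_measure R]_(x in `]0, +oo[) expR (- (c * x)) = c^-1.
Proof.
move=> c0; pose F (x : R) : R := - c^-1 * expR (- (c * x)).
have dF (x : R) : is_derive x 1 F (expR (- (c * x))).
  by rewrite /F; derive1_eq; field; rewrite gt_eqF.
have cf (x : R) : {for x, continuous (fun x : R => expR (- (c * x)))}.
  by apply: is_derive1_continuous; derive1.
have Fy : F x @[x --> +oo] --> 0.
  rewrite -[X in _ --> X](mulr0 (- c^-1)); apply: cvgMr.
  exact: cvg_expR_Ny.
have F0 : F x @[x --> 0^'+] --> - c^-1.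
  have -> : - c^-1 = F 0 by rewrite /F mulr0 oppr0 expR0 mulr1.
  apply: cvg_at_right_filter; exact: (is_derive1_continuous (dF 0)).
rewrite (@FTC_oy _ _ F 0 _ _ (fun x _ => cf x) (fun x _ => dF x) F0 Fy) ?sub0r ?opprK//.
exact: (@ge0_FTC_oy_integrable _ _ F 0 _ _ (fun x _ => expR_ge0 _) (fun x _ => cf x) (fun x _ =>
  dF x) F0 Fy).
Qed.

(** * Convergence criteria *)

Section summable_convergence.
Context d (T : measurableType d) (R : realType) (P : probability T R).

(** The series of the Y j has finite mean, hence converges almost surely, and its terms tend to
    0. *)
Lemma ae_cvg0_summable (Y : nat -> T -> R) : (forall j, measurable_fun setT (Y j)) ->
  (forall j w, 0 <= Y j w) ->
  (forall j, \int[P]_w (Y j w)%:E <= (1 / (2 ^ j.+1)%:R)%:E)%E ->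
  {ae P, forall w, Y ^~ w @ \oo --> 0}.
Proof.
move=> mY Y0 Yle.
pose S w := (\sum_(0 <= j <oo) (Y j w)%:E)%E.
have mS : measurable_fun setT S.
  by apply: ge0_emeasurable_sum; [by move=> j w _ _; rewrite lee_fin|move=> j _;
    exact/measurable_EFinP].
have S0 w : (0 <= S w)%E by apply: nneseries_ge0 => j _ _; rewrite lee_fin.
have Sfin : (\int[P]_w S w < +oo)%E.
  rewrite /S integral_nneseries//; last by move=> j w _; rewrite lee_fin.
    apply: (@le_lt_trans _ _ 1%:E); last exact: ltry.
    apply: (le_trans _ (@epsilon_trick0 R 1 xpredT ler01)).
    by apply: lee_nneseries => // j _ _; apply: integral_ge0 => w _; rewrite lee_fin.
  by move=> j; apply/measurable_EFinP.
have iS : P.-integrable setT S.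
  apply/integrableP; split => //.
  by under eq_integral do rewrite gee0_abs//.
apply: filterS (integrable_ae measurableT iS) => w /(_ I) Sw.
have Sw' : (S w < +oo)%E by rewrite ltey_eq Sw.
have H := @nneseries_tail_cvg R (fun j => (Y j w)%:E) xpredT Sw'.
have Yw j : true -> (0 <= (Y j w)%:E)%E by rewrite lee_fin.
have {}H := H Yw.
suff : (Y j w)%:E @[j --> \oo] --> 0%:E by move/fine_cvgP => [_].
apply: (squeeze_cvge _ (cvg_cst _) H); near=> n; rewrite lee_fin Y0/=.
apply: le_trans (@nneseries_lim_ge _ _ xpredT n n.+1 _); first by rewrite big_nat1.
by move=> k _ _; rewrite lee_fin.
Unshelve. all: by end_near.
Qed.

End summable_convergence.

(** Squeeze by e^(-x) <= 1 / (1 + x) <= e^(-x/(1+x)) with x = c / n, each raised to the power n. *)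
Lemma cvg_exponential_power (R : realType) (c : R) : 0 <= c ->
  (1 + c * n%:R^-1)^-1 ^+ n @[n --> \oo] --> expR (- c).
Proof.
move=> c0.
have lim1 : expR (- c * (1 + c * n%:R^-1)^-1) @[n --> \oo] --> expR (- c).
  rewrite -[X in _ --> expR X]mulr1; apply: continuous_cvg; first exact: continuous_expR.
  apply: cvgMr; rewrite -[X in _ --> X]invr1; apply: cvgV; first exact: oner_neq0.
  rewrite -[X in _ --> X]addr0; apply: cvgD; first exact: cvg_cst.
  rewrite -[X in _ --> X](mulr0 c); apply: cvgMr.
  by apply/gtr0_cvgV0; [near=> n; rewrite ltr0n; near: n; exists 1%N|exact: cvgr_idn].
apply: (squeeze_cvgr _ (cvg_cst (expR (- c))) lim1); near=> n.
have n0 : (0 < n)%N by near: n; exists 1%N.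
have nR : 0 < n%:R :> R by rewrite ltr0n.
have nc : - c = (- (c * n%:R^-1)) *+ n by rewrite mulNrn -(mulr_natr (c / _)) mulfVK ?gt_eqF.
have x0 : 0 <= c * n%:R^-1 by rewrite mulr_ge0// invr_ge0 ltW.
move: x0 nc; set x := c * n%:R^-1 => x0 nc.
have x1 : 0 < 1 + x by rewrite ltr_pwDl.
have XN (y : R) : expR (y *+ n) = expR y ^+ n by rewrite -(mulr_natl y) expRM_natl.
apply/andP; split.
  rewrite nc XN lerXn2r ?nnegrE ?expR_ge0 ?invr_ge0 ?(ltW x1)//.
  by rewrite expRN lef_pV2 ?posrE ?expR_gt0// expR_ge1Dx.
rewrite nc mulrnAl XN lerXn2r ?nnegrE ?expR_ge0 ?invr_ge0 ?(ltW x1)//.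
apply: le_trans (expR_ge1Dx _); rewrite le_eqVlt; apply/orP; left; apply/eqP.
by field; rewrite gt_eqF.
Unshelve. all: by end_near.
Qed.

Lemma cvg_of_dist_geometric (R : realType) (u : R ^nat) :
  (\forall j \near \oo, `|u j.+1 - u j| <= 2^-1 ^+ j) -> cvgn u.
Proof.
move=> [j0 _ uj].
have -> : u = (fun n => u 0%N + series (telescope u) n) by apply/funext => n;
  exact: eq_sum_telescope.
apply: is_cvgD; first exact: is_cvg_cst.
rewrite -(is_cvg_series_restrict j0).
(* The bound holds from j0 on only; zeroing the earlier terms makes the comparison with the
   geometric series valid for all k. *)
pose v k := if (j0 <= k)%N then telescope u k else 0.
rewrite (_ : (fun n => \sum_(j0 <= k < n) telescope u k) = (fun n => \sum_(j0 <= k < n) v k));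
  last first.
  by apply/funext => n; apply: eq_big_nat => k /andP[j0k _]; rewrite /v j0k.
rewrite is_cvg_series_restrict; apply: normed_cvg.
apply: (@series_le_cvg _ _ (geometric 1 2^-1)) => [n|n|n|].
- exact: normr_ge0.
- by apply: geometric_ge0 => //; rewrite invr_ge0.
- rewrite /= mul1r /v; case: ifP => [/uj//|_]; by rewrite normr0 exprn_ge0// invr_ge0.
- by apply: is_cvg_geometric_series; rewrite ger0_norm ?invr_ge0// invf_lt1// ltr1n.
Qed.

(** D^2 <= (c^2 / 2) (1 + D^2) <= c^2 / 2 + D^2 / 2, because c <= 1. *)
Lemma norm_le_of_ratio (R : realType) (D c : R) : 0 <= c <= 1 -> ratio D <= c ^+ 2 / 2 -> `|D| <= c.
Proof.
move=> /andP[c0 c1]; rewrite /ratio ler_pdivrMr ?ltr_pwDl ?sqr_ge0// => H.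
rewrite -(@ler_pXn2r _ 2) ?nnegrE// real_normK ?num_real//.
have c21 : c ^+ 2 <= 1 by rewrite expr_le1.
have : c ^+ 2 * D ^+ 2 <= 1 * D ^+ 2 by rewrite ler_wpM2r ?sqr_ge0.
by move: (c ^+ 2) (D ^+ 2) H c21 => x y; lra.
Qed.

Lemma cvg_Rintegral_bounded_comp d (T : measurableType d) (R : realType) (P : probability T R)
    (f : R -> R) (C : R) (Y : nat -> T -> R) (Z : T -> R) :
  continuous f -> (forall x, `|f x| <= C) -> (forall n, measurable_fun setT (Y n)) ->
  measurable_fun setT Z -> {ae P, forall w, Y ^~ w @ \oo --> Z w} ->
  \int[P]_w f (Y n w) @[n --> \oo] --> \int[P]_w f (Z w).
Proof.
move=> cf fC mY mZ YZ; have mf := continuous_measurable_fun cf.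
apply: (@Rintegral_dominated_cvg _ T R P setT (fun n w => f (Y n w)) (f \o Z) (fun=> C)
  measurableT).
- by move=> n; exact: (measurableT_comp mf (mY n)).
- exact: (measurableT_comp mf mZ).
- apply: filterS YZ => w Yw _; apply: continuous_cvg Yw; exact: cf.
- by apply: (@integrable_bounded _ _ _ P (fun=> C) `|C|).
- by move=> n w _; exact: fC.
Qed.

(** If u did not converge, a bad index beyond N j could be chosen for each j. Applied to
    expectations, this lets the exceptional null set depend on the sequence m. *)
Lemma cvg_of_sparse (R : realType) (u : R ^nat) (N : nat -> nat) (l : R) :
  (forall m : nat -> nat, (forall j, (N j <= m j)%N) -> u (m j) @[j --> \oo] --> l) ->
  u @ \oo --> l.
Proof.
move=> H; apply/cvgrPdist_lt => eta eta0; apply: contrapT => nH.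
have bad j : exists n, (N j <= n)%N /\ eta <= `|l - u n|.
  apply: contrapT => nj; apply: nH; exists (N j) => // n /= jn.
  by rewrite ltNge; apply/negP => bn; apply: nj; exists n.
have [m Hm] := choice bad.
have := H m (fun j => (Hm j).1).
move=> /cvgrPdist_lt /(_ _ eta0) [j0 _ /(_ _ (leqnn _))] /=.
by rewrite ltNge (Hm j0).2.
Qed.

Lemma cexp_polar (R : realType) (r s : R) :
  cexp ('i%C * (r)%:C%C - (s)%:C%C) = (expR (- s) * cos r +i* (expR (- s) * sin r))%C.
Proof.
rewrite /cexp /= !(mul0r, mul1r, oppr0, subr0, sub0r, add0r, addr0).
by congr (_ +i* _)%C; rewrite mul0r ?subr0 ?addr0.
Qed.

Lemma cexp_i (R : realType) (r : R) : cexp ('i%C * (r)%:C%C) = (cos r +i* sin r)%C.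
Proof.
by rewrite -[X in cexp X]subr0 (cexp_polar r 0) oppr0 expR0 !mul1r.
Qed.

(** * The series of shocks: martingale, Cauchy estimate and limit *)

Section marked_renewal.
Context d (T : measurableType d) (R : realType) (P : probability T R).
Notation mu := (@lebesgue_measure R).
Variables (a : R) (E eps : nat -> {RV P >-> R}).
Hypothesis a12 : 2^-1 < a.
Hypothesis iE : mutually_independent P E.
Hypothesis lE : forall n, same_law (distribution P (E n)) (exponential_prob 1).
Hypothesis ieps : iid P eps.
Hypothesis iEeps : independent_sequences P (arrival_time E) eps.
Hypothesis sym_eps :
  forall n, same_law (distribution P (eps n)) (distribution P (- eps n)).

Let lam : probability R R := distribution P (eps 0).
Hypothesis lam_moment : (\int[lam]_y (`|y| `^ a^-1)%:E < +oo)%E.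

(* Unlike arrival_time, arrival is 0 at index 0. *)
Definition arrival n w := \sum_(k < n) E k w.

(** This is S_m - S_n for n <= m; the indicator allows recursion on m with n fixed. [eps k] enters
    at time k + 1, whence [arrival k.+1]. *)
Definition shock_sum n m w :=
  \sum_(k < m) (n <= k)%N%:R * (eps k w * arrival k.+1 w `^ (- a)).

Lemma shock_sumS n m w : (n <= m)%N ->
  shock_sum n m.+1 w = shock_sum n m w + eps m w * arrival m.+1 w `^ (- a).
Proof. by move=> nm; rewrite /shock_sum big_ord_recr/= nm mul1r. Qed.

Lemma shock_sumxx n w : shock_sum n n w = 0.
Proof. by rewrite /shock_sum big1// => k _; rewrite leqNgt ltn_ord mul0r. Qed.

Lemma arrivalS m w : arrival m.+1 w = arrival m w + E m w.
Proof. by rewrite /arrival big_ord_recr. Qed.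

Lemma measurable_arrival m : measurable_fun setT (arrival m).
Proof. by apply: measurable_sum => k; exact: measurable_funPT. Qed.

Lemma measurable_shock_sum n m : measurable_fun setT (shock_sum n m).
Proof.
apply: measurable_sum => k; apply: measurable_funM; first exact: measurable_cst.
apply: measurable_funM; first exact: measurable_funPT.
exact: (measurableT_comp (measurable_powR (- a)) (measurable_arrival k.+1)).
Qed.

(** Sine is odd and eps is symmetric, so the mean equals its own negative. Symmetry enters the proof
    here. *)
Let sin_mean0 c : \int[lam]_y sin (c * y) = 0.
Proof.
have ms : measurable_fun setT (fun y : R => sin (c * y)).
  apply: (measurableT_comp (continuous_measurable_fun (@continuous_sin R))).
  exact: measurable_funM.
have b1 y : `|sin (c * y)| <= 1 by exact: sin_max.
have h1 : \int[lam]_y sin (c * y) = \int[P]_w sin (c * eps 0 w).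
  rewrite /Rintegral integral_distribution//; first by apply/measurable_EFinP.
  by apply: (@integrable_bounded _ _ _ P (fun w => sin (c * eps 0 w)) 1) => //;
    apply: (measurableT_comp ms); exact: measurable_funPT.
have h2 : \int[lam]_y sin (c * y) = \int[P]_w sin (c * (- eps 0 w)).
  transitivity (\int[distribution P (- eps 0)]_y sin (c * y)).
    rewrite /Rintegral; congr fine; apply: eq_measure_integral => A mA _.
    exact: sym_eps.
  rewrite /Rintegral integral_distribution//; first by apply/measurable_EFinP.
  by apply: (@integrable_bounded _ _ _ P (fun w => sin (c * (- eps 0) w)) 1) => //;
    apply: (measurableT_comp ms); exact: measurable_funPT.
have : \int[lam]_y sin (c * y) = - \int[lam]_y sin (c * y).
  rewrite {1}h2 h1 -mulN1r -RintegralZl//.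
    by apply: eq_Rintegral => w _; rewrite mulrN sinN mulN1r.
  by apply: (@integrable_bounded _ _ _ P (fun w => sin (c * eps 0 w)) 1) => //;
    apply: (measurableT_comp ms); exact: measurable_funPT.
by move=> h; lra.
Qed.

Let lam_eps n : same_law (distribution P (eps n)) lam.
Proof. by case: ieps => _; exact. Qed.

(** Interarrival times are differences of arrival times, so independence from the latter passes to
    the former. The first one is treated apart, as [arrival_time E 0] is 1 rather than 0. *)
Let sum_E_sub : sigma_of_sequence E `<=` sigma_of_sequence (arrival_time E).
Proof.
pose TA := g_sigma_algebraType (\bigcup_n preimage_set_system setT (arrival_time E n) measurable).
have mA n : measurable_fun setT (arrival_time E n : TA -> R).
  move=> _ B mB; rewrite setTI; apply: sub_gen_smallest; exists n => //.
  by exists B => //; rewrite setTI.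
apply: smallest_sub.
  exact: (@sigma_algebra_measurable _ TA).
move=> _ [k _ [B mB <-]].
suff mE : measurable_fun setT (E k : TA -> R) by exact: mE.
case: k => [|k].
  rewrite (_ : (E 0 : TA -> R) = arrival_time E 1)//.
  by apply/funext => w; rewrite /arrival_time big_ord_recl big_ord0 addr0.
rewrite (_ : (E k.+1 : TA -> R) = fun w => arrival_time E k.+2 w - arrival_time E k.+1 w).
  exact: measurable_funB.
by apply/funext => w; rewrite /arrival_time big_ord_recr/= addrAC subrr add0r.
Qed.

Let ieps_E : independent_sequences P eps E.
Proof.
move=> A B sA sB; rewrite setIC muleC; apply: iEeps => //; exact: sum_E_sub.
Qed.

Let past_pair d' (T' : measurableType d') (f g : T' -> R) (A : set (R * R)) :
  measurable_fun setT f -> measurable_fun setT g -> measurable A ->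
  measurable ((fun w => (f w, g w)) @^-1` A).
Proof.
move=> mf mg mA; rewrite -[X in measurable X]setTI.
by have /(_ measurableT _ mA) : measurable_fun setT (fun w => (f w, g w))
  by exact/measurable_fun_pair.
Qed.

(** Here the past contains all arrival times, so [arrival m.+1] is known before [eps m] is drawn. *)
Lemma eps_independent n m (A : set (R * R)) B : measurable A -> measurable B ->
  P ((fun w => (shock_sum n m w, arrival m.+1 w)) @^-1` A `&` eps m @^-1` B) =
  (P ((fun w => (shock_sum n m w, arrival m.+1 w)) @^-1` A) * P (eps m @^-1` B))%E.
Proof.
move=> mA mB; have [ie _] := ieps.
have mY k : measurable_fun setT (arrival_time E k) by exact: measurable_arrival_time.
apply: (past_independent mY ie iEeps) => //.
have mG k : measurable_fun setT (arrival k.+1 : pastT eps (arrival_time E) m -> R).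
  exact: (@past_measurable_Y _ _ _ eps (arrival_time E) m k.+1).
apply: (@past_pair _ (pastT eps (arrival_time E) m)) => //.
apply: measurable_sum => k; apply: measurable_funM; first exact: measurable_cst.
apply: measurable_funM.
  exact: (@past_measurable_X _ _ _ eps (arrival_time E) m k (ltn_ord k)).
exact: (measurableT_comp (measurable_powR (- a)) (mG k)).
Qed.

(** Here the roles are exchanged: the past contains the whole sequence eps and the interarrival
    times before [E m]. *)
Lemma E_independent n m (A : set (R * R)) B : measurable A -> measurable B ->
  P ((fun w => (shock_sum n m w, arrival m w)) @^-1` A `&` E m @^-1` B) =
  (P ((fun w => (shock_sum n m w, arrival m w)) @^-1` A) * P (E m @^-1` B))%E.
Proof.
move=> mA mB.
have mY k : measurable_fun setT (eps k) by exact: measurable_funPT.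
apply: (past_independent mY iE ieps_E) => //.
have mG k : (k <= m)%N -> measurable_fun setT (arrival k : pastT E eps m -> R).
  move=> km; apply: measurable_sum => i.
  exact: (@past_measurable_X _ _ _ E eps m i (leq_trans (ltn_ord i) km)).
apply: (@past_pair _ (pastT E eps m)) => //; last exact: mG.
apply: measurable_sum => k; apply: measurable_funM; first exact: measurable_cst.
apply: measurable_funM.
  exact: (@past_measurable_Y _ _ _ E eps m k).
exact: (measurableT_comp (measurable_powR (- a)) (mG _ (ltn_ord k))).
Qed.

Lemma ae_E_gt0 : {ae P, forall w k, 0 < E k w}.
Proof.
apply: ae_foralln => k; exists (E k @^-1` `]-oo, 0]%classic); split.
- by rewrite -[X in measurable X]setTI; exact: measurable_funPT.
- apply: etrans (lE k (measurable_itv _)) _; rewrite /exponential_prob.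
  rewrite -integral_itv_bndo_bndc.
    apply: integral0_eq => x; rewrite /= in_itv/= => x0.
    by rewrite lt0_exponential_pdf.
  by apply/measurable_EFinP; apply: measurable_funTS; exact: measurable_exponential_pdf.
- by move=> w /= /negP; rewrite -leNgt in_itv/=.
Qed.

Let q t := cos_deficit a lam t.
Let e t := renewal_exp a lam t.

Let mq t : measurable_fun setT (q t). Proof. exact: measurable_cos_deficit. Qed.
Let me t : measurable_fun setT (e t). Proof. exact: measurable_renewal_exp. Qed.

Let mcos : measurable_fun setT (@cos R).
Proof. exact: (continuous_measurable_fun (@continuous_cos R)). Qed.

(** First half of the martingale step: integrate out [eps m]. By the addition formula the sine term
    has mean 0 and the cosine term contributes 1 - q. *)
Lemma eps_step om t n m : (n <= m)%N ->
  \int[P]_w (cos (om + t * shock_sum n m.+1 w) * e t (arrival m.+1 w)) =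
  \int[P]_w (cos (om + t * shock_sum n m w) *
    ((1 - q t (arrival m.+1 w)) * e t (arrival m.+1 w))).
Proof.
move=> nm.
have mV : measurable_fun setT (fun w => (shock_sum n m w, arrival m.+1 w)).
  by apply/measurable_fun_pair; [exact: measurable_shock_sum|exact: measurable_arrival].
pose V : {mfun T >-> (R * R)%type} :=
  HB.pack (fun w => (shock_sum n m w, arrival m.+1 w)) (isMeasurableFun.Build _ _ _ _ _ mV).
pose f (z : (R * R) * R) := cos (om + t * (z.1.1 + z.2 * z.1.2 `^ (- a))) * e t z.1.2.
have m11 : measurable_fun setT (fun z : (R * R) * R => z.1.1).
  exact: (measurableT_comp measurable_fst measurable_fst).
have m12 : measurable_fun setT (fun z : (R * R) * R => z.1.2).
  exact: (measurableT_comp measurable_snd measurable_fst).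
have m2 : measurable_fun setT (fun z : (R * R) * R => z.2) by exact: measurable_snd.
have mf : measurable_fun setT f.
  apply: measurable_funM; last exact: (measurableT_comp (me t) m12).
  apply: (measurableT_comp mcos); apply: measurable_funD; first exact: measurable_cst.
  apply: measurable_funM; first exact: measurable_cst.
  apply: (measurable_funD m11); apply: (measurable_funM m2).
  exact: (measurableT_comp (measurable_powR (- a)) m12).
have bf z : `|f z| <= 1.
  by rewrite normrM mulr_ile1 ?cos_max ?norm_renewal_exp.
have indep A B : measurable A -> measurable B ->
    P (V @^-1` A `&` eps m @^-1` B) = (P (V @^-1` A) * P (eps m @^-1` B))%E.
  exact: eps_independent.
have := @independent_Rintegral _ T R P _ _ V (eps m) lam f 1 (lam_eps m) indep mf bf.
rewrite /f/= => H.
transitivity (\int[P]_w (cos (om + t * (shock_sum n m w + eps m w * arrival m.+1 w `^ (- a))) *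
     e t (arrival m.+1 w))).
  by apply: eq_Rintegral => w _; rewrite shock_sumS.
rewrite H; apply: eq_Rintegral => w _.
set s := shock_sum n m w; set g := arrival m.+1 w; set c := g `^ (- a).
have mtc : measurable_fun setT (fun y : R => t * y * c).
  by apply: measurable_funM => //; exact: measurable_funM.
have ic : lam.-integrable setT (fun y => (cos (t * y * c))%:E).
  by apply: (@integrable_bounded _ _ _ lam _ 1) => [|y];
    [exact: (measurableT_comp mcos mtc)|exact: cos_max].
have is' : lam.-integrable setT (fun y => (sin (t * y * c))%:E).
  apply: (@integrable_bounded _ _ _ lam _ 1) => [|y]; last exact: sin_max.
  exact: (measurableT_comp (continuous_measurable_fun (@continuous_sin R)) mtc).
transitivity (\int[lam]_y (cos (om + t * s) * e t g * cos (t * y * c) -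
    sin (om + t * s) * e t g * sin (t * y * c))).
  apply: eq_Rintegral => y _.
  have -> : om + t * (s + y * c) = (om + t * s) + t * y * c by ring.
  by rewrite cosD; ring.
rewrite RintegralB//; [|exact: integrable_fZl..].
rewrite !RintegralZl// cos_deficitE.
rewrite (_ : \int[lam]_y sin (t * y * c) = 0) ?mulr0 ?subr0; first by rewrite /q; ring.
rewrite -(sin_mean0 (t * c)); apply: eq_Rintegral => y _; congr sin; ring.
Qed.

(** Second half: integrate out [E m], which is [renewal_identity] at g = [arrival m]. *)
Lemma E_step om t n m :
  \int[P]_w (cos (om + t * shock_sum n m w) *
    ((1 - q t (arrival m.+1 w)) * e t (arrival m.+1 w))) =
  \int[P]_w (cos (om + t * shock_sum n m w) * e t (arrival m w)).
Proof.
have mV : measurable_fun setT (fun w => (shock_sum n m w, arrival m w)).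
  by apply/measurable_fun_pair; [exact: measurable_shock_sum|exact: measurable_arrival].
pose V : {mfun T >-> (R * R)%type} :=
  HB.pack (fun w => (shock_sum n m w, arrival m w)) (isMeasurableFun.Build _ _ _ _ _ mV).
pose k x := (1 - q t x) * e t x.
have mk : measurable_fun setT k.
  apply: measurable_funM (me t); apply: measurable_funB (mq t); exact: measurable_cst.
have bk x : `|k x| <= 1.
  by rewrite normrM mulr_ile1 ?norm_oneB_cos_deficit ?norm_renewal_exp.
pose f (z : (R * R) * R) := cos (om + t * z.1.1) * k (z.1.2 + z.2).
have m11 : measurable_fun setT (fun z : (R * R) * R => z.1.1).
  exact: (measurableT_comp measurable_fst measurable_fst).
have m12 : measurable_fun setT (fun z : (R * R) * R => z.1.2).
  exact: (measurableT_comp measurable_snd measurable_fst).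
have m2 : measurable_fun setT (fun z : (R * R) * R => z.2) by exact: measurable_snd.
have mf : measurable_fun setT f.
  apply: measurable_funM; last exact: (measurableT_comp mk (measurable_funD m12 m2)).
  apply: (measurableT_comp mcos); apply: measurable_funD; first exact: measurable_cst.
  by apply: measurable_funM => //; exact: measurable_cst.
have bf z : `|f z| <= 1 by rewrite normrM mulr_ile1 ?cos_max ?bk.
have indep A B : measurable A -> measurable B ->
    P (V @^-1` A `&` E m @^-1` B) = (P (V @^-1` A) * P (E m @^-1` B))%E.
  exact: E_independent.
pose lE0 : probability R R := distribution P (E m).
have := @independent_Rintegral _ T R P _ _ V (E m) lE0 f 1 _ indep mf bf.
move=> /(_ (fun _ _ => erefl)); rewrite /f/= => H.
transitivity (\int[P]_w (cos (om + t * shock_sum n m w) * k (arrival m w + E m w))).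
  by apply: eq_Rintegral => w _; rewrite arrivalS.
rewrite H.
have inner s g : \int[lE0]_y (cos (om + t * s) * k (g + y)) =
    cos (om + t * s) * \int[mu]_(x in `]0, +oo[) (k (g + x) * expR (- x)).
  have mkg : measurable_fun setT (fun y : R => k (g + y)).
    by apply: (measurableT_comp mk); exact: measurable_funD.
  have bkg y : `|k (g + y)| <= 1 by exact: bk.
  rewrite RintegralZl//; last by apply: (integrable_bounded _ mkg bkg).
  by rewrite (Rintegral_exponential (lE m) mkg bkg).
apply: ae_eq_Rintegral.
- have mF := @measurable_parametric_Rintegral _ R R lE0 _ _ f 1 mf bf.
  exact: (measurableT_comp mF mV).
- apply: measurable_funM; last exact: (measurableT_comp (me t) (measurable_arrival m)).
  apply: (measurableT_comp mcos); apply: measurable_funD; first exact: measurable_cst.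
  by apply: measurable_funM (measurable_shock_sum n m); exact: measurable_cst.
(* [renewal_identity] requires g >= 0, which holds for arrival times almost surely only. *)
- apply: filterS ae_E_gt0 => w Ew; rewrite inner; congr (_ * _).
  by apply: renewal_identity => //; apply: sumr_ge0 => i _; exact: ltW.
Qed.

Lemma cos_renewal_martingale om t n m : (n <= m)%N ->
  \int[P]_w (cos (om + t * shock_sum n m w) * e t (arrival m w)) =
  cos om * \int[P]_w e t (arrival n w).
Proof.
move=> /subnK <-; elim: (m - n)%N => [|k IH].
  rewrite add0n -RintegralZl//.
    by apply: eq_Rintegral => w _; rewrite shock_sumxx mulr0 addr0.
  apply: (@integrable_bounded _ _ _ P _ 1) => [|w]; last exact: norm_renewal_exp.
  exact: (measurableT_comp (me t) (measurable_arrival n)).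
rewrite addSn -IH.
exact: etrans (eps_step om t (leq_addl k n)) (E_step om t n (k + n)).
Qed.

Lemma arrival_laplace l n : 0 <= l ->
  \int[P]_w expR (- (l * Num.max (arrival n w) 0)) = (1 + l)^-1 ^+ n.
Proof.
move=> l0; pose h (x : R) := expR (- (l * Num.max x 0)).
have mh : measurable_fun setT h.
  apply: (measurableT_comp (@measurable_expR R)); apply: measurableT_comp => //.
  by apply: measurable_funM => //; apply: measurable_maxr.
have h0 x : 0 < h x by exact: expR_gt0.
have bh x : `|h x| <= 1.
  by rewrite gtr0_norm// -expR0 ler_expR oppr_le0 mulr_ge0// max0_ge0.
elim: n => [|n IH].
  rewrite expr0 -[RHS](@Rintegral_prob_cst _ _ _ P); apply: eq_Rintegral => w _.
  by rewrite /arrival big_ord0 maxxx mulr0 oppr0 expR0.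
have mV : measurable_fun setT (fun w => (shock_sum n n w, arrival n w)).
  by apply/measurable_fun_pair; [exact: measurable_shock_sum|exact: measurable_arrival].
(* The first component is 0; the pair is formed in order to apply [E_independent]. *)
pose V : {mfun T >-> (R * R)%type} :=
  HB.pack (fun w => (shock_sum n n w, arrival n w)) (isMeasurableFun.Build _ _ _ _ _ mV).
pose f (z : (R * R) * R) := h z.1.2 * h z.2.
have mf : measurable_fun setT f.
  apply: measurable_funM; apply: (measurableT_comp mh); last exact: measurable_snd.
  exact: (measurableT_comp measurable_snd measurable_fst).
have bf z : `|f z| <= 1 by rewrite normrM mulr_ile1.
have indep A B : measurable A -> measurable B ->
    P (V @^-1` A `&` E n @^-1` B) = (P (V @^-1` A) * P (E n @^-1` B))%E.
  exact: E_independent.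
have := @independent_Rintegral _ T R P _ _ V (E n) (distribution P (E n)) f 1 _ indep mf bf.
move=> /(_ (fun _ _ => erefl)); rewrite /f/= => H.
have mha k : measurable_fun setT (fun w => h (arrival k w)).
  exact: (measurableT_comp mh (measurable_arrival k)).
have mhE k : measurable_fun setT (fun w => h (E k w)).
  by apply: (measurableT_comp mh); exact: measurable_funPT.
transitivity (\int[P]_w (h (arrival n w) * h (E n w))).
  apply: ae_eq_Rintegral; [exact: (mha n.+1)|exact: measurable_funM|].
  apply: filterS ae_E_gt0 => w Ew.
  have An : 0 <= arrival n w by apply: sumr_ge0 => i _; exact: ltW.
  rewrite arrivalS /h !max_l ?addr_ge0 ?(ltW (Ew n))//.
  by rewrite -expRD mulrDr opprD.
rewrite H.
have -> : \int[P]_w (\int[distribution P (E n)]_y (h (arrival n w) * h y)) =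
    \int[P]_w (h (arrival n w) * \int[distribution P (E n)]_y h y).
  by apply: eq_Rintegral => w _; rewrite RintegralZl//; exact: integrable_bounded bh.
have ih : P.-integrable setT (fun w => (h (arrival n w))%:E).
  by apply: (@integrable_bounded _ _ _ P _ 1).
rewrite RintegralZr// IH exprSr; congr (_ * _).
rewrite (Rintegral_exponential (lE n) mh bh).
rewrite -Rintegral_expR_oy ?ltr_pwDl//.
apply: eq_Rintegral => x; rewrite inE/= in_itv/= andbT => x0.
by rewrite /h max_l ?(ltW x0)// -expRD; congr expR; ring.
Qed.

Let J := tail_integral (ratio_mixture a lam).

Let J_ge0 g : 0 <= J g.
Proof. by apply: tail_integral_ge0 => s _; exact: ratio_mixture_ge0. Qed.

Let J_ni : {homo J : x y /~ x <= y}.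
Proof.
apply: tail_integral_nonincreasing; last exact: integrable_ratio_mixture.
by move=> s _; exact: ratio_mixture_ge0.
Qed.

Let J_max g : J (Num.max g 0) = J g.
Proof. by rewrite /J /tail_integral max_l// max0_ge0. Qed.

Let J_le g : `|J g| <= J 0.
Proof. by rewrite ger0_norm// -J_max J_ni// max0_ge0. Qed.

Let mJ : measurable_fun setT J.
Proof.
apply: measurable_tail_integral; last exact: integrable_ratio_mixture.
by move=> s _; exact: ratio_mixture_ge0.
Qed.

Let mJa n : measurable_fun setT (fun w => J (arrival n w)).
Proof. exact: (measurableT_comp mJ (measurable_arrival n)). Qed.

Definition mean_tail n := \int[P]_w J (arrival n w).

Lemma mean_tail_ge0 n : 0 <= mean_tail n.
Proof. by apply: Rintegral_ge0. Qed.

(** A Laplace bound replaces almost sure divergence of the arrival times: E e^(-G_n) = 2^(-n). *)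
Lemma cvg_mean_tail : mean_tail n @[n --> \oo] --> 0.
Proof.
have cJ : J x @[x --> +oo] --> 0 by apply: cvg_tail_integral_y; exact: integrable_ratio_mixture.
have mexp n : measurable_fun setT (fun w => expR (- (1 * Num.max (arrival n w) 0))).
  apply: (measurableT_comp (@measurable_expR R)); apply: measurableT_comp => //.
  by apply: measurable_funM => //; apply: measurable_maxr => //; exact: measurable_arrival.
have bexp n w : `|expR (- (1 * Num.max (arrival n w) 0))| <= 1.
  by rewrite ger0_norm ?expR_ge0// -[leRHS]expR0 ler_expR oppr_le0 mul1r max0_ge0.
apply/cvgr0Pnorm_le => eta eta0.
have eta2 : 0 < eta / 2 by rewrite divr_gt0.
have [M [_ HM]] := (cvgr0Pnorm_le _).1 cJ _ eta2.
pose M1 := Num.max (M + 1) 0.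
have JM1 g : M1 <= g -> J g <= eta / 2.
  move=> Mg; apply: le_trans (ler_norm _) (HM g _).
  by apply: lt_le_trans Mg; rewrite lt_max ltrDl ltr01.
have M10 : 0 <= M1 by rewrite /M1 max0_ge0.
pose C := J 0 * expR M1.
(* Beyond M1 the first term suffices; below M1, e^(M1-g) >= 1 and the second term exceeds J 0. *)
have key g : J g <= eta / 2 + C * expR (- (1 * Num.max g 0)).
  rewrite -J_max; set g' := Num.max g 0; rewrite mul1r.
  have [/JM1 h|gM] := leP M1 g'.
    by apply: le_trans h _; rewrite lerDl mulr_ge0 ?expR_ge0// mulr_ge0 ?expR_ge0.
  apply: (@le_trans _ _ (J 0)); first by rewrite J_ni// max0_ge0.
  apply: ler_wpDl; first exact: ltW.
  by rewrite /C -mulrA -expRD ler_peMr// -expR0 ler_expR subr_ge0 ltW.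
have bound n : mean_tail n <= eta / 2 + C * (1 + 1)^-1 ^+ n.
  rewrite -(arrival_laplace n ler01) -RintegralZl//;
    last exact: (integrable_bounded P (mexp n) (bexp n)).
  rewrite -[X in _ <= X + _](Rintegral_prob_cst P) -RintegralD//; last 2 first.
  - by apply: (@integrable_bounded _ _ _ P (fun=> eta / 2) `|eta / 2|).
  - by apply: integrable_fZl => //; exact: (integrable_bounded P (mexp n) (bexp n)).
  apply: le_Rintegral => //.
  - by apply: (integrable_bounded P (mJa n)) => w; exact: J_le.
  - apply: (@integrable_fD _ _ _ P) => //.
      by apply: (@integrable_bounded _ _ _ P (fun=> eta / 2) `|eta / 2|).
    by apply: integrable_fZl => //; exact: (integrable_bounded P (mexp n) (bexp n)).
have c0 : C * (1 + 1)^-1 ^+ n @[n --> \oo] --> 0.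
  rewrite -[X in _ --> X](mulr0 C); apply: cvgMr; apply: cvg_expr.
  by rewrite ger0_norm ?invr_ge0// invf_lt1// ltrDl.
apply: filterS ((cvgr0Pnorm_le _).1 c0 _ eta2) => n hn; rewrite ger0_norm ?mean_tail_ge0//.
apply: le_trans (bound n) _; rewrite [leRHS]splitr lerD2l.
exact: le_trans (ler_norm _) hn.
Qed.

Let mcs om t n m : measurable_fun setT (fun w => cos (om + t * shock_sum n m w)).
Proof.
apply: (measurableT_comp mcos); apply: measurable_funD; first exact: measurable_cst.
by apply: measurable_funM (measurable_shock_sum n m); exact: measurable_cst.
Qed.

Let mea t n : measurable_fun setT (fun w => e t (arrival n w)).
Proof. exact: (measurableT_comp (me t) (measurable_arrival n)). Qed.

Let bea t n w : `|e t (arrival n w)| <= 1.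
Proof. exact: norm_renewal_exp. Qed.

Lemma oneB_mean_renewal_exp_le t n :
  1 - \int[P]_w e t (arrival n w) <= 2 * (1 + t ^+ 2) * mean_tail n.
Proof.
have ic : P.-integrable setT (fun=> (1 : R)%:E).
  by apply: (@integrable_bounded _ _ _ P (fun=> 1) `|1|).
have ie : P.-integrable setT (fun w => (e t (arrival n w))%:E).
  by apply: (integrable_bounded P (mea t n)); exact: bea.
have iJ : P.-integrable setT (fun w => (J (arrival n w))%:E).
  by apply: (integrable_bounded P (mJa n)) => w; exact: J_le.
rewrite -[X in X - _](Rintegral_prob_cst P) -RintegralB// -RintegralZl//.
apply: le_Rintegral => //; first exact: (@integrable_fB _ _ _ P).
  exact: integrable_fZl.
by move=> w _; exact: oneB_renewal_exp_le.
Qed.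

(** Replacing e_t(G_m) by 1 in the martingale identity costs at most 1 - E e_t(G_m). *)
Lemma mean_cos_shock_sum om t n m : (n <= m)%N ->
  `|\int[P]_w cos (om + t * shock_sum n m w) - cos om * \int[P]_w e t (arrival n w)| <=
  2 * (1 + t ^+ 2) * mean_tail m.
Proof.
move=> nm; rewrite -(cos_renewal_martingale _ _ nm).
have ic : P.-integrable setT (fun w => (cos (om + t * shock_sum n m w))%:E).
  by apply: (@integrable_bounded _ _ _ P _ 1) => // w; exact: cos_max.
have mce : measurable_fun setT (fun w => cos (om + t * shock_sum n m w) * e t (arrival m w)).
  exact: measurable_funM.
have bce w : `|cos (om + t * shock_sum n m w) * e t (arrival m w)| <= 1.
  by rewrite normrM mulr_ile1// cos_max.
have ice := integrable_bounded P mce bce.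
have i1 : P.-integrable setT (fun=> (1 : R)%:E).
  by apply: (@integrable_bounded _ _ _ P (fun=> 1) `|1|).
have ie : P.-integrable setT (fun w => (e t (arrival m w))%:E).
  by apply: (integrable_bounded P (mea t m)); exact: bea.
apply: le_trans (oneB_mean_renewal_exp_le t m).
rewrite -[X in _ <= X - _](Rintegral_prob_cst P) -!RintegralB//.
apply: le_trans (le_normr_Rintegral _ _) _ => //; first exact: (@integrable_fB _ _ _ P).
apply: le_Rintegral => //.
- apply: (@integrable_bounded _ _ _ P _ 2) => [|w].
    by apply: measurableT_comp => //; exact: measurable_funB.
  by rewrite normr_id (le_trans (ler_normB _ _))// [leRHS]/(1 + 1) lerD// cos_max.
- exact: (@integrable_fB _ _ _ P).
- move=> w _; rewrite -[X in `|X - _|]mulr1 -mulrBr normrM.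
  rewrite [X in _ * X]ger0_norm ?subr_ge0 ?renewal_exp_le1//.
  by rewrite ler_piMl ?cos_max// subr_ge0 renewal_exp_le1.
Qed.

Lemma cvg_mean_cos_shock_sum om t :
  \int[P]_w cos (om + t * shock_sum 0 n w) @[n --> \oo] --> cos om * e t 0.
Proof.
have e0 : \int[P]_w e t (arrival 0 w) = e t 0.
  rewrite -[RHS](Rintegral_prob_cst P); apply: eq_Rintegral => w _.
  by rewrite /arrival big_ord0.
apply/subr_cvg0; apply/norm_cvg0P; apply: (@squeeze_cvgr _ _ _ _ (fun=> 0) (fun n => 2 * (1 + t
  ^+ 2) * mean_tail n)).
- near=> n; rewrite normr_ge0/= -e0; exact: mean_cos_shock_sum.
- exact: cvg_cst.
- rewrite -[X in _ --> X](mulr0 (2 * (1 + t ^+ 2))); apply: cvgMr; exact: cvg_mean_tail.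
Unshelve. all: by end_near.
Qed.

Let mratio : measurable_fun setT (@ratio R).
Proof. exact: (continuous_measurable_fun (@continuous_ratio R)). Qed.

Let oneB_mean_cos_le t n m : (n <= m)%N ->
  1 - \int[P]_w cos (t * shock_sum n m w) <=
  2 * (1 + t ^+ 2) * (mean_tail n + mean_tail m).
Proof.
move=> nm; have := mean_cos_shock_sum 0 t nm.
under eq_Rintegral do rewrite add0r.
rewrite cos0 mul1r ler_norml => /andP[+ _].
have key (x y z u : R) : 1 - z <= x -> - y <= u - z -> 1 - u <= x + y by move=> *; lra.
move=> h2; rewrite (mulrDr (2 * (1 + t ^+ 2))).
exact: key (oneB_mean_renewal_exp_le t n) h2.
Qed.

Lemma mean_ratio_shock_sum_le : exists2 K, 0 <= K & forall n m, (n <= m)%N ->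
  \int[P]_w ratio (shock_sum n m w) <= K * (mean_tail n + mean_tail m).
Proof.
(* This is 2 (1 + x^2) e^(-x), the factor of [oneB_mean_cos_le] times the Laplace weight, split so
   that [integrable_powR_expR] applies. *)
pose k (x : R) := 2 * (x `^ 0 * expR (- (1 * x))) + 2 * (x `^ 2 * expR (- (1 * x))).
have kE x : 0 < x -> k x = expR (- (1 * x)) * (2 * (1 + x ^+ 2)).
  by move=> x0; rewrite /k powRr0 -(powR_mulrn 2 (ltW x0)); ring.
have ik : mu.-integrable `]0, +oo[ (fun x => (k x)%:E).
  by apply: integrable_fD; first exact: measurable_oy; apply: integrable_fZl;
    try exact: measurable_oy; apply: integrable_powR_expR; lra.
have k0 x : 0 < x -> 0 <= k x.
  by move=> x0; rewrite kE// mulr_ge0 ?expR_ge0// mulr_ge0// addr_ge0// sqr_ge0.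
exists (\int[mu]_(x in `]0, +oo[) k x).
  by apply: Rintegral_ge0 => x /=; rewrite in_itv/= andbT; exact: k0.
move=> n m nm; set b := mean_tail n + mean_tail m.
have b0 : 0 <= b by rewrite addr_ge0// mean_tail_ge0.
pose D w := shock_sum n m w.
have mD : measurable_fun setT D by exact: measurable_shock_sum.
have kfin : (\int[mu]_(x in `]0%R, +oo[) (k x)%:E)%E \is a fin_num.
  by apply: integrable_fin_num => //; exact: measurable_oy.
rewrite -lee_fin EFinM (@EFin_Rintegral_bounded _ _ _ _ _ 1); last 2 first.
- exact: (measurableT_comp mratio mD).
- by move=> w; rewrite ger0_norm ?ratio_ge0 ?ratio_le1.
rewrite fineK// muleC -ge0_integralZl//; last 2 first.
- by apply: measurable_int ik.
- by move=> x /=; rewrite in_itv/= andbT => x0; rewrite lee_fin k0.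
pose f (z : T * measurableTypeR R) := expR (- (1 * z.2)) * (1 - cos (z.2 * D z.1)).
have m2 : measurable_fun setT (fun z : T * measurableTypeR R => (z.2 : R)).
  exact: measurable_snd.
have m1 : measurable_fun setT (fun z : T * measurableTypeR R => D z.1).
  exact: (measurableT_comp mD measurable_fst).
have mf : measurable_fun setT f.
  apply: measurable_funM.
    apply: (measurableT_comp (@measurable_expR R)); apply: measurableT_comp => //.
    exact: measurable_funM.
  apply: measurable_funB; first exact: measurable_cst.
  by apply: (measurableT_comp mcos); exact: measurable_funM.
have f0 w x : [set: T] w -> `]0, +oo[%classic x -> 0 <= f (w, x).
  by move=> _ _; rewrite mulr_ge0 ?expR_ge0// subr_ge0 cos_le1.
have -> : (\int[P]_w (ratio (D w))%:E =
    \int[P]_(w in setT) \int[mu]_(x in `]0%R, +oo[) (f (w, x))%:E)%E.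
  apply: eq_integral => w _; apply: esym; apply: etrans (laplace_oneBcos (D w) ltr01) _.
  by rewrite /ratio expr1n mul1r.
rewrite (@tonelli_on _ _ _ _ R P mu setT `]0, +oo[%classic f measurableT (measurable_oy 0) mf f0).
apply: ge0_le_integral.
- exact: measurable_oy.
- by move=> x x0; apply: integral_ge0 => w _; rewrite lee_fin f0.
- apply: (@measurable_funS _ _ _ _ setT) => //.
  have f0' z : (0 <= (EFin \o f) z)%E.
    by rewrite lee_fin mulr_ge0 ?expR_ge0// subr_ge0 cos_le1.
  apply: (@measurable_fun_fubini_tonelli_G _ _ _ _ R P (EFin \o f)) => //.
  by apply/measurable_EFinP.
- by apply: emeasurable_funM => //; case/integrableP: ik.
move=> x /=; rewrite in_itv/= andbT => x0.
have mc : measurable_fun setT (fun w => cos (x * D w)).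
  by apply: (measurableT_comp mcos); apply: measurable_funM.
have ic : P.-integrable setT (fun w => (cos (x * D w))%:E).
  by apply: (@integrable_bounded _ _ _ P _ 1) => // w; exact: cos_max.
have i1 : P.-integrable setT (fun=> (1 : R)%:E).
  by apply: (@integrable_bounded _ _ _ P (fun=> 1) `|1|).
have i1c : P.-integrable setT (fun w => (1 - cos (x * D w))%:E).
  exact: (@integrable_fB _ _ _ P).
have := oneB_mean_cos_le x nm.
rewrite -[X in X - _](Rintegral_prob_cst P) -RintegralB// => H.
rewrite (_ : (\int[P]_w _)%E = (\int[P]_w (f (w, x)))%:E); last first.
  rewrite fineK//; apply: integrable_fin_num => //.
  rewrite /f/=; exact: integrable_fZl i1c.
rewrite /f/= RintegralZl// -EFinM lee_fin kE// mulrCA ler_wpM2l ?expR_ge0//.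
by apply: le_trans H _; rewrite mulrC.
Qed.

(* A bounded substitute for (arrival n / n - 1)^2 whose mean is given by Laplace
   transforms. *)
Definition lln_error n w := (expR (- (n%:R^-1 * Num.max (arrival n w) 0)) - expR (-1)) ^+ 2.

Lemma measurable_lln_error n : measurable_fun setT (lln_error n).
Proof.
apply: measurable_funX; apply: measurable_funB => //.
apply: (measurableT_comp (@measurable_expR R)); apply: measurableT_comp => //.
by apply: measurable_funM => //; apply: measurable_maxr => //; exact: measurable_arrival.
Qed.

Lemma lln_error_ge0 n w : 0 <= lln_error n w. Proof. exact: sqr_ge0. Qed.

Lemma lln_error_le1 n w : lln_error n w <= 1.
Proof.
have key (x y : R) : 0 <= x <= 1 -> 0 <= y <= 1 -> (x - y) ^+ 2 <= 1.
  move=> /andP[h1 h2] /andP[h3 h4].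
  have : 0 <= (1 - (y - x)) * (1 + (y - x)) by apply: mulr_ge0; lra.
  by rewrite !expr2; lra.
apply: key; rewrite expR_ge0/= -[leRHS]expR0 ler_expR oppr_le0//.
by rewrite mulr_ge0 ?max0_ge0// invr_ge0.
Qed.

(** Expanding the square leaves Laplace transforms at 2/n and 1/n, with limits e^(-2) and e^(-1);
    the three terms cancel in the limit. *)
Lemma cvg_mean_lln_error : \int[P]_w lln_error n w @[n --> \oo] --> 0.
Proof.
pose Z (l : R) n w := expR (- (l * Num.max (arrival n w) 0)).
have mZ l n : measurable_fun setT (Z l n).
  apply: (measurableT_comp (@measurable_expR R)); apply: measurableT_comp => //.
  by apply: measurable_funM => //; apply: measurable_maxr => //; exact: measurable_arrival.
have bZ l n w : 0 <= l -> `|Z l n w| <= 1.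
  move=> l0; rewrite ger0_norm ?expR_ge0// -[leRHS]expR0 ler_expR oppr_le0.
  by rewrite mulr_ge0// max0_ge0.
have iZ l n : 0 <= l -> P.-integrable setT (fun w => (Z l n w)%:E).
  by move=> l0; apply: (@integrable_bounded _ _ _ P _ 1) => // w; exact: bZ.
have i1 c : P.-integrable setT (fun=> (c : R)%:E).
  by apply: (@integrable_bounded _ _ _ P (fun=> c) `|c|).
have LZ l n : 0 <= l -> \int[P]_w Z l n w = (1 + l)^-1 ^+ n by exact: arrival_laplace.
pose e1 : R := expR (-1).
have EZ n : \int[P]_w lln_error n w =
    (1 + 2 * n%:R^-1)^-1 ^+ n - 2 * e1 * (1 + 1 * n%:R^-1)^-1 ^+ n + e1 ^+ 2.
  have n0 : (0 : R) <= n%:R^-1 by rewrite invr_ge0.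
  have n20 : (0 : R) <= 2 * n%:R^-1 by rewrite mulr_ge0.
  rewrite mul1r -!LZ// -RintegralZl//; last exact: iZ.
  have i2 := iZ _ n n20.
  have i3 : P.-integrable setT (fun w => (2 * e1 * Z n%:R^-1 n w)%:E).
    by apply: integrable_fZl => //; exact: iZ.
  rewrite -[X in _ + X](Rintegral_prob_cst P) -RintegralB// -RintegralD//.
    apply: eq_Rintegral => w _; rewrite /lln_error -/e1 -/(Z n%:R^-1 n w).
    have -> : Z (2 * n%:R^-1) n w = Z n%:R^-1 n w * Z n%:R^-1 n w.
      by rewrite /Z -expRD; congr expR; ring.
    by ring.
  - exact: integrable_fB.
  - exact: i1.
have H2 := @cvg_exponential_power R 2 (ler0n R 2).
have H1 := @cvg_exponential_power R 1 ler01.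
under eq_fun do rewrite EZ.
have -> : (0 : R) = expR (- 2) - 2 * e1 * expR (- 1) + e1 ^+ 2.
  by rewrite -/e1 (_ : - 2 = -1 + -1 :> R) ?expRD -/e1; ring.
apply: cvgD; last exact: cvg_cst.
by apply: cvgB => //; apply: cvgMr.
Qed.

Lemma cvg_arrival_of_lln_error (m : nat -> nat) w : (forall k, 0 < E k w) ->
  lln_error (m j) w @[j --> \oo] --> 0 ->
  arrival (m j) w / (m j)%:R @[j --> \oo] --> (1 : R).
Proof.
move=> Ew lw.
have A0 n : 0 <= arrival n w by apply: sumr_ge0 => i _; exact: ltW.
pose z j := expR (- ((m j)%:R^-1 * arrival (m j) w)).
have zc : z j @[j --> \oo] --> expR (-1).
  apply/subr_cvg0/norm_cvg0P.
  have : Num.sqrt (lln_error (m j) w) @[j --> \oo] --> Num.sqrt (0 : R).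
    by apply: continuous_cvg lw; exact: sqrt_continuous.
  rewrite sqrtr0; apply: cvg_trans; apply: near_eq_cvg; near=> j.
  by rewrite /lln_error sqrtr_sqr max_l.
have : - ln (z j) @[j --> \oo] --> - ln (expR (- 1 : R)).
  by apply: cvgN; apply: continuous_cvg zc; apply: continuous_ln; exact: expR_gt0.
rewrite expRK opprK; apply: cvg_trans; apply: near_eq_cvg; near=> j.
by rewrite /z expRK opprK mulrC.
Unshelve. all: by end_near.
Qed.

Lemma shock_sum_add n m w : (n <= m)%N -> shock_sum 0 m w = shock_sum 0 n w + shock_sum n m w.
Proof.
move=> /subnK <-; elim: (m - n)%N => [|k IH]; first by rewrite shock_sumxx addr0.
by rewrite addSn !shock_sumS ?leq_addl// IH addrA.
Qed.

(* With these rates, the increments between consecutive N j are eventually at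
   most 2^(-j), by norm_le_of_ratio and Borel-Cantelli. *)
Lemma fast_indices : exists N : nat -> nat,
  [/\ forall j, (N j <= N j.+1)%N, forall j, (j <= N j)%N,
     forall j n m, (N j <= n <= m)%N ->
       \int[P]_w ratio (shock_sum n m w) <= (4 ^+ j * 2 ^+ j.+1)^-1 &
     forall j n, (N j <= n)%N -> \int[P]_w lln_error n w <= (2 ^+ j.+1)^-1].
Proof.
have [K K0 HK] := mean_ratio_shock_sum_le.
have Kd : 0 < 2 * K + 1 by rewrite ltr_wpDl// mulr_ge0.
have bounds j : exists M, forall n, (M <= n)%N ->
    mean_tail n <= (4 ^+ j * 2 ^+ j.+1)^-1 / (2 * K + 1) /\
    \int[P]_w lln_error n w <= (2 ^+ j.+1)^-1.
  have b1 : 0 < (4 ^+ j * 2 ^+ j.+1)^-1 / (2 * K + 1).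
    by rewrite divr_gt0// invr_gt0 mulr_gt0// exprn_gt0.
  have b2 : 0 < (2 ^+ j.+1)^-1 :> R by rewrite invr_gt0 exprn_gt0.
  have [M1 _ H1] := (cvgr0Pnorm_le _).1 cvg_mean_tail _ b1.
  have [M2 _ H2] := (cvgr0Pnorm_le _).1 cvg_mean_lln_error _ b2.
  exists (maxn M1 M2) => n; rewrite geq_max => /andP[n1 n2].
  by split; [apply: le_trans (ler_norm _) (H1 _ n1)|apply: le_trans (ler_norm _) (H2 _ n2)].
have [M HM] := choice bounds.
(* The sum makes N nondecreasing and at least M j; the summand j gives j <= N j. *)
exists (fun j => j + \sum_(i < j.+1) M i)%N.
have MN j : (M j <= j + \sum_(i < j.+1) M i)%N.
  by rewrite big_ord_recr/= addnA leq_addl.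
split => [j|j|j n m /andP[Nn nm]|j n Nn].
- by rewrite [in leqRHS]big_ord_recr/= addnA (leq_trans _ (leq_addr _ _))// leq_add2r.
- exact: leq_addr.
- apply: le_trans (HK _ _ nm) _.
  have [h1 _] := HM j n (leq_trans (MN j) Nn).
  have [h2 _] := HM j m (leq_trans (MN j) (leq_trans Nn nm)).
  apply: (@le_trans _ _ (K * ((4 ^+ j * 2 ^+ j.+1)^-1 / (2 * K + 1) + (4 ^+ j * 2 ^+ j.+1)^-1 /
    (2 * K + 1)))).
    by rewrite ler_wpM2l// lerD.
  rewrite (_ : K * _ = (4 ^+ j * 2 ^+ j.+1)^-1 * (2 * K / (2 * K + 1))); last by ring.
  rewrite ler_piMr ?invr_ge0 ?mulr_ge0 ?exprn_ge0// ler_pdivrMr// mul1r lerDl//.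
- by have [] := HM j n (leq_trans (MN j) Nn).
Qed.

Lemma fast_limit : exists (S : T -> R) (N : nat -> nat),
  [/\ measurable_fun setT S, forall j, (j <= N j)%N &
    forall m : nat -> nat, (forall j, (N j <= m j)%N) -> {ae P, forall w,
      (fun j => shock_sum 0 (m j) w) @ \oo --> S w /\
      (fun j => arrival (m j) w / (m j)%:R) @ \oo --> (1 : R)}].
Proof.
have [N [NS Nj Nratio Nlln]] := fast_indices.
(* An upper limit is defined and measurable everywhere, although the sequence converges only almost
   surely. *)
pose S w := fine (limn_esup (fun j => (shock_sum 0 (N j) w)%:E)).
have mS : measurable_fun setT S.
  apply: measurableT_comp => //; apply: measurable_fun_limn_esup => j.
  by apply/measurable_EFinP; exact: measurable_shock_sum.
exists S, N; split => // m Nm.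
have small (n1 n2 : nat -> nat) : (forall j, (N j <= n1 j <= n2 j)%N) ->
    {ae P, forall w, \forall j \near \oo, `|shock_sum (n1 j) (n2 j) w| <= 2^-1 ^+ j}.
  (* Y j has mean at most 2^(-(j+1)), so it is eventually at most 1/2; then the ratio is at most
     (2^(-j))^2 / 2 and [norm_le_of_ratio] applies with c = 2^(-j). *)
  move=> Nn; pose Y j w := 4 ^+ j * ratio (shock_sum (n1 j) (n2 j) w).
  have mr j : measurable_fun setT (fun w => ratio (shock_sum (n1 j) (n2 j) w)).
    exact: (measurableT_comp mratio (measurable_shock_sum _ _)).
  have br j w : `|ratio (shock_sum (n1 j) (n2 j) w)| <= 1.
    by rewrite ger0_norm ?ratio_ge0 ?ratio_le1.
  have mY j : measurable_fun setT (Y j) by apply: measurable_funM => //; exact: mr.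
  have Y0 j w : 0 <= Y j w by rewrite mulr_ge0 ?exprn_ge0// ratio_ge0.
  have Yle j : (\int[P]_w (Y j w)%:E <= (1 / (2 ^ j.+1)%:R)%:E)%E.
    rewrite -(@EFin_Rintegral_bounded _ _ _ _ _ (4 ^+ j)) //; last first.
      by move=> w; rewrite normrM ger0_norm ?exprn_ge0// ler_piMr ?exprn_ge0.
    rewrite lee_fin /Y RintegralZl//; last exact: (integrable_bounded P (mr j) (br j)).
    rewrite div1r natrX -ler_pdivlMl ?exprn_gt0// -invfM.
    exact: Nratio.
  apply: filterS (ae_cvg0_summable mY Y0 Yle) => w Yw.
  have h : 0 < 2^-1 :> R by rewrite invr_gt0.
  apply: filterS ((cvgr0Pnorm_le _).1 Yw _ h) => j.
  rewrite ger0_norm// /Y => H; apply: norm_le_of_ratio.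
    by rewrite exprn_ge0 ?invr_ge0//= exprn_ile1 ?invr_ge0// invf_le1// ler1n.
  rewrite -exprM mulnC exprM (_ : 2^-1 ^+ 2 = 4^-1); last by rewrite exprVn; congr _^-1; ring.
  by rewrite exprVn ler_pdivlMl ?exprn_gt0.
have lln : {ae P, forall w, lln_error (m j) w @[j --> \oo] --> 0}.
  apply: (@ae_cvg0_summable _ _ _ P (fun j => lln_error (m j))
    (fun j => measurable_lln_error (m j)) (fun j => lln_error_ge0 (m j))).
  move=> j; rewrite -(@EFin_Rintegral_bounded _ _ _ _ _ 1) => [||w]; last 2 first.
  - exact: measurable_lln_error.
  - by rewrite ger0_norm ?lln_error_ge0 ?lln_error_le1.
  by rewrite lee_fin div1r natrX; exact: Nlln.
(* [small] is applied between consecutive N j, which gives the limit, and from N j to m j, which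
   transfers it to m. *)
have sN : forall j, (N j <= N j <= N j.+1)%N by move=> j; rewrite leqnn NS.
have sm : forall j, (N j <= N j <= m j)%N by move=> j; rewrite leqnn Nm.
apply: filterS3 (small _ _ sN) (small _ _ sm) (filterI lln ae_E_gt0) => w hN hm [hl Ew]; split.
  have cN : cvgn (fun j => shock_sum 0 (N j) w).
    apply: cvg_of_dist_geometric; apply: filterS hN => j.
    by rewrite (shock_sum_add _ (NS j)) addrAC subrr add0r.
  have SN : (fun j => shock_sum 0 (N j) w) @ \oo --> S w.
    rewrite /S; have /cvg_limn_einf_sup[_ ->] :
      (shock_sum 0 (N j) w)%:E @[j --> \oo] --> (limn (fun j => shock_sum 0 (N j) w))%:E.
      by apply: cvg_EFin => //; exact: nearW.
    exact: cN.
  have -> : (fun j => shock_sum 0 (m j) w) =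
      (fun j => shock_sum 0 (N j) w + shock_sum (N j) (m j) w).
    by apply/funext => j; rewrite (shock_sum_add _ (Nm j)).
  rewrite -[S w]addr0; apply: cvgD => //; apply/norm_cvg0P.
  apply: (@squeeze_cvgr _ _ _ _ (fun=> 0) (fun j => 2^-1 ^+ j)) => //.
  - by apply: filterS hm => j ->; rewrite normr_ge0.
  - exact: cvg_cst.
  - by apply: cvg_expr; rewrite ger0_norm ?invr_ge0// invf_lt1// ltr1n.
exact: cvg_arrival_of_lln_error.
Qed.

Lemma limit_shock_sum : exists (S : T -> R) (N : nat -> nat),
  [/\ measurable_fun setT S, forall j, (j <= N j)%N,
    forall om t, \int[P]_w cos (om + t * S w) = cos om * renewal_exp a lam t 0 &
    forall m : nat -> nat, (forall j, (N j <= m j)%N) -> {ae P, forall w,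
      (fun j => shock_sum 0 (m j) w) @ \oo --> S w /\
      (fun j => arrival (m j) w / (m j)%:R) @ \oo --> (1 : R)}].
Proof.
have [S [N [mS jN SN]]] := fast_limit; exists S, N; split => // om t.
have Noo : N j @[j --> \oo] --> \oo.
  by move=> A [k _ kA]; exists k => // j /= kj; apply: kA; exact: leq_trans kj (jN j).
have h1 : \int[P]_w cos (om + t * shock_sum 0 (N j) w) @[j --> \oo]
  --> cos om * renewal_exp a lam t 0.
  apply: (@cvg_comp _ _ _ N (fun n => \int[P]_w cos (om + t * shock_sum 0 n w)) _ _ _ Noo);
    exact: cvg_mean_cos_shock_sum.
have cf : continuous (fun x : R => cos (om + t * x)).
  by move=> x; apply: is_derive1_continuous; derive1.
have h2 : \int[P]_w cos (om + t * shock_sum 0 (N j) w) @[j --> \oo]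
  --> \int[P]_w cos (om + t * S w).
  have SNae : {ae P, forall w, (fun j => shock_sum 0 (N j) w) @ \oo --> S w}.
    by apply: filterS (SN N (fun j => leqnn _)) => w [].
  exact: (@cvg_Rintegral_bounded_comp _ _ _ P _ 1 (fun j => shock_sum 0 (N j)) S cf
    (fun x => cos_max _) (fun j => measurable_shock_sum 0 (N j)) mS SNae).
exact: (cvg_unique _ h2 h1).
Qed.

(** The initial convention G_0 = 1 gives X_1 = G_1^a + eps_1, so the formula starts at index 1; the
    summand 1 becomes the location parameter. *)
Lemma processE n w : (forall k, 0 < E k w) ->
  process a E eps n.+1 w = arrival n.+1 w `^ a * (1 + shock_sum 0 n.+1 w).
Proof.
move=> Ew.
have A0 k : 0 < arrival k.+1 w.
  by rewrite arrivalS ltr_wpDl//; apply: sumr_ge0 => i _; exact: ltW.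
have AA k : arrival k.+1 w `^ a * arrival k.+1 w `^ (- a) = 1.
  by rewrite -gt0_powRD// subrr powRr0.
elim: n => [|n IH].
  rewrite shock_sumS// shock_sumxx add0r mulrDr mulr1 mulrCA AA mulr1.
  by rewrite /= /arrival_time divr1 mulr1.
rewrite [LHS]/= -/(process a E eps n.+1 w) IH [shock_sum 0 n.+2 w]shock_sumS// -/(arrival n.+2 w).
have AE : (arrival n.+2 w / arrival n.+1 w) `^ a * arrival n.+1 w `^ a = arrival n.+2 w `^ a.
  rewrite -powRM ?divr_ge0 ?(ltW (A0 _))//.
  by rewrite divfK// gt_eqF// A0.
by rewrite mulrA AE addrA [RHS]mulrDr [in RHS]mulrCA AA mulr1.
Qed.

Lemma scaled_processE n w : (0 < n)%N -> (forall k, 0 < E k w) ->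
  (n%:R `^ a)^-1 * process a E eps n w = (arrival n w / n%:R) `^ a * (1 + shock_sum 0 n w).
Proof.
case: n => // n _ Ew; rewrite processE// mulrA; congr (_ * _).
have A0 : 0 <= arrival n.+1 w by apply: sumr_ge0 => i _; exact: ltW.
by rewrite powRM ?invr_ge0// mulrC -(powR_inv1 (ler0n R n.+1)) -powRrM mulN1r powRN.
Qed.

End marked_renewal.

(** * The limit law of the scaled process *)

Unset Implicit Arguments.

Theorem theorem2p1 (d : measure_display) (T : measurableType d) (R : realType)
    (P : probability T R) (a : R) (E eps : nat -> {RV P >-> R}) :
  2^-1 < a ->
  iid P E ->
  (forall n, same_law (distribution P (E n)) (exponential_prob 1)) ->
  iid P eps ->
  independent_sequences P (arrival_time E) eps ->
  (forall n, same_law (distribution P (eps n)) (distribution P (- eps n))) ->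
  let alpha := a^-1 in
  (forall n, ('E_P[(fun w => `|eps n w| `^ alpha)%R] < +oo)%E) ->
  let X : nat -> {RV P >-> R} := fun n => [the {mfun T >-> R} of process a E eps n] in
  let sigma :=
    (fine 'E_P[(fun w => `|eps 0%N w| `^ alpha)%R]%E / stable_c alpha) `^ a in
  exists mu : probability R R,
    symmetric_stable alpha sigma 1 mu /\
    cvg_in_distribution P (fun n => (n%:R `^ a)^-1 \o* X n) mu.
Proof.
move=> a12 [iE _] lE ieps iEeps sym_eps alpha moment X sigma.
have a0 : 0 < a by apply: lt_trans a12; rewrite invr_gt0.
pose lam : probability R R := distribution P (eps 0%N).
have mpow : measurable_fun setT (fun y : R => (`|y| `^ a^-1)%:E).
  apply/measurable_EFinP.
  by apply: (measurableT_comp (measurable_powR a^-1)); exact: normr_measurable.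
have momentE : ('E_P[(fun w => `|eps 0%N w| `^ alpha)%R] = \int[lam]_y (`|y| `^ a^-1)%:E)%E.
  rewrite unlock /lam ge0_integral_distribution// => y; exact: powR_ge0.
have lam_moment : (\int[lam]_y (`|y| `^ a^-1)%:E < +oo)%E.
  by rewrite -momentE; exact: moment.
have [S [N [mS jN cosS SN]]] := limit_shock_sum a12 iE lE ieps iEeps sym_eps lam_moment.
have mS1 : measurable_fun setT (fun w => 1 + S w) by exact: measurable_funD.
pose Z : {mfun T >-> R} :=
  HB.pack (fun w => 1 + S w) (isMeasurableFun.Build _ _ _ _ _ mS1).
pose mu : probability R R := distribution P Z.
have intmu (f : R -> R) C : measurable_fun setT f -> (forall x, `|f x| <= C) ->
    \int[mu]_x f x = \int[P]_w f (1 + S w).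
  move=> mf fC; rewrite /Rintegral /mu integral_distribution//; first by apply/measurable_EFinP.
  by apply: (@integrable_bounded _ _ _ P (f \o Z) C); [exact: (measurableT_comp mf mS1)|move=> w;
    exact: fC].
exists mu; split.
  move=> t; rewrite /char_fun.
  pose c := renewal_exp a lam t 0.
  have sc : sigma `^ alpha * `|t| `^ alpha =
      `|t| `^ a^-1 * fine (\int[lam]_y (`|y| `^ a^-1)%:E) / stable_c a^-1.
    have al02 : 0 < a^-1 < 2.
      by rewrite invr_gt0 a0/= -[ltRHS]invrK ltf_pV2 ?posrE ?invr_gt0.
    rewrite /sigma momentE -powRrM mulfV ?gt_eqF// powRr1; first by rewrite mulrC mulrA.
    rewrite mulr_ge0//.
      by apply: fine_ge0; apply: integral_ge0 => y _; rewrite lee_fin powR_ge0.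
    (* Cancelling the exponents a and 1/a needs a nonnegative base; the sign of the stable constant
       is read off from its integral form. *)
    rewrite -stable_c_moment// mulr_ge0 ?invr_ge0 ?(ltW a0)//.
    apply: Rintegral_ge0 => x _; rewrite mulr_ge0 ?powR_ge0//.
  rewrite cexp_polar sc -renewal_exp0// -/lam -/c mul1r.
  congr (_ +i* _)%C.
    (* The phase om = t accounts for the location 1 and gives the real part. *)
    transitivity (\int[P]_w cos (t + t * S w)); last by rewrite cosS mulrC.
    under eq_Rintegral do rewrite cexp_i/=.
    rewrite (intmu (fun x => cos (t * x)) 1)//.
    - by apply: eq_Rintegral => w _; rewrite mulrDr mulr1.
    - apply: continuous_measurable_fun => x; apply: is_derive1_continuous; derive1.
    - by move=> x; exact: cos_max.
  (* Shifting the phase by pi / 2 turns cosine into sine and gives the imaginary part. *)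
  transitivity (\int[P]_w cos ((t - pi / 2) + t * S w)); last by rewrite cosS cosBpihalf mulrC.
  under eq_Rintegral do rewrite cexp_i/=.
  rewrite (intmu (fun x => sin (t * x)) 1)//.
  - by apply: eq_Rintegral => w _; rewrite -cosBpihalf mulrDr mulr1 addrAC.
  - apply: continuous_measurable_fun => x; apply: is_derive1_continuous; derive1.
  - by move=> x; exact: sin_max.
move=> f cf [C fC].
have mf := continuous_measurable_fun cf.
have mX n : measurable_fun setT (fun w => (n%:R `^ a)^-1 * X n w).
  by apply: measurable_funM => //; exact: measurable_funPT.
have EE n : ('E_P[f \o ((n%:R `^ a)^-1 \o* X n)%R] = (\int[P]_w f ((n%:R `^ a)^-1 * X n w))%:E)%E.
  rewrite unlock (@EFin_Rintegral_bounded _ _ _ P _ C)//; last first.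
    exact: (measurableT_comp mf (mX n)).
  by apply: eq_integral => w _ /=; rewrite mulrC.
under eq_fun do rewrite EE.
rewrite -(@EFin_Rintegral_bounded _ _ _ mu _ C)//.
apply: cvg_EFin; first exact: nearW.
rewrite (intmu f C)//.
(* The maximum with 1 excludes index 0, to which [scaled_processE] does not apply. *)
apply: (cvg_of_sparse (N := fun j => maxn 1 (N j))) => m Nm.
have Nm' j : (N j <= m j)%N by apply: leq_trans (Nm j); exact: leq_maxr.
have m1 j : (0 < m j)%N by apply: leq_trans (Nm j); exact: leq_maxl.
apply: (@cvg_Rintegral_bounded_comp _ _ _ P f C (fun j w => ((m j)%:R `^ a)^-1 * X (m j) w)
  (fun w => 1 + S w) cf fC _ mS1).
  by move=> j; exact: mX.
apply: filterS2 (SN m Nm') (ae_E_gt0 lE) => w [Sw Gw] Ew.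
rewrite (_ : (fun j => _) = (fun j => (arrival E (m j) w / (m j)%:R) `^ a * (1 + shock_sum a E
  eps 0 (m j) w))); last first.
  by apply/funext => j; exact: scaled_processE.
rewrite -[X in _ --> X]mul1r; apply: cvgM.
  have e1 : 1 = 1 `^ a :> R by rewrite powR1.
  rewrite [X in _ --> X]e1.
  apply: (@cvg_comp _ _ _ _ (fun x : R => x `^ a) _ _ _ Gw).
  by apply: (@is_derive1_continuous R (fun x : R => x `^ a)); derive1.
by apply: cvgD => //; exact: cvg_cst.
Qed.
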